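(* Let $A$ be a selfadjoint positive definite operator in the complex Hilbert space $H$ with dense domain $\mathcal{D}(A)$ and $a_0=\inf_{x\in\mathcal{D}(A),\|x\|=1}(Ax,x)>0$, and let $D\in\mathcal{L}(H_1,H_{-1})$ satisfy, for some $\nu>0$ and all $x\in H_1$, $\operatorname{Re}(Dx,x)_{-1,1}\ge 0$ and $|\operatorname{Im}(Dx,x)_{-1,1}|\le \nu\operatorname{Re}(Dx,x)_{-1,1}$. Suppose $\delta>0$. Then the operator $\mathcal{T}$ is a generator of an (analytic) $C_0$-semigroup $\exp(t\mathcal{T})$ in the space $\mathfrak{H}=H\times H_1$ with exponential decay rate $$\omega=\left(\frac{1}{\beta}+\frac{2}{\sqrt{\alpha\delta}}+\frac{\|D\|^2}{2\delta}+\sqrt{\frac{4\|D\|^2}{\delta\sqrt{\alpha\delta}}+\frac{\|D\|^4}{\delta^2}}\right)^{-1}>0,$$ i.e. there is a constant $C$ such that for all $t\ge0$ the inequality $\|\exp(t\mathcal{T})\|_{\mathfrak{H}}\le C\exp(-\omega t)$ holds. Moreover, for all $b\ge0$ $$\sigma(L)=\sigma(\mathcal{T})\subset\{\lambda\in\mathbb{C}:\ \operatorname{Re}\lambda\le-\omega,\ |\operatorname{Im}\lambda|\le M_b|\operatorname{Re}\lambda|+b\},$$ where $$M_b=\min_{\theta\ge b^2,\ \theta>0}M_{\theta,b},\qquad M_{\theta,b}=\nu+\frac{2}{\delta\left(b+\sqrt{b^2+4\theta}\right)}+\frac{\sqrt{\theta}-b}{\beta}.$$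
   Context: $H$ is a complex Hilbert space with inner product $(\cdot,\cdot)$ and norm $\|\cdot\|$. For $s\ge0$, $H_s$ is $\mathcal{D}(A^{s/2})$ with norm $\|x\|_s=\|A^{s/2}x\|$; for $s<0$, $H_s$ is the completion of $H$ with respect to $\|x\|_s=\|A^{s/2}x\|$. The operator $A$ is regarded as a bounded operator $H_s\to H_{s-2}$ for every $s\in\mathbb{R}$. $(\cdot,\cdot)_{-1,1}$ is the extension by continuity of $(x,y)$, $x\in H$, $y\in H_1$, to a sesquilinear form on $H_{-1}\times H_1$ (the duality between $H_{-1}$ and $H_1$ with pivot space $H$). $\mathcal{L}(X,Y)$ denotes bounded operators from $X$ to $Y$. Constants (infima over $x\in H_1$, $x\ne0$): $$\alpha=\inf\frac{\operatorname{Re}(Dx,x)_{-1,1}}{\|x\|_{-1}^2},\quad \beta=\inf\frac{\operatorname{Re}(Dx,x)_{-1,1}}{\|x\|^2},\quad \delta=\inf\frac{\operatorname{Re}(Dx,x)_{-1,1}}{\|x\|_1^2},$$ and $\|D\|=\sup_{x\in H_1,\|x\|_1=1}\|Dx\|_{-1}$. (One has $\alpha\ge a_0\beta\ge a_0^2\delta\ge0$.) The operator $\mathcal{T}$ in $\mathfrak{H}=H\times H_1$ is $$\mathcal{T}=\begin{pmatrix}-D&-A\\ I&0\end{pmatrix},\quad \mathcal{D}(\mathcal{T})=\left\{\begin{pmatrix}w_1\\ w_2\end{pmatrix}\in H_1\times H_1: Dw_1+Aw_2\in H\right\},$$ that is, $\mathcal{T}(w_1,w_2)^\top=(-(Dw_1+Aw_2),\,w_1)^\top$.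 The quadratic pencil is $L(\lambda)=\lambda^2\mathcal{J}+\lambda D+A\in\mathcal{L}(H_1,H_{-1})$, $\lambda\in\mathbb{C}$, where $\mathcal{J}:H_1\hookrightarrow H_{-1}$ is the embedding operator. Its resolvent set is $\rho(L)=\{\lambda\in\mathbb{C}:\exists\,L^{-1}(\lambda)\in\mathcal{L}(H_{-1},H_1)\}$ and its spectrum is $\sigma(L)=\mathbb{C}\setminus\rho(L)$. *)

(* Defs.v *)
From HB Require Import structures.
From mathcomp Require Export all_boot all_order all_algebra sesquilinear.
From mathcomp Require Export all_classical all_reals all_analysis.
From mathcomp Require Export complex.

Set Implicit Arguments.
Unset Strict Implicit.
Unset Printing Implicit Defensive.

Import Order.TTheory GRing.Theory Num.Theory.
Export numFieldNormedType.Exports.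

Local Open Scope classical_set_scope.
Local Open Scope ring_scope.
Local Open Scope complex_scope.

Local Notation Rea := complex.Re.
Local Notation Ima := complex.Im.

(* A normed module over R[i] has its norm in R[i]; rnorm is the same norm
   as an element of R. *)
Definition rnorm (R : realType) (V : normedModType R[i]) (x : V) : R :=
  Rea `|x|.

(* Inner products are linear in the first variable. *)
Definition hilbert_norm (R : realType) (H : normedModType R[i])
    (ip : {dot H for @Num.conj R[i]}) : Prop :=
  forall x : H, ip x x = `|x| ^+ 2.

Section UnboundedOperators.
Context {R : realType}.

(* The values of opfun outside opdom are irrelevant: every notion below
   only looks at opfun on opdom. *)
Record partial_op (X Y : Type) := PartialOp {
  opdom : set X;
  opfun :> X -> Y
}.

Definition linear_op (X Y : lmodType R[i]) (T : partial_op X Y) : Prop :=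
  opdom T 0 /\
  (forall (a : R[i]) x y, opdom T x -> opdom T y ->
     opdom T (a *: x + y) /\ T (a *: x + y) = a *: T x + T y).

(* T is densely defined and T = T^*, the right-hand side of the equivalence
   being the graph of the adjoint. *)
Definition selfadjoint (H : normedModType R[i])
    (ip : {dot H for @Num.conj R[i]}) (T : partial_op H H) : Prop :=
  [/\ linear_op T, dense (opdom T) &
      forall y z : H, (opdom T y /\ T y = z) <->
        (forall x, opdom T x -> ip (T x) y = ip x z)].

Definition lower_bound (H : normedModType R[i])
    (ip : {dot H for @Num.conj R[i]}) (T : partial_op H H) : R :=
  inf [set Rea (ip (T x) x) | x in [set x | opdom T x /\ `|x| = 1]].

(* S = A^{1/2}: the nonnegative selfadjoint S with S^2 = A, including the
   equality of the domains. *)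
Definition op_sqrt (H : normedModType R[i])
    (ip : {dot H for @Num.conj R[i]}) (A S : partial_op H H) : Prop :=
  [/\ selfadjoint ip S,
      forall x, opdom S x -> 0 <= ip (S x) x,
      forall x, opdom A x <-> (opdom S x /\ opdom S (S x)) &
      forall x, opdom A x -> A x = S (S x)].

Definition op_inv (X : Type) (Y : pointedType) (T : partial_op Y X) (y : X)
  : Y := get [set x | opdom T x /\ T x = y].

Definition resolvent_set (X : normedModType R[i]) (T : partial_op X X) :
    set R[i] :=
  [set l | exists G : {linear X -> X},
     [/\ continuous G,
         forall x, opdom T (G x) /\ T (G x) - l *: G x = x &
         forall x, opdom T x -> G (T x - l *: x) = x]].

Definition spectrum (X : normedModType R[i]) (T : partial_op X X) :
  set R[i] := ~` resolvent_set T.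

End UnboundedOperators.

(* Extension by continuity along e : U -> V of f : U -> W given on P:
   the limit of f u when u stays in P and e u tends to v. *)
Definition cont_ext (U : Type) (V : topologicalType) (W : ptopologicalType)
    (P : set U) (e : U -> V) (f : U -> W) (v : V) : W :=
  lim (f u @[u --> filter_from (nbhs v) (fun B => P `&` e @^-1` B)]).

Section Scale.
Context {R : realType} (H : normedModType R[i]).
Variable ip : {dot H for @Num.conj R[i]}.
Variables (A S : partial_op H H).

(* i1 : H1 -> H presents H1 as the domain of S = A^{1/2} normed by |S x|. *)
Definition is_H1 (H1 : normedModType R[i]) (i1 : {linear H1 -> H}) : Prop :=
  [/\ injective i1, range i1 = opdom S &
      forall x : H1, `|x| = `|S (i1 x)|].

(* j : H -> Hm (Hm complete) presents Hm as the completion of H for the norm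
   |A^{-1/2} x|. *)
Definition is_Hm1 (Hm : completeNormedModType R[i]) (j : {linear H -> Hm})
  : Prop :=
  dense (range j) /\ forall x : H, `|j x| = `|op_inv S x|.

Variables (H1 Hm : normedModType R[i]).
Variables (i1 : {linear H1 -> H}) (j : {linear H -> Hm}).

Definition pairing (f : Hm) (y : H1) : R[i] :=
  cont_ext (W := (R[i] : numFieldType)^o) setT j (fun x : H => ip x (i1 y)) f.

(* A as an operator H1 -> Hm, extended by continuity from its domain. *)
Definition A_ext (x : H1) : Hm :=
  cont_ext [set u : H1 | opdom A (i1 u)] id (fun u => j (A (i1 u))) x.

Variable D : {linear H1 -> Hm}.

Definition rform (x : H1) : R := Rea (pairing (D x) x).
Definition iform (x : H1) : R := Ima (pairing (D x) x).

Definition alpha : R :=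
  inf [set rform x / rnorm (j (i1 x)) ^+ 2 | x in [set x | x != 0]].
Definition beta : R :=
  inf [set rform x / rnorm (i1 x) ^+ 2 | x in [set x | x != 0]].
Definition delta : R :=
  inf [set rform x / rnorm x ^+ 2 | x in [set x | x != 0]].
Definition normD : R := sup [set rnorm (D x) | x in [set x | `|x| = 1]].

Definition omega : R :=
  (beta^-1 + 2 / Num.sqrt (alpha * delta) + normD ^+ 2 / (2 * delta)
   + Num.sqrt (4 * normD ^+ 2 / (delta * Num.sqrt (alpha * delta))
               + normD ^+ 4 / delta ^+ 2))^-1.

Definition M_theta (nu b theta : R) : R :=
  nu + 2 / (delta * (b + Num.sqrt (b ^+ 2 + 4 * theta)))
  + (Num.sqrt theta - b) / beta.

(* M = M_b: a minimum, hence attained. *)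
Definition is_M_min (nu b M : R) : Prop :=
  let E := [set M_theta nu b theta | theta in
              [set theta | b ^+ 2 <= theta /\ 0 < theta]] in
  E M /\ lbound E M.

Definition pencil (l : R[i]) (x : H1) : Hm :=
  l ^+ 2 *: j (i1 x) + l *: D x + A_ext x.

Definition pencil_resolvent_set : set R[i] :=
  [set l | exists G : {linear Hm -> H1},
     [/\ continuous G, cancel G (pencil l) & cancel (pencil l) G]].

Definition pencil_spectrum : set R[i] := ~` pencil_resolvent_set.

(* The inclusions i1 and j are inverted explicitly: w.1 \in H1 means
   w.1 = i1 x, and "D w.1 + A w.2 \in H" means D x + A w.2 = j z. *)
Definition opT : partial_op (H * H1)%type (H * H1)%type :=
  let sum (w : (H * H1)%type) : Hm :=
    D (get [set x | i1 x = w.1]) + A_ext w.2 in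
  PartialOp
    [set w | range i1 w.1 /\ range j (sum w)]
    (fun w => (- get [set z | j z = sum w], get [set x | i1 x = w.1])).

(* The Hilbert norm of H x H1; the library norm on the product is the
   (equivalent) maximum norm. *)
Definition pnorm (w : (H * H1)%type) : R :=
  Num.sqrt (rnorm w.1 ^+ 2 + rnorm w.2 ^+ 2).

End Scale.

Section Semigroups.
Context {R : realType} (X : normedModType R[i]).

Definition C0_semigroup (E : R -> {linear X -> X}) : Prop :=
  [/\ forall t, 0 <= t -> continuous (E t),
      forall x, E 0 x = x,
      forall s t x, 0 <= s -> 0 <= t -> E (s + t) x = E s (E t x) &
      forall x, E t x @[t --> 0^'+] --> x].

Definition is_generator (T : partial_op X X) (E : R -> {linear X -> X})
  : Prop :=
  forall x y, (opdom T x /\ T x = y) <->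
    ((h^-1)%:C *: (E h x - x)) @[h --> 0^'+] --> y.

(* The open sector |arg z| < arctan m. *)
Definition sector (m : R) : set R[i] :=
  [set z | 0 < Rea z /\ `|Ima z| < m * Rea z].

(* E extends to a strongly holomorphic semigroup in some sector. *)
Definition analytic_semigroup (E : R -> {linear X -> X}) : Prop :=
  exists (m : R) (F : R[i] -> {linear X -> X}), 0 < m /\
  [/\ forall t, 0 <= t -> F t%:C =1 E t,
      forall z, sector m z -> continuous (F z),
      forall z w x, sector m z -> sector m w -> F (z + w) x = F z (F w x),
      forall z x, sector m z ->
        derivable (fun u : (R[i] : numFieldType)^o => F u x) z 1 &
      forall x, F z x @[z --> within (sector m)
                  (nbhs (0 : (R[i] : numFieldType)^o))] --> x].

End Semigroups.

(* Main.v *)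
Require Import Defs.
From HB Require Import structures.
From mathcomp Require Import ring lra.
Set Implicit Arguments.
Unset Strict Implicit.
Unset Printing Implicit Defensive.
Import Order.TTheory GRing.Theory Num.Theory.
Local Open Scope classical_set_scope.
Local Open Scope ring_scope.

(** Let B = A^-1 D and let N be A^-1 on H, both with values in H_1. As A is an
    isometry of H_1 onto H_{-1} which turns the duality with H_1 into the inner
    product <.,.>_1, the pencil L(l) becomes l^2 N + l B + 1 on H_1, and T
    maps (x, y), with x in H_1 and Bx + y = Nz, to (-z, x). This reduction rests on
    the projection theorem, which shows that A and its square root are onto
    ([A_surj], [A_ext_surj], [pairing_A]).

    The decay rate comes from a Lyapunov product on H x H_1,
      <w,w'> = (w_1,w'_1) + <w_2,w'_2>_1 + 2 omega ((w_1,w'_2) + (w_2,w'_1)),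
    equivalent to the natural one. On the domain of T,
      - Re <Tw,w> - omega <w,w> >= c (|x|_1^2 + |y|_1^2)
    for some c > 0 ([lyapunov_form]). Once the terms have been bounded by alpha,
    beta, delta and |D|, this says that a binary quadratic form is positive, and the
    given omega satisfies the discriminant condition ([rate_discr]). The form
    <Tw,w'> is also bounded by the H_1 x H_1 norms ([lyap_bounded]). Hence T is
    sectorial for this product, without any shift.

    A sectorial operator generates an analytic semigroup. The exponential is the
    limit of the implicit Euler schemes (1 - 2^-n zT)^(-2^n), for z in a sector
    in which (1 - zT)^-1 is a contraction; the schemes converge at a geometric
    rate on the domain of T^2, since (1 - aT)(1 - bT) = 1 - (a+b)T + ab T^2
    ([JJ_approx], [euler_next]). Each real step of length h contracts by
    (1 + 2 omega h)^(-1/2), and this yields the rate exp(-omega t). Analyticity needs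
    |T exp(tT)| <= K/t, which a discrete energy estimate proves for the schemes with
    K independent of n ([energy_weighted]); then exp(tT) maps into the domain of T^2,
    where differentiability in z is explicit ([F_derivable]).

    The spectra of T and L coincide by elimination of the second component
    ([regular_resolvent], [resolvent_regular]). By the Lax-Milgram lemma, l is
    in the resolvent set of L as soon as |(L(l)y,y)| >= c |y|_1^2 for some
    c > 0. For Re l >= - omega this is the Lyapunov inequality at (l y, y)
    ([halfplane_regular]); outside of the sector it follows from the real and
    imaginary parts of conj(l) (L(l)y,y) ([sector_regular]). The minimum M_b is
    attained by the extreme value theorem ([sector_const_min]). *)

Local Open Scope complex_scope.
Local Notation Rea := complex.Re.
Local Notation Ima := complex.Im.

(** * Real-valued moduli and norms *)

Section Modulus.
Context {R : realType}.
Implicit Types a b z : R[i].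

(** The modulus as an element of R; the norm of R[i] takes values in R[i], where
    the linear arithmetic decision procedures do not apply. *)
Definition modc (z : R[i]) : R := Num.sqrt (Rea z ^+ 2 + Ima z ^+ 2).

Lemma modcE z : `|z| = (modc z)%:C.
Proof. by rewrite normc_def. Qed.

Lemma modc_ge0 z : 0 <= modc z. Proof. exact: sqrtr_ge0. Qed.

Lemma modc_sqr z : modc z ^+ 2 = Rea z ^+ 2 + Ima z ^+ 2.
Proof. by rewrite sqr_sqrtr // addr_ge0 // sqr_ge0. Qed.

Lemma modcM a b : modc (a * b) = modc a * modc b.
Proof. by apply: complexI; rewrite rmorphM /= -!modcE normrM. Qed.

Lemma modcD a b : modc (a + b) <= modc a + modc b.
Proof. by rewrite -lecR rmorphD /= -!modcE ler_normD. Qed.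

Lemma modc0 : modc 0 = 0.
Proof. by apply: complexI; rewrite -modcE normr0. Qed.

Lemma modcN a : modc (- a) = modc a.
Proof. by apply: complexI; rewrite -!modcE normrN. Qed.

Lemma modcR (x : R) : modc x%:C = `|x|.
Proof. by rewrite /modc /= expr0n addr0 sqrtr_sqr. Qed.

Lemma modcV a : modc a^-1 = (modc a)^-1.
Proof. by apply: complexI; rewrite fmorphV /= -!modcE normfV. Qed.

Lemma modc_eq0 a : modc a = 0 -> a = 0.
Proof. by move=> h; apply/eqP; rewrite -normr_eq0 modcE h. Qed.

Lemma ReM a b : Rea (a * b) = Rea a * Rea b - Ima a * Ima b.
Proof. by case: a b => [? ?] [? ?]. Qed.
Lemma ImM a b : Ima (a * b) = Rea a * Ima b + Ima a * Rea b.
Proof. by case: a b => [? ?] [? ?]. Qed.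
Lemma ReD a b : Rea (a + b) = Rea a + Rea b.
Proof. by case: a b => [? ?] [? ?]. Qed.
Lemma ImD a b : Ima (a + b) = Ima a + Ima b.
Proof. by case: a b => [? ?] [? ?]. Qed.
Lemma ReN a : Rea (- a) = - Rea a. Proof. by case: a. Qed.
Lemma ImN a : Ima (- a) = - Ima a. Proof. by case: a. Qed.
Lemma ReJ a : Rea (Num.conj a) = Rea a. Proof. by case: a. Qed.
Lemma ImJ a : Ima (Num.conj a) = - Ima a. Proof. by case: a. Qed.
Lemma modcJ a : modc (Num.conj a) = modc a.
Proof. by rewrite /modc ReJ ImJ sqrrN. Qed.
Definition ReImE := (ReM, ImM, ReD, ImD, ReN, ImN, ReJ, ImJ).

Lemma Re_le_modc z : `|Rea z| <= modc z.
Proof. by rewrite -sqrtr_sqr ler_wsqrtr // lerDl sqr_ge0. Qed.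

Lemma Im_le_modc z : `|Ima z| <= modc z.
Proof. by rewrite -sqrtr_sqr ler_wsqrtr // lerDr sqr_ge0. Qed.

Lemma eq_ReIm a b : Rea a = Rea b -> Ima a = Ima b -> a = b.
Proof. by case: a b => [? ?] [? ?] /= -> ->. Qed.

End Modulus.

Section RealNorm.
Context {R : realType}.
Implicit Types V W : normedModType R[i].

Lemma rnormE V (x : V) : `|x| = (rnorm x)%:C.
Proof. by rewrite /rnorm RRe_real // normr_real. Qed.

Lemma rnorm_ge0 V (x : V) : 0 <= rnorm x.
Proof. by rewrite -ler0c -rnormE. Qed.

Lemma rnormD V (x y : V) : rnorm (x + y) <= rnorm x + rnorm y.
Proof. by rewrite -lecR rmorphD /= -!rnormE ler_normD. Qed.

Lemma rnormZ V a (x : V) : rnorm (a *: x) = modc a * rnorm x.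
Proof. by apply: complexI; rewrite rmorphM /= -modcE -!rnormE normrZ. Qed.

Lemma rnorm0 V : rnorm (0 : V) = 0.
Proof. by rewrite /rnorm normr0. Qed.

Lemma rnormN V (x : V) : rnorm (- x) = rnorm x.
Proof. by rewrite /rnorm normrN. Qed.

Lemma rnorm_scalar (z : R[i]) : rnorm (z : (R[i] : numFieldType)^o) = modc z.
Proof. by rewrite /rnorm [`|_|]modcE. Qed.

Lemma rnormC V (x y : V) : rnorm (x - y) = rnorm (y - x).
Proof. by rewrite -rnormN opprB. Qed.

Lemma rnorm_eq0 V (x : V) : rnorm x = 0 -> x = 0.
Proof. by move=> h; apply/eqP; rewrite -normr_eq0 rnormE h. Qed.

Lemma rnorm_le0 V (x : V) : rnorm x <= 0 -> x = 0.
Proof. by move=> h; apply: rnorm_eq0; apply/le_anti; rewrite h rnorm_ge0. Qed.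

Lemma rnorm_gt0 V (x : V) : x != 0 -> 0 < rnorm x.
Proof.
move=> x0; rewrite lt_def rnorm_ge0 andbT.
by apply: contraNN x0 => /eqP /rnorm_eq0 ->.
Qed.

Lemma rnorm_tri V (x y z : V) : rnorm (x - z) <= rnorm (x - y) + rnorm (y - z).
Proof. by rewrite -[x - z](subrKA y) rnormD. Qed.

Lemma cvg_rnormP V (T : Type) (F : set_system T) {FF : Filter F} (f : T -> V) l :
  f t @[t --> F] --> l <->
  (forall e : R, 0 < e -> \forall t \near F, rnorm (f t - l) < e).
Proof.
split=> [/cvgrPdist_lt h e e0|h].
  have := h e%:C; rewrite ltcR => /(_ e0); apply: filterS => t.
  by rewrite distrC rnormE ltcR.
apply/cvgrPdist_lt => e; rewrite ltcE => /andP[/eqP/= ime ree].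
have := h _ ree; apply: filterS => t.
by rewrite distrC rnormE ltcE /= ime eqxx.
Qed.

Lemma nbhs_rnormP V (x : V) (P : set V) :
  nbhs x P <-> exists2 e : R, 0 < e & forall y, rnorm (y - x) < e -> P y.
Proof.
split.
  move=> /nbhs_normP[e /= e0 h]; exists (Rea e).
    by move: e0; rewrite ltcE => /andP[].
  move=> y yx; apply: h => /=; rewrite distrC rnormE ltcE /= yx andbT.
  by move: e0; rewrite ltcE => /andP[/eqP/= ->].
move=> [e e0 h]; apply/nbhs_normP; exists e%:C => /=; first by rewrite ltcR.
by move=> y /=; rewrite distrC rnormE ltcR => /h.
Qed.

Lemma cvg_rnorm_unique V (u : nat -> V) (l l' : V) :
  u n @[n --> \oo] --> l -> u n @[n --> \oo] --> l' -> l = l'.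
Proof. by move=> h1 h2; apply: (cvg_unique _ h1 h2). Qed.

Lemma linear_continuousP V W (f : {linear V -> W}) :
  continuous f <-> exists2 C : R, 0 < C & forall x, rnorm (f x) <= C * rnorm x.
Proof.
split=> [cf|[C C0 hC]].
  have /nbhs_rnormP[e e0 he] : nbhs (0 : V) (f @^-1` [set y | rnorm (y - f 0) < 1]).
    by apply: (cf 0); apply/nbhs_rnormP; exists 1.
  exists (2 / e) => [|x]; first by rewrite divr_gt0.
  have [->|x0] := eqVneq x 0; first by rewrite linear0 !rnorm0 mulr0.
  have nx := rnorm_gt0 x0.
  pose s : R := e / (2 * rnorm x).
  have s0 : 0 < s by rewrite divr_gt0 // mulr_gt0.
  have := he (s%:C *: x); rewrite subr0 rnormZ modcR gtr0_norm //=.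
  rewrite linear0 subr0 linearZ /= rnormZ modcR gtr0_norm //.
  have -> : s * rnorm x = e / 2 by rewrite /s; field; rewrite gt_eqF.
  move=> /(_ _)/ltW h; have {h} h : s * rnorm (f x) <= 1.
    by apply: h; rewrite ltr_pdivrMr // mulr_natr mulr2n ltrDl.
  have -> : 2 / e * rnorm x = s^-1.
    by rewrite /s; field; rewrite !gt_eqF.
  by rewrite -[leRHS]mul1r ler_pdivlMr // mulrC.
move=> x; apply/cvg_rnormP => e e0; apply/nbhs_rnormP.
exists (e / C) => [|y]; first by rewrite divr_gt0.
rewrite -linearB => h; apply: le_lt_trans (hC _) _.
by rewrite mulrC -ltr_pdivlMr.
Qed.

Lemma dense_rnormP V (E : set V) :
  dense E <-> forall x (e : R), 0 < e -> exists2 y, E y & rnorm (x - y) < e.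
Proof.
split=> [dE x e e0|h].
  have nx : nbhs x [set y | rnorm (x - y) < e].
    by apply/nbhs_rnormP; exists e => // y /=; rewrite rnormC.
  have [y [/= yx Ey]] := dE _ (ex_intro _ x nx) (@open_interior _ _).
  by exists y => //; have := interior_subset yx.
move=> O [x Ox] oO.
have /nbhs_rnormP[e e0 he] : nbhs x O by apply: open_nbhs_nbhs.
have [y Ey xy] := h x e e0.
by exists y; split=> //; apply: he; rewrite rnormC.
Qed.

Definition rcauchy V (u : nat -> V) : Prop :=
  forall e : R, 0 < e -> exists N, forall m n, (N <= m)%N -> (N <= n)%N ->
    rnorm (u m - u n) < e.

Definition seq_complete V : Prop :=
  forall u : nat -> V, rcauchy u -> exists l : V, u n @[n --> \oo] --> l.

Lemma complete_seq_complete (V : completeNormedModType R[i]) : seq_complete V.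
Proof.
move=> u h; suff /cvg_ex[l ul] : cvg (u @ \oo) by exists l.
apply/cauchy_cvgP/cauchy_exP => e; rewrite ltcE => /andP[/eqP/= ime ree].
have [N hN] := h _ ree; exists (u N); exists N => // n /= Nn.
rewrite -ball_normE /= rnormE ltcE /= ime eqxx /=.
exact: hN.
Qed.

End RealNorm.

(** * Inner products and the projection theorem *)

Section Inner.
Context {R : realType} {V : lmodType R[i]}.

(** Positive semidefinite hermitian forms. A plain predicate is used because
    the same theory serves three products: that of H, that of H_1 and the
    Lyapunov product on H x H_1. *)
Definition inner (f : V -> V -> R[i]) : Prop :=
  [/\ forall a u v w, f (a *: u + v) w = a * f u w + f v w,
      forall u v, f v u = Num.conj (f u v) &
      forall u, 0 <= Rea (f u u)].

Definition ipnorm (f : V -> V -> R[i]) (u : V) : R := Num.sqrt (Rea (f u u)).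

Variable f : V -> V -> R[i].
Hypothesis fP : inner f.

Lemma innerDl u v w : f (u + v) w = f u w + f v w.
Proof. by case: fP => h _ _; rewrite -[u]scale1r h mul1r scale1r. Qed.

Lemma inner0l w : f 0 w = 0.
Proof. by apply: (@addrI _ (f 0 w)); rewrite -innerDl !addr0. Qed.

Lemma innerZl a u w : f (a *: u) w = a * f u w.
Proof. by case: fP => h _ _; rewrite -[a *: u]addr0 h inner0l addr0. Qed.

Lemma innerC u v : f v u = Num.conj (f u v).
Proof. by case: fP. Qed.

Lemma innerDr u v w : f w (u + v) = f w u + f w v.
Proof. by rewrite !(innerC _ w) innerDl rmorphD. Qed.

Lemma innerZr a u w : f w (a *: u) = Num.conj a * f w u.
Proof. by rewrite !(innerC _ w) innerZl rmorphM. Qed.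

Lemma inner0r w : f w 0 = 0.
Proof. by rewrite innerC inner0l rmorph0. Qed.

Lemma innerNl u w : f (- u) w = - f u w.
Proof. by rewrite -scaleN1r innerZl mulN1r. Qed.

Lemma innerNr u w : f w (- u) = - f w u.
Proof. by rewrite !(innerC _ w) innerNl rmorphN. Qed.

Lemma innerBl u v w : f (u - v) w = f u w - f v w.
Proof. by rewrite innerDl innerNl. Qed.

Lemma innerBr u v w : f w (u - v) = f w u - f w v.
Proof. by rewrite innerDr innerNr. Qed.

Lemma inner_Im u : Ima (f u u) = 0.
Proof.
have := innerC u u; case: (f u u) => a b [] /eqP.
by rewrite -subr_eq0 opprK -mulr2n mulrn_eq0 => /eqP.
Qed.

Lemma ipnorm_sqr u : ipnorm f u ^+ 2 = Rea (f u u).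
Proof. by rewrite sqr_sqrtr //; case: fP. Qed.

Lemma ipnorm_ge0 u : 0 <= ipnorm f u. Proof. exact: sqrtr_ge0. Qed.

Lemma innerE u : f u u = (ipnorm f u ^+ 2)%:C.
Proof. by rewrite ipnorm_sqr; apply: eq_ReIm => //=; rewrite inner_Im. Qed.

Lemma ipnormD_sqr u v :
  ipnorm f (u + v) ^+ 2 = ipnorm f u ^+ 2 + ipnorm f v ^+ 2 + 2 * Rea (f u v).
Proof.
rewrite !ipnorm_sqr innerDl !innerDr !ReD (innerC u v) ReJ; ring.
Qed.

Lemma ipnormZ a u : ipnorm f (a *: u) = modc a * ipnorm f u.
Proof.
apply/eqP; rewrite -(@eqrXn2 _ 2) ?mulr_ge0 ?ipnorm_ge0 ?modc_ge0 //.
rewrite exprMn !ipnorm_sqr innerZl innerZr !ReImE inner_Im modc_sqr; apply/eqP; ring.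
Qed.

Lemma ipnormN u : ipnorm f (- u) = ipnorm f u.
Proof. by rewrite -scaleN1r ipnormZ modcN (modcR 1) normr1 mul1r. Qed.

Lemma ipnormB_sqr u v :
  ipnorm f (u - v) ^+ 2 = ipnorm f u ^+ 2 + ipnorm f v ^+ 2 - 2 * Rea (f u v).
Proof. by rewrite ipnormD_sqr ipnormN innerNr ReN mulrN. Qed.

Lemma ipnorm_parallelogram u v :
  ipnorm f (u + v) ^+ 2 + ipnorm f (u - v) ^+ 2 = 2 * (ipnorm f u ^+ 2 + ipnorm f v ^+ 2).
Proof. by rewrite ipnormD_sqr ipnormB_sqr; ring. Qed.

(** The quadratic polynomial [t |-> |u - t <u,v> v|^2] is nonnegative; taking its
    value at a well-chosen t also covers a vector v of norm 0. *)
Lemma inner_CS u v : modc (f u v) <= ipnorm f u * ipnorm f v.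
Proof.
rewrite -(@ler_sqr _ (modc _)) ?nnegrE ?mulr_ge0 ?ipnorm_ge0 ?modc_ge0 //.
rewrite exprMn; set c := f u v.
have key (t : R) : 0 <= ipnorm f u ^+ 2 - 2 * t * modc c ^+ 2
                      + t ^+ 2 * modc c ^+ 2 * ipnorm f v ^+ 2.
  have := sqr_ge0 (ipnorm f (u - (t%:C * c) *: v)).
  rewrite ipnormB_sqr innerZr -/c ipnormZ modcM modcR !exprMn real_normK ?num_real //.
  suff -> : Rea (Num.conj (t%:C * c) * c) = t * modc c ^+ 2 by move=> h; lra.
  by rewrite rmorphM !ReImE modc_sqr /=; ring.
have [vv|vv] := eqVneq (ipnorm f v) 0.
  rewrite vv expr0n mulr0; apply: contraT; rewrite -ltNge => c0.
  have := key ((ipnorm f u ^+ 2 + 1) / (2 * modc c ^+ 2)); rewrite vv.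
  suff -> : 2 * ((ipnorm f u ^+ 2 + 1) / (2 * modc c ^+ 2)) * modc c ^+ 2
     = ipnorm f u ^+ 2 + 1 by move=> h; exfalso; lra.
  by field; rewrite -sqrf_eq0 gt_eqF.
have v2 : 0 < ipnorm f v ^+ 2 by rewrite exprn_gt0 // lt_def vv ipnorm_ge0.
have := key (ipnorm f v ^- 2).
set A := ipnorm f u ^+ 2; set B := modc c ^+ 2.
set W := ipnorm f v ^+ 2 in v2 *.
have -> : A - 2 * W^-1 * B + W^-1 ^+ 2 * B * W = (A * W - B) / W.
  by field; rewrite gt_eqF.
by rewrite pmulr_lge0 ?invr_gt0 // subr_ge0.
Qed.

Lemma inner_Re_CS u v : `|Rea (f u v)| <= ipnorm f u * ipnorm f v.
Proof. exact: le_trans (Re_le_modc _) (inner_CS u v). Qed.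

Lemma ipnormD u v : ipnorm f (u + v) <= ipnorm f u + ipnorm f v.
Proof.
rewrite -(@ler_sqr _ (ipnorm f _)) ?nnegrE ?addr_ge0 ?ipnorm_ge0 //.
have := inner_Re_CS u v; rewrite ler_norml => /andP[_ h].
by rewrite ipnormD_sqr; lra.
Qed.

End Inner.

Section Projection.
Context {R : realType} {V : normedModType R[i]}.
Hypothesis Vc : seq_complete V.
Variable f : V -> V -> R[i].
Hypotheses (fP : inner f) (f_norm : forall x, ipnorm f x = rnorm x).

(** The projection theorem in the form in which it yields surjectivity: by the
    parallelogram law a minimizing sequence for the distance from x to M
    is Cauchy, and x minus its limit is orthogonal to M. *)
Lemma closed_subspace_full (M : set V) :
  M 0 -> (forall a u v, M u -> M v -> M (a *: u + v)) ->
  (forall (u : nat -> V) x, (forall n, M (u n)) -> u n @[n --> \oo] --> x -> M x) ->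
  (forall g, (forall m, M m -> f m g = 0) -> g = 0) ->
  forall x, M x.
Proof.
move=> M0 ML Mc Mo x.
pose E := [set rnorm (x - m) | m in M].
have iE : has_inf E.
  by split; [exists (rnorm (x - 0)); exists 0|exists 0 => _ [m _ <-]; exact: rnorm_ge0].
pose d := inf E.
have dle m : M m -> d <= rnorm (x - m) by move=> Mm; apply: (ge_inf iE.2); exists m.
have d0 : 0 <= d by apply: lb_le_inf; [case: iE | move=> _ [m _ <-]; exact: rnorm_ge0].
have /choice[u hu] n : exists m, M m /\ rnorm (x - m) < d + n.+1%:R^-1.
  have n0 : 0 < n.+1%:R^-1 :> R by rewrite invr_gt0.
  by have [_ [m Mm <-] h] := inf_adherent n0 iE; exists m.
have par m n (e : R) : 0 < e -> e <= 1 -> rnorm (x - u m) < d + e ->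
    rnorm (x - u n) < d + e -> rnorm (u m - u n) ^+ 2 <= (8 * d + 4) * e.
  move=> e0 e1 hm hn.
  have := ipnorm_parallelogram fP (x - u m) (x - u n).
  have -> : x - u m - (x - u n) = - (u m - u n).
    by rewrite opprD opprK addrACA subrr add0r opprB addrC.
  pose w := (2^-1 : R[i]) *: (u m + u n).
  have Mw : M w.
    rewrite /w; have -> : (2^-1 : R[i]) *: (u m + u n) = 2^-1 *: u m + 2^-1 *: u n.
      by rewrite scalerDr.
    apply: (ML _ _ _ (hu m).1).
    by rewrite -[_ *: _]addr0; apply: (ML _ _ _ (hu n).1).
  have -> : x - u m + (x - u n) = (2 : R)%:C *: (x - w).
    rewrite scalerBr /w scalerA rmorph_nat divff ?pnatr_eq0 // scale1r.
    by rewrite scaler_nat mulr2n opprD addrACA.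
  rewrite (ipnormN fP). rewrite (ipnormZ fP) // modcR !f_norm ger0_norm // exprMn => par.
  have := dle _ Mw; rewrite -(@ler_sqr _ d) ?nnegrE ?rnorm_ge0 // => dw.
  have sm : rnorm (x - u m) ^+ 2 <= (d + e) ^+ 2.
    by rewrite ler_sqr ?nnegrE ?rnorm_ge0 ?addr_ge0 // ltW.
  have sn : rnorm (x - u n) ^+ 2 <= (d + e) ^+ 2.
    by rewrite ler_sqr ?nnegrE ?rnorm_ge0 ?addr_ge0 // ltW.
  have ee : e ^+ 2 <= e by rewrite expr2 ler_piMl // ltW.
  by nra.
have small (e : R) : 0 < e -> exists N, forall n, (N <= n)%N -> n.+1%:R^-1 < e.
  move=> e0; have [N _ hN] := near_infty_natSinv_lt (PosNum e0).
  by exists N => n Nn; apply: hN.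
have [l ul] : exists l : V, u n @[n --> \oo] --> l.
  apply: Vc => e e0.
  pose s := Num.min 1 (e ^+ 2 / (2 * (8 * d + 4))).
  have d4 : 0 < 8 * d + 4 by lra.
  have s0 : 0 < s by rewrite lt_min ltr01 divr_gt0 // ?exprn_gt0 // mulr_gt0.
  have [N hN] := small _ s0; exists N => m n Nm Nn.
  have hh k : (N <= k)%N -> rnorm (x - u k) < d + s.
    by move=> Nk; apply: lt_le_trans (hu k).2 _; rewrite lerD2l ltW // hN.
  have s1 : s <= 1 by rewrite ge_min lexx.
  have := par m n s s0 s1 (hh _ Nm) (hh _ Nn).
  have s2 : s <= e ^+ 2 / (2 * (8 * d + 4)) by rewrite ge_min lexx orbT.
  have s3 : (8 * d + 4) * s <= e ^+ 2 / 2.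
    rewrite mulrC; apply: le_trans (ler_wpM2r (ltW d4) s2) _.
    by rewrite le_eqVlt; apply/orP; left; apply/eqP; field; rewrite gt_eqF.
  have e2 : 0 < e ^+ 2 by rewrite exprn_gt0.
  move=> h; rewrite -(@ltr_sqr _ (rnorm _)) ?nnegrE ?rnorm_ge0 ?ltW //; lra.
have Ml : M l by apply: (Mc u) => // n; case: (hu n).
have gd : rnorm (x - l) <= d.
  apply/ler_addgt0Pr => e e0.
  have e2 : 0 < e / 2 by rewrite divr_gt0.
  have [N hN] := small _ e2.
  move/cvg_rnormP: ul => /(_ _ e2) [N' _ hN'].
  pose n := maxn N N'.
  have h1 := hN' n (leq_maxr _ _).
  have h2 := hN n (leq_maxl _ _).
  have := rnorm_tri x (u n) l; have := (hu n).2; rewrite /= in h1.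
  move: h1 h2; move: (n.+1%:R^-1) (rnorm (x - u n)) (rnorm (u n - l)) => r1 r2 r3; lra.
suff -> : x = l by [].
apply/eqP; rewrite -subr_eq0; apply/eqP; apply: Mo => m Mm.
set g := x - l in gd *; rewrite (innerC fP g).
have [->|c0] := eqVneq (f g m) 0; first by rewrite rmorph0.
exfalso; set c := f g m in c0.
have c2 : 0 < modc c ^+ 2.
  rewrite exprn_gt0 // lt_def modc_ge0 andbT.
  by apply: contraNN c0 => /eqP /modc_eq0 ->.
pose t : R := (rnorm m ^+ 2 + 1)^-1.
have m0 : 0 < rnorm m ^+ 2 + 1 by rewrite ltr_wpDl // sqr_ge0.
have t0 : 0 < t by rewrite invr_gt0.
have h1 : rnorm g <= rnorm (g - (t%:C * c) *: m).
  apply: le_trans gd _.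
  have -> : g - (t%:C * c) *: m = x - ((t%:C * c) *: m + l).
    by rewrite /g opprD addrA addrAC.
  by apply: dle; apply: ML.
have := h1; rewrite -ler_sqr ?nnegrE ?rnorm_ge0 // -!f_norm.
rewrite (ipnormB_sqr fP g (_ *: _)) (innerZr fP) -/c (ipnormZ fP).
rewrite modcM modcR !exprMn real_normK ?num_real //.
rewrite !f_norm.
have -> : Rea (Num.conj (t%:C * c) * c) = t * modc c ^+ 2.
  by rewrite rmorphM !ReImE modc_sqr /=; ring.
have tm : t * rnorm m ^+ 2 <= 1.
  by rewrite mulrC ler_pdivrMr // mul1r lerDl.
have : t * modc c ^+ 2 * (t * rnorm m ^+ 2) <= t * modc c ^+ 2.
  by rewrite ler_piMr // mulr_ge0 // ltW.
have : 0 < t * modc c ^+ 2 by rewrite mulr_gt0.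
rewrite !expr2; lra.
Qed.

Definition closed_op (T : partial_op V V) : Prop :=
  forall (u : nat -> V) x y, (forall n, opdom T (u n)) ->
    u n @[n --> \oo] --> x -> T (u n) @[n --> \oo] --> y -> opdom T x /\ T x = y.

(** Being bounded below makes the range of a closed operator closed, so that the
    projection theorem applies to the range. *)
Lemma closed_op_surj (T : partial_op V V) (c : R) :
  linear_op T -> closed_op T -> 0 < c ->
  (forall x, opdom T x -> c * rnorm x <= rnorm (T x)) ->
  (forall g, (forall x, opdom T x -> f (T x) g = 0) -> g = 0) ->
  forall y, exists2 x, opdom T x & T x = y.
Proof.
move=> [T0 TL] Tc c0 Tb To.
have TB x y : opdom T x -> opdom T y -> opdom T (x - y) /\ T (x - y) = T x - T y.
  move=> Tx Ty; have := TL (-1) y x Ty Tx.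
  by rewrite !scaleN1r ![- _ + _]addrC.
apply: (@closed_subspace_full [set y | exists2 x, opdom T x & T x = y]).
- exists 0 => //; have := (TL (-1) 0 0 T0 T0).2.
  by rewrite scaler0 addr0 scaleN1r addNr.
- move=> a _ _ [x Tx <-] [y Ty <-]; have [h1 h2] := TL a x y Tx Ty.
  by exists (a *: x + y).
- move=> w y hw wy.
  have /choice[u hu] n : exists x, opdom T x /\ T x = w n.
    by have [x] := hw n; exists x.
  have [x ux] : exists x : V, u n @[n --> \oo] --> x.
    apply: Vc => e e0; move/cvg_rnormP: (wy) => /(_ (c * e / 2)).
    have ce : 0 < c * e / 2 by rewrite divr_gt0 // mulr_gt0.
    move=> /(_ ce)[N _ hN]; exists N => m n Nm Nn.
    have [um wm] := hu m; have [un wn] := hu n.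
    have [h1 h2] := TB _ _ um un.
    have := Tb _ h1; rewrite h2 wm wn.
    have := rnorm_tri (w m) y (w n); rewrite (rnormC y).
    have := hN m Nm; have := hN n Nn; rewrite /= => a1 a2 a3 a4.
    by rewrite -(ltr_pM2l c0); lra.
  have hu1 n : opdom T (u n) by case: (hu n).
  have [h1 h2] : opdom T x /\ T x = y.
    apply: (Tc u) => //; suff -> : (fun n => T (u n)) = w by [].
    by apply/funext => n; case: (hu n).
  by exists x.
- by move=> g hg; apply: To => x Tx; apply: hg; exists x.
Qed.

(** The Lax-Milgram lemma, with the modulus of the form instead of its real part:
    coercivity bounds P below, and a vector orthogonal to the range of P is
    orthogonal to its own image. *)
Lemma coercive_surj (P : {linear V -> V}) (c : R) : continuous P -> 0 < c ->
  (forall x, c * rnorm x ^+ 2 <= modc (f (P x) x)) ->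
  forall y, exists x, P x = y.
Proof.
move=> Pc c0 Pb y; have [||||x _ <-] := @closed_op_surj (PartialOp setT P) c _ _ c0 _ _ y.
- by split=> // a u v _ _; split=> //=; rewrite linearP.
- move=> u x z _ ux uz; split=> //=; apply: (@cvg_rnorm_unique _ _ (P \o u)) => //.
  exact: (cvg_comp _ _ ux (Pc x)).
- move=> x _ /=; have := Pb x; have := inner_CS fP (P x) x; rewrite !f_norm.
  have [->|/rnorm_gt0 x0] := eqVneq x 0; first by move=> _ _; rewrite rnorm0 mulr0 rnorm_ge0.
  move=> h1 h2; rewrite -(ler_pM2r x0) -mulrA -expr2; exact: le_trans h2 h1.
- move=> g hg; have := Pb g; have /= -> := hg g I.
  rewrite modc0 => h; apply: rnorm_eq0; apply/eqP; rewrite -sqrf_eq0.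
  by rewrite eq_le sqr_ge0 andbT -(ler_pM2l c0) mulr0.
by exists x.
Qed.

End Projection.

(** * Sectors and seminorms *)

Lemma ex_linear (K : pzRingType) (U V : lmodType K) (g : U -> V) :
  linear g -> exists h : {linear U -> V}, h =1 g.
Proof.
move=> gL.
pose h : {linear U -> V} := HB.pack g (GRing.isLinear.Build K U V *:%R g gL).
by exists h.
Qed.

Lemma subrACA (V : zmodType) (a b c d : V) : a - b - (c - d) = a - c - (b - d).
Proof. by rewrite !opprB addrACA [RHS]addrACA [- b - c]addrC. Qed.

Section Sector.
Context {R : realType}.
Implicit Types (z w : R[i]) (m t : R).

Lemma sectorD m z w : sector m z -> sector m w -> sector m (z + w).
Proof.
move=> [z0 hz] [w0 hw]; split; rewrite !ReImE /=; first exact: addr_gt0.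
by apply: le_lt_trans (ler_normD _ _) _; rewrite mulrDr ltrD.
Qed.

Lemma sectorZ m t z : 0 < t -> sector m z -> sector m (t%:C * z).
Proof.
move=> t0 [z0 hz]; split; rewrite !ReImE /= !mul0r ?subr0 ?addr0.
  exact: mulr_gt0.
by rewrite normrM gtr0_norm // mulrCA ltr_pM2l.
Qed.

Lemma sectorR m t : 0 < m -> 0 < t -> sector m t%:C.
Proof. by move=> m0 t0; split=> //=; rewrite normr0 mulr_gt0. Qed.

Lemma sector_neq0 m z : sector m z -> z != 0.
Proof. by move=> [z0 _]; apply: contraTN z0 => /eqP ->; rewrite /= ltxx. Qed.

Lemma sector_near m z : 0 < m -> sector m z ->
  exists2 e : R, 0 < e & forall w, modc w <= e -> sector m (z + w).
Proof.
move=> m0 [z0 hz].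
pose e := Num.min (Rea z / 2) ((m * Rea z - `|Ima z|) / (2 * (m + 1))).
have d0 : 0 < m * Rea z - `|Ima z| by rewrite subr_gt0.
exists e => [|w we].
  by rewrite lt_min !divr_gt0 //= mulr_gt0 // addr_gt0.
have := Re_le_modc w; have := Im_le_modc w.
have e1 : e <= Rea z / 2 by rewrite ge_min lexx.
have : e <= (m * Rea z - `|Ima z|) / (2 * (m + 1)) by rewrite ge_min lexx orbT.
rewrite ler_pdivlMr ?mulr_gt0 ?addr_gt0 // => e2 iw rw.
have h1 : - Rea w <= e by apply: le_trans (le_trans rw we); rewrite -normrN ler_norm.
split; rewrite !ReImE /=; first by lra.
apply: le_lt_trans (ler_normD _ _) _.
have : m * - Rea w <= m * e by rewrite ler_pM2l.
lra.
Qed.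

End Sector.

Section Seminorm.
Context {R : realType} {X : lmodType R[i]}.

Definition seminorm (q : X -> R) : Prop :=
  (forall x y, q (x + y) <= q x + q y) /\
  (forall a x, q (a *: x) = modc a * q x).

Variable q : X -> R.
Hypothesis qP : seminorm q.
Implicit Types U V : X -> X.

Lemma semiD x y : q (x + y) <= q x + q y. Proof. by case: qP. Qed.
Lemma semiZ a x : q (a *: x) = modc a * q x. Proof. by case: qP. Qed.
Lemma semiZr (t : R) x : 0 <= t -> q (t%:C *: x) = t * q x.
Proof. by move=> t0; rewrite semiZ modcR ger0_norm. Qed.
Lemma semi0 : q 0 = 0.
Proof. by rewrite -(scale0r 0) semiZ modc0 mul0r. Qed.
Lemma semiN x : q (- x) = q x.
Proof. by rewrite -scaleN1r semiZ modcN (modcR 1) normr1 mul1r. Qed.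
Lemma semi_ge0 x : 0 <= q x.
Proof. by have := semiD x (- x); rewrite subrr semi0 semiN; lra. Qed.
Lemma semiC x y : q (x - y) = q (y - x).
Proof. by rewrite -semiN opprB. Qed.
Lemma semiB x y : q (x - y) <= q x + q y.
Proof. by rewrite -(semiN y) semiD. Qed.
Lemma semi_tri y x z : q (x - z) <= q (x - y) + q (y - z).
Proof. by rewrite -[x - z](subrKA y) semiD. Qed.

Definition contr U : Prop := forall x, q (U x) <= q x.

Lemma iter_contr U N : contr U -> contr (iter N U).
Proof. by move=> hU x; elim: N => //= N IH; apply: le_trans (hU _) IH. Qed.

Lemma iter_commute U V N x : (forall x, U (V x) = V (U x)) ->
  U (iter N V x) = iter N V (U x).
Proof. by move=> UV; elim: N => //= N IH; rewrite UV IH. Qed.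

Lemma iter_sub U N : {morph U : x y / x - y} -> {morph iter N U : x y / x - y}.
Proof. by move=> hU x y; elim: N => //= N ->; rewrite hU. Qed.

Lemma iter_comp U V N x : (forall x, U (V x) = V (U x)) ->
  iter N (U \o V) x = iter N U (iter N V x).
Proof.
move=> UV; elim: N x => //= N IH x; rewrite IH; congr (U _).
by rewrite iter_commute // => y; exact/esym.
Qed.

(** Telescoping: U^N - V^N is the sum of the U^k V^(N-1-k) (U - V), whose factors
    commute. This turns the errors of single steps into errors of the scheme. *)
Lemma iter_diff U V N x :
  contr U -> contr V -> {morph U : x y / x - y} -> {morph V : x y / x - y} ->
  (forall x, U (V x) = V (U x)) ->
  q (iter N U x - iter N V x) <= N%:R * q (U x - V x).
Proof.
move=> hU hV Us Vs UV; elim: N => [|N IH] /=.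
  by rewrite subrr mul0r semi0.
apply: le_trans (semi_tri (U (iter N V x)) _ _) _.
rewrite -Us (iter_commute _ _ UV) -[V (iter N V x)]iterS iterSr -iter_sub //.
rewrite mulrS mulrDl mul1r addrC.
by rewrite lerD ?iter_contr // (le_trans (hU _)).
Qed.

End Seminorm.

(** * Analytic semigroups by the implicit Euler scheme *)

Section Euler.
Context {R : realType} {X : normedModType R[i]}.
Hypothesis Xc : seq_complete X.
Variables (q : X -> R) (c1 c2 : R).
Hypotheses (qP : seminorm q) (c1_gt0 : 0 < c1) (c2_gt0 : 0 < c2)
  (le_q : forall x, rnorm x <= c1 * q x) (q_le : forall x, q x <= c2 * rnorm x).
Variables (T : partial_op X X) (m : R) (J : R[i] -> {linear X -> X}).
Hypotheses (T_lin : linear_op T) (T_dense : dense (opdom T)) (m_gt0 : 0 < m).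
(** J z is the resolvent (1 - zT)^-1. *)
Hypothesis JT : forall z, sector m z ->
  [/\ forall x, opdom T (J z x) /\ J z x - z *: T (J z x) = x,
      forall x, opdom T x -> J z (x - z *: T x) = x &
      contr q (J z)].

Local Notation S := (sector m).
Local Notation qD := (semiD qP).
Local Notation qB := (semiB qP).
Local Notation qZ := (semiZ qP).
Local Notation q_ge0 := (semi_ge0 qP).
Local Notation qtri := (semi_tri qP).

Lemma cvg_qP (I : Type) (F : set_system I) {FF : Filter F} (g : I -> X) l :
  g t @[t --> F] --> l <->
  (forall e : R, 0 < e -> \forall t \near F, q (g t - l) < e).
Proof.
split=> [/cvg_rnormP h e e0|h].
  have := h (e / c2) (divr_gt0 e0 c2_gt0); apply: filterS => t.
  by rewrite ltr_pdivlMr // mulrC; apply: le_lt_trans.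
apply/cvg_rnormP => e e0.
have := h (e / c1) (divr_gt0 e0 c1_gt0); apply: filterS => t.
by rewrite ltr_pdivlMr // mulrC; apply: le_lt_trans.
Qed.

Lemma q_eq0 x : q x <= 0 -> x = 0.
Proof.
move=> qx; apply: rnorm_le0; apply: le_trans (le_q x) _.
by rewrite pmulr_rle0.
Qed.

Lemma domB x y : opdom T x -> opdom T y ->
  opdom T (x - y) /\ T (x - y) = T x - T y.
Proof.
move=> Tx Ty; have := T_lin.2 (-1) y x Ty Tx.
by rewrite !scaleN1r ![- _ + _]addrC.
Qed.

Lemma J_dom z x : S z -> opdom T (J z x).
Proof. by move=> /JT[h _ _]; case: (h x). Qed.

Lemma J_eq z x : S z -> J z x = x + z *: T (J z x).
Proof. by move=> /JT[h _ _]; case: (h x) => _ {2}<-; rewrite subrK. Qed.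

Lemma J_id z x : S z -> opdom T x -> J z (x - z *: T x) = x.
Proof. by move=> /JT[_ h _]; apply: h. Qed.

Lemma J_contr z : S z -> contr q (J z). Proof. by move=> /JT[]. Qed.

Lemma J_sub z : {morph J z : x y / x - y}. Proof. exact: linearB. Qed.

Lemma TJ z x : S z -> opdom T x -> T (J z x) = J z (T x).
Proof.
move=> Sz Tx; apply: (scalerI (sector_neq0 Sz)).
apply: (@addrI _ x); rewrite -J_eq //.
rewrite -linearZ_LR.
rewrite -{2}[x](J_id Sz Tx) J_sub subrK.
by [].
Qed.

(** Both sides solve (1 - bT) y = J a x. *)
Lemma JC a b x : S a -> S b -> J a (J b x) = J b (J a x).
Proof.
move=> Sa Sb; set y := J a _.
have Ty : opdom T y by apply: J_dom.
rewrite -(J_id Sb Ty) /y (TJ Sa (J_dom x Sb)) -linearZ_LR -J_sub.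
by congr (J b (J a _)); rewrite {1}J_eq // addrK.
Qed.

Definition dom2 (x : X) : Prop := opdom T x /\ opdom T (T x).

Lemma J_dom2 z x : S z -> opdom T x -> dom2 (J z x).
Proof. by move=> Sz Tx; split; rewrite ?TJ //; apply: J_dom. Qed.

Lemma J_approx z x : S z -> opdom T x -> q (J z x - x) <= modc z * q (T x).
Proof.
move=> Sz Tx; rewrite {1}J_eq // addrC addKr TJ // qZ.
by rewrite ler_wpM2l ?modc_ge0 // J_contr.
Qed.

(** The difference is - ab J a J b J (a + b) T^2 x, because
    (1 - aT)(1 - bT) = 1 - (a + b)T + ab T^2. *)
Lemma JJ_approx a b x : S a -> S b -> dom2 x ->
  q (J a (J b x) - J (a + b) x) <= modc a * modc b * q (T (T x)).
Proof.
move=> Sa Sb [Tx TTx]; have Sab := sectorD Sa Sb.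
pose w := J (a + b) x.
have Tw : opdom T w by apply: J_dom.
have TwE : T w = J (a + b) (T x) by rewrite TJ.
have TTw : opdom T (T w) by rewrite TwE; apply: J_dom.
have [Tv TvE] : opdom T (w - b *: T w) /\
    T (w - b *: T w) = T w - b *: T (T w).
  have := T_lin.2 (- b) (T w) w TTw Tw.
  by rewrite !scaleNr ![- _ + _]addrC.
have E : w - b *: T w - a *: T (w - b *: T w) = x + (a * b) *: T (T w).
  rewrite TvE scalerBr scalerA opprB {1}/w J_eq // -/w scalerDl.
  by rewrite [x + (_ + _)]addrA addrK addrACA subrr addr0.
have := J_id Sb Tw; rewrite -{1}(J_id Sa Tv) E.
rewrite !linearD !linearZ_LR /= => wE.
have -> : J (a + b) x = w by [].
rewrite -wE (JC _ Sa Sb) opprD addrA subrr add0r semiN // qZ modcM.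
rewrite ler_wpM2l ?mulr_ge0 ?modc_ge0 //.
rewrite TwE TJ //; do 3 (apply: le_trans (J_contr _ _) _ => //).
Qed.

(** The n-th approximation of exp(zT) makes 2^n steps, so that one step of the n-th
    scheme is compared with two steps of the next one. *)
Definition step (n : nat) (z : R[i]) : R[i] := ((2^-1 : R) ^+ n)%:C * z.
Definition euler (n : nat) (z : R[i]) (x : X) : X :=
  iter (2 ^ n) (J (step n z)) x.

Lemma half_gt0 n : 0 < (2^-1 : R) ^+ n. Proof. by rewrite exprn_gt0. Qed.

Lemma half_small (e : R) : 0 < e -> exists N, forall n, (N <= n)%N ->
  (2^-1 : R) ^+ n < e.
Proof.
move=> e0.
have /cvgrPdist_lt/(_ e e0) [N _ hN] :
    (fun n => (2^-1 : R) ^+ n) @ \oo --> (0 : R).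
  by apply: cvg_expr; rewrite ger0_norm // invf_lt1 // ltr1n.
exists N => n Nn; have := hN n Nn.
by rewrite /= sub0r normrN ger0_norm // ltW ?half_gt0.
Qed.

Lemma count_half n : (2 ^ n)%:R * (2^-1 : R) ^+ n = 1.
Proof. by rewrite natrX -exprMn divff ?expr1n // pnatr_eq0. Qed.

Lemma step_sector n z : S z -> S (step n z).
Proof. by apply: sectorZ; rewrite half_gt0. Qed.

Lemma modc_step n z : modc (step n z) = (2^-1) ^+ n * modc z.
Proof. by rewrite modcM modcR ger0_norm // ltW ?half_gt0. Qed.

Lemma euler_contr n z : S z -> contr q (euler n z).
Proof. by move=> Sz; apply/iter_contr/J_contr/step_sector. Qed.

Lemma euler_linear n z : linear (euler n z).
Proof.
rewrite /euler => a x y; elim: (2 ^ n)%N => //= N ->.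
by rewrite linearP.
Qed.

Lemma euler_sub n z : {morph euler n z : x y / x - y}.
Proof. by apply: iter_sub; exact: J_sub. Qed.

Lemma euler_dom n z x : S z -> opdom T x ->
  opdom T (euler n z x) /\ T (euler n z x) = euler n z (T x).
Proof.
move=> Sz Tx; rewrite /euler; elim: (2 ^ n)%N => //= N [h1 h2].
by split; [apply: J_dom|rewrite TJ // ?h2 //]; exact: step_sector.
Qed.

Lemma euler_approx n z x : S z -> opdom T x ->
  q (euler n z x - x) <= modc z * q (T x).
Proof.
move=> Sz Tx; have Sn := step_sector n Sz.
have -> : euler n z x - x = iter (2 ^ n) (J (step n z)) x - iter (2 ^ n) id x.
  by congr (_ - _); elim: (2 ^ n)%N => //= N <-.
apply: le_trans (iter_diff qP _ _ (J_contr Sn) _ (J_sub _) _ _) _ => //.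
apply: le_trans (ler_wpM2l (ler0n _ _) (J_approx Sn Tx)) _.
by rewrite modc_step mulrA mulrA count_half mul1r.
Qed.

(** Each of the 2^n steps contributes an error O(4^-n), whence the geometric rate of
    convergence on the domain of T^2. *)
Lemma euler_next n z x : S z -> dom2 x ->
  q (euler n.+1 z x - euler n z x) <=
    (2^-1) ^+ n * (modc z ^+ 2 / 4 * q (T (T x))).
Proof.
move=> Sz x2; have S1 := step_sector n.+1 Sz; have S0 := step_sector n Sz.
rewrite {1}/euler expnSr iterM.
have -> : iter (2 ^ n) (iter 2 (J (step n.+1 z))) x =
          iter (2 ^ n) (J (step n.+1 z) \o J (step n.+1 z)) x by [].
have E : step n z = step n.+1 z + step n.+1 z.
  rewrite /step -mulrDl -rmorphD; congr (_%:C * _); rewrite exprS; lra.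
apply: le_trans (iter_diff qP _ _ _ (J_contr S0) _ (J_sub _) _) _ => /=.
- by move=> y /=; apply: le_trans (J_contr S1 _) (J_contr S1 _).
- by move=> y w /=; rewrite !J_sub.
- by move=> y; rewrite (JC y S1 S0) (JC _ S1 S0).
have := ler_wpM2l (ler0n _ (2 ^ n)) (JJ_approx S1 S1 x2); rewrite -E.
move/le_trans; apply; rewrite modc_step exprS.
rewrite le_eqVlt; apply/orP; left; apply/eqP.
transitivity ((2 ^ n)%:R * (2^-1 : R) ^+ n *
   ((2^-1) ^+ n * (modc z ^+ 2 / 4 * q (T (T x))))); first by field.
by rewrite count_half mul1r.
Qed.

Lemma euler_far n k z x : S z -> dom2 x ->
  q (euler (n + k) z x - euler n z x) <=
    ((2^-1) ^+ n - (2^-1) ^+ (n + k)) * (modc z ^+ 2 / 2 * q (T (T x))).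
Proof.
move=> Sz x2; elim: k => [|k IH]; first by rewrite addn0 !subrr mul0r semi0.
apply: le_trans (qtri (euler (n + k) z x) _ _) _.
apply: le_trans (lerD _ IH) _; first by rewrite addnS; exact: euler_next.
by rewrite addnS [in leRHS]exprS le_eqVlt; apply/orP; left; apply/eqP; field.
Qed.

Lemma euler_far2 n k z x : S z -> dom2 x -> (n <= k)%N ->
  q (euler k z x - euler n z x) <= (2^-1) ^+ n * (modc z ^+ 2 / 2 * q (T (T x))).
Proof.
move=> Sz x2 nk; rewrite -(subnKC nk); apply: le_trans (euler_far _ _ Sz x2) _.
apply: ler_wpM2r.
  by apply: mulr_ge0 (q_ge0 _); apply: divr_ge0 (sqr_ge0 _) _.
by rewrite lerBlDr lerDl ltW // half_gt0.
Qed.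

(** J t x tends to x as t decreases to 0, and J t maps the domain of T into that
    of T^2. *)
Lemma dom2_dense x (e : R) : 0 < e -> exists2 y, dom2 y & q (x - y) < e.
Proof.
move=> e0; have e2 : 0 < e / 2 by rewrite divr_gt0.
have [y Ty xy] := (dense_rnormP _).1 T_dense x _ (divr_gt0 e2 c2_gt0).
have {}xy : q (x - y) < e / 2.
  by move: xy; rewrite ltr_pdivlMr // mulrC; apply: le_lt_trans.
pose t := e / 2 / (q (T y) + 1).
have k0 : 0 < q (T y) + 1 by rewrite ltr_wpDl ?q_ge0.
have t0 : 0 < t by rewrite divr_gt0.
have St := sectorR m_gt0 t0.
exists (J t%:C y); first exact: J_dom2.
apply: le_lt_trans (qtri y _ _) _; rewrite (semiC qP y).
have := J_approx St Ty; rewrite modcR gtr0_norm // => h.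
have : t * q (T y) <= e / 2.
  by rewrite -[leRHS](divfK (lt0r_neq0 k0)) -/t ler_pM2l // lerDl.
lra.
Qed.

Lemma dense_dom2 (g : X -> X) (K : R) : 0 <= K ->
  (forall x y, q (g x - g y) <= K * q (x - y)) ->
  (forall x, dom2 x -> g x = 0) -> forall x, g x = 0.
Proof.
move=> K0 gK g0 x; apply: q_eq0; apply/ler_addgt0Pr => e e0; rewrite add0r.
have K1 : 0 < K + 1 by rewrite ltr_wpDl.
have [y y2 xy] := dom2_dense x (divr_gt0 e0 K1).
have := gK x y; rewrite (g0 y) // subr0 => h; apply: le_trans h _.
move: xy; rewrite ltr_pdivlMr // => h.
have := q_ge0 (x - y); nra.
Qed.

(** The approximations are equicontinuous and converge on a dense set. *)
Lemma euler_cvg z x : S z -> exists l : X, euler n z x @[n --> \oo] --> l.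
Proof.
move=> Sz; apply: Xc => e e0.
pose s := e / c1 / 3; have s0 : 0 < s by rewrite !divr_gt0.
have [y y2 xy] := dom2_dense x s0.
pose B := modc z ^+ 2 / 2 * q (T (T y)) + 1.
have B0 : 0 < B by rewrite ltr_wpDl // mulr_ge0 ?divr_ge0 ?sqr_ge0 ?q_ge0.
have sB : 0 < s / 2 / B by rewrite !divr_gt0.
have [N hN] := half_small sB; exists N => i j Ni Nj.
have near k : (N <= k)%N -> q (euler k z y - euler N z y) < s / 2.
  move=> Nk; apply: le_lt_trans (euler_far2 Sz y2 Nk) _.
  have := hN N (leqnn N); rewrite ltr_pdivlMr // /B.
  by have := half_gt0 N; lra.
have cl k : q (euler k z x - euler k z y) < s.
  by rewrite -euler_sub; apply: le_lt_trans (euler_contr _ Sz _) xy.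
apply: le_lt_trans (le_q _) _; rewrite mulrC -ltr_pdivlMr //.
have -> : e / c1 = s + (s / 2 + s / 2 + s) by rewrite /s; field; rewrite gt_eqF.
apply: le_lt_trans (qtri (euler i z y) _ _) _; apply: ltrD => //.
apply: le_lt_trans (qtri (euler j z y) _ _) _; apply: ltrD.
  apply: le_lt_trans (qtri (euler N z y) _ _) _; apply: ltrD; first exact: near.
  by rewrite semiC //; exact: near.
by rewrite semiC //; exact: cl.
Qed.

Lemma ex_limit z : exists E : {linear X -> X},
  (S z -> forall x, euler n z x @[n --> \oo] --> E x) /\
  (~ S z -> forall x, E x = x).
Proof.
have [Sz|nSz] := pselect (S z); last first.
  by exists idfun; split.
have /choice[g gP] x := euler_cvg x Sz.
have [|h hg] := @ex_linear _ _ _ g.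
  move=> a x y; apply: (cvg_rnorm_unique (gP _)).
  rewrite (_ : (fun n => _) = (fun n => a *: euler n z x + euler n z y)).
    by apply: cvgD => //; apply: cvgZr.
  by apply/funext => n; rewrite euler_linear.
by exists h; split=> // _ x; rewrite hg.
Qed.

Lemma lim_q (u : nat -> X) (l y : X) (B : R) : u n @[n --> \oo] --> l ->
  (exists N, forall n, (N <= n)%N -> q (u n - y) <= B) -> q (l - y) <= B.
Proof.
move=> /cvg_qP ul [N hN]; apply/ler_addgt0Pr => e e0.
have [M _ hM] := ul e e0.
have := hM (maxn N M) (leq_maxr _ _); rewrite /= semiC // => h.
have := hN _ (leq_maxl N M); have := qtri (u (maxn N M)) l y; lra.
Qed.

(** T is closed because it has a bounded resolvent: x = J 1 (x - Tx). *)
Lemma T_closed : closed_op T.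
Proof.
move=> u x y Tu ux uy.
have S1 : S (1 : R)%:C := sectorR m_gt0 ltr01.
suff E : J (1 : R)%:C (x - y) = x.
  have Tx : opdom T x by rewrite -E; apply: J_dom.
  split=> //; have := J_eq (x - y) S1; rewrite E rmorph1 scale1r => h.
  by apply: (@addrI _ (x - y)); rewrite -h subrK.
have uxy : u n - T (u n) @[n --> \oo] --> x - y by apply: cvgB.
apply/eqP; rewrite -subr_eq0; apply/eqP; apply: q_eq0.
apply/ler_addgt0Pr => e e0; rewrite add0r.
have e2 : 0 < e / 2 by rewrite divr_gt0.
move/cvg_qP : ux => /(_ _ e2) [N _ hN]; move/cvg_qP : uxy => /(_ _ e2) [M _ hM].
have := hN (maxn N M) (leq_maxl _ _); have := hM (maxn N M) (leq_maxr _ _).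
rewrite /=; set n := maxn N M => h1 h2.
have E : J (1 : R)%:C (u n - T (u n)) = u n.
  by have := J_id S1 (Tu n); rewrite scale1r.
apply: le_trans (qtri (u n) _ _) _; rewrite -{1}E -J_sub.
have := J_contr S1 (x - y - (u n - T (u n))); rewrite (semiC qP (x - y)); lra.
Qed.

(** F z plays the role of exp(zT). *)
Variable F : R[i] -> {linear X -> X}.
Hypothesis F_lim : forall z, S z -> forall x, euler n z x @[n --> \oo] --> F z x.
Hypothesis F0 : forall x, F 0 x = x.

Lemma F_sub z : {morph F z : x y / x - y}. Proof. exact: linearB. Qed.

Lemma F_contr z : S z -> contr q (F z).
Proof.
move=> Sz x; have := @lim_q _ _ 0 (q x) (@F_lim _ Sz x); rewrite subr0; apply.
by exists 0%N => n _; rewrite subr0 euler_contr.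
Qed.

Lemma F_approx z x : S z -> opdom T x -> q (F z x - x) <= modc z * q (T x).
Proof.
move=> Sz Tx; apply: (lim_q (@F_lim _ Sz x)).
by exists 0%N => n _; exact: euler_approx.
Qed.

Lemma F_dom z x : S z -> opdom T x ->
  opdom T (F z x) /\ T (F z x) = F z (T x).
Proof.
move=> Sz Tx; apply: (T_closed (u := fun n => euler n z x)).
- by move=> n; case: (euler_dom n Sz Tx).
- exact: F_lim.
- rewrite (_ : (fun n => _) = fun n => euler n z (T x)); first exact: F_lim.
  by apply/funext => n; case: (euler_dom n Sz Tx).
Qed.

Lemma F_approx2 z x : S z -> dom2 x ->
  q (F z x - x - z *: T x) <= 2 * modc z ^+ 2 * q (T (T x)).
Proof.
move=> Sz x2; have [Tx TTx] := x2.
have E0 : step 0 z = z by rewrite /step expr0 mul1r.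
have h1 : q (F z x - J z x) <= modc z ^+ 2 / 2 * q (T (T x)).
  apply: (lim_q (@F_lim _ Sz x)); exists 0%N => n _.
  have := euler_far2 Sz x2 (leq0n n); rewrite expr0 mul1r.
  by rewrite {2}/euler expn0 /= E0.
have h2 : q (J z x - x - z *: T x) <= modc z ^+ 2 * q (T (T x)).
  rewrite {1}J_eq // TJ // [x + _]addrC addrK -scalerBr qZ expr2 -mulrA.
  by rewrite ler_wpM2l ?modc_ge0 // J_approx.
have -> : F z x - x - z *: T x = F z x - J z x + (J z x - x - z *: T x).
  by rewrite addrA addrA subrK.
apply: le_trans (qD _ _) _.
have : 0 <= modc z ^+ 2 * q (T (T x)) by rewrite mulr_ge0 ?sqr_ge0 ?q_ge0.
move: h1 h2; rewrite mulrAC -mulrA; lra.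
Qed.

(** On the domain of T^2, the n-th schemes for z + w and for z followed by w differ
    by O(2^-n). *)
Lemma FD z w x : S z -> S w -> F (z + w) x = F z (F w x).
Proof.
move=> Sz Sw; have Szw := sectorD Sz Sw.
apply/eqP; rewrite -subr_eq0; apply/eqP; move: x.
apply: (@dense_dom2 (fun x => F (z + w) x - F z (F w x)) 2) => // [x y|x x2].
  have -> : F (z + w) x - F z (F w x) - (F (z + w) y - F z (F w y)) =
     F (z + w) (x - y) - F z (F w (x - y)).
    by rewrite !F_sub subrACA.
  apply: le_trans (qB _ _) _; rewrite mulrDl mul1r.
  by rewrite lerD ?F_contr // (le_trans (F_contr Sz _)) // F_contr.
apply: q_eq0; apply/ler_addgt0Pr => e e0; rewrite add0r.
apply: (lim_q (@F_lim _ Szw x)).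
pose B := modc z * modc w * q (T (T x)) + 1.
have B0 : 0 < B by rewrite ltr_wpDl // !mulr_ge0 ?modc_ge0 ?q_ge0.
have e2 : 0 < e / 2 by rewrite divr_gt0.
have [N hN] := half_small (divr_gt0 e2 B0).
have [M1 _ h1] := (cvg_qP _ _).1 (@F_lim _ Sz (F w x)) _ (divr_gt0 e2 (ltr0Sn _ 1)).
have [M2 _ h2] := (cvg_qP _ _).1 (@F_lim _ Sw x) _ (divr_gt0 e2 (ltr0Sn _ 1)).
exists (maxn N (maxn M1 M2)) => n; rewrite !geq_max => /and3P[Nn M1n M2n].
have {}h1 := h1 n M1n; have {}h2 := h2 n M2n; rewrite /= in h1 h2.
have S1 := step_sector n Sz; have S2 := step_sector n Sw.
have S3 := step_sector n Szw.
have h3 : q (euler n (z + w) x - euler n z (euler n w x)) < e / 2.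
  rewrite {2 3}/euler -iter_comp; last by move=> y; apply: JC.
  have C12 : contr q (J (step n z) \o J (step n w)).
    by move=> y; apply: le_trans (J_contr S1 _) (J_contr S2 _).
  have Cs : {morph J (step n z) \o J (step n w) : y y' / y - y'}.
    by move=> y y' /=; rewrite !J_sub.
  have CC y : J (step n (z + w)) ((J (step n z) \o J (step n w)) y) =
      (J (step n z) \o J (step n w)) (J (step n (z + w)) y).
    by rewrite /= (JC _ S3 S1) (JC _ S3 S2).
  apply: le_lt_trans (iter_diff qP (2 ^ n) x (J_contr S3) C12 (J_sub _) Cs CC) _.
  have := ler_wpM2l (ler0n R (2 ^ n)) (JJ_approx S1 S2 x2).
  rewrite {3}/step {3}/step -mulrDr -/(step n _) semiC // => /le_lt_trans; apply.
  rewrite !modc_step.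
  have -> : (2 ^ n)%:R * (2^-1 ^+ n * modc z * (2^-1 ^+ n * modc w) *
       q (T (T x))) = (2 ^ n)%:R * 2^-1 ^+ n *
       (2^-1 ^+ n * (modc z * modc w * q (T (T x)))) by ring.
  rewrite count_half mul1r.
  have := hN n Nn; rewrite ltr_pdivlMr // /B.
  by have := half_gt0 n; lra.
apply: le_trans (qtri (euler n z (euler n w x)) _ _) _.
have := qtri (euler n z (F w x)) (euler n z (euler n w x)) (F z (F w x)).
have := euler_contr n Sz (euler n w x - F w x); rewrite euler_sub; lra.
Qed.

Lemma F_cvg0 x : F z x @[z --> within S (nbhs (0 : (R[i] : numFieldType)^o))] --> x.
Proof.
apply/cvg_qP => e e0.
have [y [Ty _] xy] := dom2_dense x (divr_gt0 e0 (ltr0Sn _ 3)).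
rewrite near_withinE; apply/nbhs_rnormP.
have k0 : 0 < q (T y) + 1 by rewrite ltr_wpDl ?q_ge0.
exists (e / 4 / (q (T y) + 1)) => [|z]; first by rewrite !divr_gt0.
rewrite subr0 rnorm_scalar => hz Sz.
have := F_approx Sz Ty; have := F_contr Sz (x - y); rewrite F_sub => h1 h2.
have h3 : modc z * q (T y) <= e / 4.
  have : modc z * (q (T y) + 1) < e / 4 by rewrite -ltr_pdivlMr.
  by have := modc_ge0 z; lra.
have := qtri (F z y) (F z x) x; have := qtri y (F z y) x.
rewrite (semiC qP y); lra.
Qed.

(** The domain of T^2 is a core of T. *)
Lemma graph_dense x (e : R) : opdom T x -> 0 < e ->
  exists2 y, dom2 y & q (T y - T x) < e.
Proof.
move=> Tx e0.
have [z zTx] := dom2_dense (T x) (divr_gt0 e0 (ltr0Sn _ 3)).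
have k0 : 0 < q (T z) + 1 by rewrite ltr_wpDl ?q_ge0.
pose s := e / 4 / (q (T z) + 1).
have s0 : 0 < s by rewrite !divr_gt0.
have Ss := sectorR m_gt0 s0.
have := J_approx Ss zTx.1; rewrite modcR gtr0_norm // => hz.
have sz : s * q (T z) <= e / 4.
  have <- : s * (q (T z) + 1) = e / 4 by rewrite divfK // gt_eqF.
  by rewrite ler_pM2l // lerDl.
move=> hzT; exists (J s%:C x); first exact: J_dom2.
rewrite TJ //; have := J_contr Ss (T x - z); rewrite J_sub.
have := qtri (J s%:C z) (J s%:C (T x)) (T x); have := qtri z (J s%:C z) (T x).
rewrite (semiC qP z); lra.
Qed.

Lemma F_diff_quot h x y (B : R) : 0 < h -> q (F h%:C x - x - h%:C *: y) <= h * B ->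
  q ((h^-1)%:C *: (F h%:C x - x) - y) <= B.
Proof.
move=> h0; have -> : (h^-1)%:C *: (F h%:C x - x) - y =
    (h^-1)%:C *: (F h%:C x - x - h%:C *: y).
  by rewrite [RHS]scalerBr scalerA -rmorphM /= mulVf ?gt_eqF // scale1r.
have hi : 0 <= h^-1 by rewrite invr_ge0 ltW.
by rewrite (semiZr qP _ hi) ler_pdivrMl.
Qed.

Lemma F_generator_dom x : opdom T x ->
  ((h^-1)%:C *: (F h%:C x - x)) @[h --> (0 : R)^'+] --> T x.
Proof.
move=> Tx.
apply/cvg_qP => e e0.
have [z z2 zx] := graph_dense Tx (divr_gt0 e0 (ltr0Sn _ 3)).
have k0 : 0 < 2 * q (T (T z)) + 1 by rewrite ltr_wpDl ?mulr_ge0 ?q_ge0.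
near=> h.
have h0 : 0 < h by near: h; exact: nbhs_right_gt.
have hs : h < e / 4 / (2 * q (T (T z)) + 1).
  by near: h; apply: nbhs_right_lt; rewrite !divr_gt0.
have Sh := sectorR m_gt0 h0.
apply: (@le_lt_trans _ _ (3 * (e / 4))); last by lra.
apply: F_diff_quot => //.
have [Txz TxzE] := domB Tx z2.1.
have := F_approx Sh Txz; rewrite modcR gtr0_norm // TxzE F_sub => h1.
have := F_approx2 Sh z2; rewrite modcR gtr0_norm // => h2.
have h3 : h * (2 * q (T (T z))) <= e / 4.
  have : h * (2 * q (T (T z)) + 1) < e / 4 by rewrite -ltr_pdivlMr.
  by lra.
have E : F h%:C x - x - h%:C *: T x = (F h%:C x - F h%:C z - (x - z)) +
   ((F h%:C z - z - h%:C *: T z) + h%:C *: (T z - T x)).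
  rewrite [h%:C *: (T z - T x)]scalerBr [X in _ = _ + X]addrA subrK.
  by rewrite opprB [RHS]addrA [X in _ = X - _]addrAC !subrKA.
rewrite E; apply: le_trans (qD _ _) _.
have h4 := qD (F h%:C z - z - h%:C *: T z) (h%:C *: (T z - T x)).
rewrite (semiZr qP _ (ltW h0)) in h4.
have h5 : h * q (T z - T x) <= h * (e / 4) by rewrite ler_pM2l // ltW.
have h6 : h * q (T x - T z) <= h * (e / 4) by rewrite ler_pM2l // semiC // ltW.
have h7 : 2 * h ^+ 2 * q (T (T z)) <= h * (e / 4).
  have -> : 2 * h ^+ 2 * q (T (T z)) = h * (h * (2 * q (T (T z)))) by ring.
  by rewrite ler_pM2l.
by lra.
Unshelve. all: end_near. Qed.

(** T has no proper extension that generates the same semigroup: the resolvent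
    equation identifies x with an element u of the domain up to a vector v
    such that exp(hT)v = v + hv + o(h), and contractivity forces v = 0. *)
Lemma F_generator x y : (opdom T x /\ T x = y) <->
  ((h^-1)%:C *: (F h%:C x - x)) @[h --> (0 : R)^'+] --> y.
Proof.
split=> [[Tx <-]|hy]; first exact: F_generator_dom.
have S1 : S (1 : R)%:C := sectorR m_gt0 ltr01.
pose u := J (1 : R)%:C (x - y).
have Tu : opdom T u by apply: J_dom.
have uE : u = x - y + T u by rewrite {1}/u J_eq // rmorph1 scale1r.
suff xu : x = u.
  split; first by rewrite xu.
  have := uE; rewrite -xu => h.
  by apply: (@addrI _ (x - y)); rewrite -h subrK.
apply/eqP; rewrite -subr_eq0; apply/eqP; set v := x - u.
have vE : y - T u = v by rewrite /v {2}uE opprD addrA subKr.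
have hv : ((h^-1)%:C *: (F h%:C v - v)) @[h --> (0 : R)^'+] --> v.
  rewrite -[X in _ --> X]vE.
  rewrite (_ : (fun h : R => _) = (fun h : R => (h^-1)%:C *: (F h%:C x - x) -
                                          (h^-1)%:C *: (F h%:C u - u))).
    by apply: cvgB => //; exact: F_generator_dom.
  apply/funext => h; rewrite -scalerBr /v F_sub; congr (_ *: _).
  by rewrite subrACA.
apply: q_eq0; apply/ler_addgt0Pr => e e0; rewrite add0r.
have : \forall h \near (0 : R)^'+, q v <= e.
  move/cvg_qP : hv => /(_ e e0) hv; near=> h.
  have h0 : 0 < h by near: h; exact: nbhs_right_gt.
  have : q ((h^-1)%:C *: (F h%:C v - v) - v) < e by near: h; exact: hv.
  set r := _ - v => rE.
  have E : (1 + h)%:C *: v = F h%:C v - h%:C *: r.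
    rewrite /r [h%:C *: (_ - _)]scalerBr scalerA -rmorphM /= divff ?gt_eqF //.
    rewrite scale1r rmorphD /= scalerDl rmorph1 scale1r.
    by rewrite [X in _ = _ + X]opprB [RHS]addrCA subKr addrC.
  have h1 : 0 <= 1 + h by rewrite addr_ge0 // ltW.
  have := semiZr qP v h1; rewrite E => h2.
  have := qB (F h%:C v) (h%:C *: r).
  have := F_contr (sectorR m_gt0 h0) v.
  rewrite (semiZr qP r (ltW h0)) h2 => h3 h4.
  have h5 : h * q r < h * e by rewrite ltr_pM2l.
  by rewrite -(ler_pM2l h0); lra.
move=> /filter_ex[h]; exact.
Unshelve. all: end_near. Qed.

Variable K : R.
Hypotheses (K_ge0 : 0 <= K)
  (euler_smoothing : forall n t x, (0 < n)%N -> 0 < t -> opdom T x ->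
     q (euler n t%:C (T x)) <= K / t * q x).

Lemma F_smoothing t x : 0 < t -> opdom T x -> q (F t%:C (T x)) <= K / t * q x.
Proof.
move=> t0 Tx; have St := sectorR m_gt0 t0.
have := @lim_q _ _ 0 (K / t * q x) (@F_lim _ St (T x)); rewrite subr0; apply.
by exists 1%N => n n0; rewrite subr0 euler_smoothing.
Qed.

(** T F t is bounded on the domain of T by the smoothing estimate, and T is closed. *)
Lemma F_dom_all t x : 0 < t -> opdom T (F t%:C x).
Proof.
move=> t0; have St := sectorR m_gt0 t0.
have /choice[u hu] k : exists y, dom2 y /\ q (x - y) < (2^-1) ^+ k.
  by have [y y2 xy] := dom2_dense x (half_gt0 k); exists y.
have ux : u n @[n --> \oo] --> x.
  apply/cvg_qP => e e0; have [N hN] := half_small e0; exists N => // n Nn /=.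
  by rewrite semiC //; apply: lt_trans (hu n).2 (hN n Nn).
have [y uy] : exists y : X, F t%:C (T (u n)) @[n --> \oo] --> y.
  apply: Xc => e e0.
  have k0 : 0 < c1 * (K / t) + 1 by rewrite ltr_wpDl // !mulr_ge0 ?invr_ge0 // ltW.
  move/cvg_qP : ux => /(_ (e / (c1 * (K / t) + 1) / 2)) [].
    by rewrite !divr_gt0.
  move=> N _ hN; exists N => i j Ni Nj.
  rewrite -F_sub; have [h1 h2] := domB (hu i).1.1 (hu j).1.1.
  rewrite -h2; apply: le_lt_trans (le_q _) _.
  have {}h2 := F_smoothing t0 h1.
  apply: le_lt_trans (ler_wpM2l (ltW c1_gt0) h2) _.
  have : q (u i - u j) < e / (c1 * (K / t) + 1).
    have := qtri x (u i) (u j); have := hN i Ni; have := hN j Nj.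
    by rewrite /= (semiC qP x); lra.
  rewrite ltr_pdivlMr // mulrA.
  by have := q_ge0 (u i - u j); lra.
have [] // := T_closed (u := fun n => F t%:C (u n)) (x := F t%:C x) (y := y).
- by move=> n; case: (F_dom St (hu n).1.1).
- apply/cvg_qP => e e0; move/cvg_qP: ux => /(_ e e0); apply: filterS => n.
  by rewrite -F_sub; apply: le_lt_trans; exact: F_contr.
- rewrite (_ : (fun n => _) = fun n => F t%:C (T (u n))) //.
  by apply/funext => n; case: (F_dom St (hu n).1.1).
Qed.

Lemma F_dom2_all t x : 0 < t -> dom2 (F t%:C x).
Proof.
move=> t0; have t2 : 0 < t / 2 by rewrite divr_gt0.
have St := sectorR m_gt0 t2.
have -> : F t%:C x = F (t / 2)%:C (F (t / 2)%:C x).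
  by rewrite -FD // -rmorphD /= -splitr.
have h := F_dom_all x t2.
by split; [|rewrite (F_dom St h).2]; exact: F_dom_all.
Qed.

(** By smoothing, F u x = F (u - t) y with y = F t x in the domain of T^2, where F has a
    first-order expansion at 0 within the sector. An arbitrary complex increment h is
    written (h + s) - s, with s of the order of |h| large enough for h + s to
    lie in the sector, so that one-sided expansions suffice. *)
Lemma F_derivable z x : S z ->
  derivable (fun u : (R[i] : numFieldType)^o => F u x) z 1.
Proof.
move=> Sz; have [e e0 he] := sector_near m_gt0 Sz.
pose t := e / 2; have t0 : 0 < t by rewrite divr_gt0.
pose y := F t%:C x; have y2 : dom2 y by exact: F_dom2_all.
(* s := k |h| gives Re (h + s) >= (2/m) |h|, and hence h + s is in the sector. *)
pose k := 1 + 2 / m.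
have k0 : 0 < k by rewrite ltr_wpDr // divr_ge0 // ltW.
pose C := (2 * (k + 1) ^+ 2 + 2 * k ^+ 2 + k) * q (T (T y)).
have C0 : 0 <= C.
  by apply: mulr_ge0 (q_ge0 _); have := sqr_ge0 (k + 1); have := sqr_ge0 k; lra.
have Szt : S (z - t%:C).
  by apply: he; rewrite modcN modcR gtr0_norm // /t; lra.
have Stt : S t%:C by exact: sectorR.
pose L := F (z - t%:C) (T y).
have key h : h != 0 -> modc h < t / k ->
    q (h^-1 *: (F (h + z) x - F z x) - L) <= modc h * C.
  move=> h0 ht.
  have mh : 0 < modc h.
    by rewrite lt_def modc_ge0 andbT; apply: contraNN h0 => /eqP/modc_eq0 ->.
  pose s := k * modc h; have s0 : 0 < s by rewrite mulr_gt0.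
  have st : s < t by rewrite /s mulrC -ltr_pdivlMr.
  have Ss : S s%:C by exact: sectorR.
  have Shs : S (h + s%:C).
    have := Re_le_modc h; have := Im_le_modc h.
    rewrite !ler_norml => /andP[i1 i2] /andP[r1 r2].
    have hr : 2 / m * modc h <= Rea h + s by rewrite /s /k; lra.
    have hr0 : 0 < 2 / m * modc h by rewrite mulr_gt0 // divr_gt0.
    split; rewrite !ReImE /= ?addr0; first lra.
    apply: lt_le_trans (_ : m * (2 / m * modc h) <= _); last first.
      by rewrite ler_pM2l.
    have -> : m * (2 / m * modc h) = 2 * modc h by field; rewrite gt_eqF.
    by apply: le_lt_trans (Im_le_modc h) _; lra.
  pose w := z - t%:C - s%:C.
  have Sw : S w.
    rewrite /w -addrA -opprD -rmorphD; apply: he.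
    by rewrite modcN modcR gtr0_norm ?addr_gt0 // /t; move: st; rewrite /t; lra.
  have E1 : F (h + z) x = F w (F (h + s%:C) y).
    rewrite /y -!FD //; last exact: sectorD.
    by congr (F _ x); rewrite /w; ring.
  have E2 : F z x = F w (F s%:C y).
    rewrite /y -!FD //; last exact: sectorD.
    by congr (F _ x); rewrite /w; ring.
  have E3 : L = F w (F s%:C (T y)).
    by rewrite -FD // /w subrK.
  rewrite E1 E2 E3.
  pose d := F (h + s%:C) y - F s%:C y - h *: T y.
  have Ed : d = (F (h + s%:C) y - y - (h + s%:C) *: T y) -
                (F s%:C y - y - s%:C *: T y).
    by rewrite subrACA [- (F s%:C y - y)]opprB subrKA scalerDl addrK.
  have dle : q d <= 2 * modc (h + s%:C) ^+ 2 * q (T (T y)) +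
                    2 * s ^+ 2 * q (T (T y)).
    rewrite Ed; apply: le_trans (qB _ _) _; apply: lerD; first exact: F_approx2.
    by have := F_approx2 Ss y2; rewrite modcR gtr0_norm.
  have mhs : modc (h + s%:C) <= (k + 1) * modc h.
    by apply: le_trans (modcD _ _) _; rewrite modcR gtr0_norm // /s; lra.
  have sTy : q (T y - F s%:C (T y)) <= s * q (T (T y)).
    by have := F_approx Ss y2.2; rewrite modcR gtr0_norm // semiC.
  have Er : h^-1 *: (F w (F (h + s%:C) y) - F w (F s%:C y)) - F w (F s%:C (T y)) =
     h^-1 *: F w d + F w (T y - F s%:C (T y)).
    have -> : F w d = F w (F (h + s%:C) y) - F w (F s%:C y) - h *: F w (T y).
      by rewrite /d !F_sub; congr (_ - _); exact: linearZ_LR.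
    rewrite [in RHS]scalerBr [h^-1 *: (h *: _)]scalerA mulVf // scale1r.
    by rewrite [F w (T y - _)]F_sub addrA subrK.
  rewrite Er; apply: le_trans (qD _ _) _; rewrite qZ modcV.
  have h1 := F_contr Sw d; have h2 := F_contr Sw (T y - F s%:C (T y)).
  have h3 : (modc h)^-1 * q (F w d) <=
      modc h * ((2 * (k + 1) ^+ 2 + 2 * k ^+ 2) * q (T (T y))).
    rewrite ler_pdivrMl //; apply: le_trans h1 _; apply: le_trans dle _.
    have : modc (h + s%:C) ^+ 2 <= ((k + 1) * modc h) ^+ 2.
      by rewrite ler_sqr ?nnegrE ?mulr_ge0 ?modc_ge0 // addr_ge0 // ltW.
    have -> : modc h * (modc h * ((2 * (k + 1) ^+ 2 + 2 * k ^+ 2) * q (T (T y)))) =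
       2 * ((k + 1) * modc h) ^+ 2 * q (T (T y)) + 2 * s ^+ 2 * q (T (T y)).
      by rewrite /s; ring.
    by move=> h4; rewrite lerD2r ler_wpM2r ?q_ge0 // ler_pM2l.
  have h4 : q (F w (T y - F s%:C (T y))) <= modc h * (k * q (T (T y))).
    by apply: le_trans h2 (le_trans sTy _); rewrite /s mulrCA mulrA.
  apply: le_trans (lerD h3 h4) _.
  by rewrite -mulrDr -mulrDl.
apply/cvg_ex; exists L; apply/cvg_qP => r r0.
have C1 : 0 < C + 1 by rewrite ltr_wpDl.
apply/nbhs_rnormP; exists (Num.min (t / k) (r / (C + 1))).
  by rewrite lt_min !divr_gt0.
move=> h; rewrite subr0 rnorm_scalar lt_min => /andP[ht hr] h0.
have := key h h0 ht; rewrite -[X in F (X + z)]mulr1 => hk.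
apply: le_lt_trans hk _.
by move: hr; rewrite ltr_pdivlMr //; have := modc_ge0 h; lra.
Qed.

Variable om : R.
Hypotheses (om_gt0 : 0 < om)
  (J_decay : forall t x, 0 < t ->
     (1 + 2 * om * t) * q (J t%:C x) ^+ 2 <= q x ^+ 2).

(** Lower bound for the growth of the powers (1 + x/N)^N, sharp enough for the limit
    exp x. *)
Lemma expR_le_1D (y : R) : 0 <= y -> expR (y * (1 - y)) <= 1 + y.
Proof.
move=> y0; have y1 : 0 < 1 + y by rewrite ltr_wpDr.
pose s := y / (1 + y).
have sy : y * (1 - y) <= s.
  rewrite /s ler_pdivlMr //.
  have -> : y * (1 - y) * (1 + y) = y - y ^+ 3 by ring.
  by rewrite gerBl exprn_ge0.
apply: le_trans (_ : expR s <= _); first by rewrite ler_expR.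
have := expR_ge1Dx (- s); rewrite expRN.
have -> : 1 - s = (1 + y)^-1 by rewrite /s; field; rewrite gt_eqF.
by rewrite lef_pV2 ?posrE ?expR_gt0.
Qed.

(** Each step of length h contracts by (1 + 2 om h)^(-1/2). *)
Lemma euler_decay n t x : 0 < t ->
  expR (om * t * (1 - 2 * om * t * (2^-1) ^+ n)) * q (euler n t%:C x) <= q x.
Proof.
move=> t0; pose y := 2 * om * t * (2^-1) ^+ n.
have y0 : 0 < y by rewrite !mulr_gt0 ?half_gt0.
have y1 : 0 < 1 + y by rewrite addr_gt0.
have stepE : step n t%:C = ((2^-1) ^+ n * t)%:C by rewrite /step rmorphM.
have t1 : 0 < (2^-1) ^+ n * t by rewrite mulr_gt0 ?half_gt0.
have it N : (1 + y) ^+ N * q (iter N (J (step n t%:C)) x) ^+ 2 <= q x ^+ 2.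
  elim: N => [|N IH]; first by rewrite expr0 mul1r.
  apply: le_trans IH; rewrite exprSr -mulrA ler_wpM2l ?exprn_ge0 ?(ltW y1) //.
  have := J_decay (iter N (J (step n t%:C)) x) t1; rewrite -stepE.
  suff -> : 2 * om * (2^-1 ^+ n * t) = y by [].
  by rewrite /y; ring.
rewrite -(@ler_sqr _ _ (q x)) ?nnegrE ?mulr_ge0 ?expR_ge0 ?q_ge0 // exprMn.
apply: le_trans (it (2 ^ n)%N); rewrite -/(euler n t%:C x).
rewrite ler_wpM2r ?sqr_ge0 // -expRM_natl.
have -> : 2 * (om * t * (1 - 2 * om * t * 2^-1 ^+ n)) =
    (2 ^ n)%:R * (y * (1 - y)).
  transitivity ((2 ^ n)%:R * 2^-1 ^+ n * (2 * om * t * (1 - y))).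
    by rewrite count_half mul1r /y; ring.
  by rewrite /y; ring.
rewrite expRM_natl ler_pXn2r ?expn_gt0 ?nnegrE ?expR_ge0 ?(ltW y1) //.
by apply: expR_le_1D; exact: ltW.
Qed.

Lemma F_decay t x : 0 < t -> q (F t%:C x) <= expR (- (om * t)) * q x.
Proof.
move=> t0; have St := sectorR m_gt0 t0.
have e0 := expR_gt0 (om * t).
rewrite expRN ler_pdivlMl //; apply/ler_addgt0Pr => e e1.
rewrite -ler_pdivlMl //; have := @lim_q _ _ 0 ((expR (om * t))^-1 * (q x + e)) (@F_lim _ St x).
rewrite subr0; apply.
pose B := expR (om * t) * (2 * (om * t) ^+ 2) * q x + 1.
have omt : 0 < om * t by rewrite mulr_gt0.
have B0 : 0 < B.
  by rewrite ltr_wpDl // !mulr_ge0 ?q_ge0 ?expR_ge0 // ltW.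
have [N hN] := half_small (divr_gt0 e1 B0); exists N => n Nn; rewrite subr0.
rewrite ler_pdivlMl //.
have := euler_decay n x t0; set E := q (euler n _ x) => h1.
have h2 : E <= q x by exact: euler_contr.
have E0 : 0 <= E by exact: q_ge0.
pose r := om * t * (2 * om * t * 2^-1 ^+ n).
have h3 : expR (om * t) * (1 - r) <= expR (om * t * (1 - 2 * om * t * 2^-1 ^+ n)).
  have -> : om * t * (1 - 2 * om * t * 2^-1 ^+ n) = om * t + - r by rewrite /r; ring.
  by rewrite expRD ler_pM2l // expR_ge1Dx.
have h4 : expR (om * t) * (1 - r) * E <= q x.
  by apply: le_trans h1; rewrite ler_wpM2r.
have r0 : 0 <= r by rewrite !mulr_ge0 ?ltW ?half_gt0.
have h5 : expR (om * t) * r * E <= expR (om * t) * r * q x.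
  by rewrite ler_wpM2l // mulr_ge0 // ltW.
have h6 : expR (om * t) * r * q x <= e.
  have := hN n Nn; rewrite ltr_pdivlMr // /B.
  have -> : expR (om * t) * r * q x =
     2^-1 ^+ n * (expR (om * t) * (2 * (om * t) ^+ 2) * q x) by rewrite /r; ring.
  by have := half_gt0 n; lra.
lra.
Qed.

Let E (t : R) : {linear X -> X} := F t%:C.

Lemma F_semigroup : [/\ C0_semigroup E, is_generator T E, analytic_semigroup E &
  forall t x, 0 <= t -> q (E t x) <= expR (- (om * t)) * q x].
Proof.
have F_cont z : S z -> continuous (F z).
  move=> Sz; apply/linear_continuousP; exists (c1 * c2) => [|x].
    exact: mulr_gt0.
  rewrite -mulrA; apply: le_trans (le_q _) _; rewrite ler_pM2l //.
  exact: le_trans (F_contr Sz x) (q_le x).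
have St t : 0 < t -> S t%:C by exact: sectorR.
have E0 x : E 0 x = x by exact: F0.
split.
- split=> //.
  + move=> t; rewrite le_eqVlt => /predU1P[<-|/St]; last exact: F_cont.
    by move=> x; rewrite (_ : (E 0 : X -> X) = id); [exact: cvg_id|apply/funext].
  + move=> s t x; rewrite le_eqVlt => /predU1P[<-|s0].
      by rewrite add0r E0.
    rewrite le_eqVlt => /predU1P[<-|t0]; first by rewrite addr0 E0.
    by rewrite /E rmorphD /= FD //; exact: St.
  + move=> x; apply/cvg_qP => e e0.
    have /cvg_qP/(_ e e0) := @F_cvg0 x; rewrite near_withinE => h.
    have [r r0 hr] := (nbhs_rnormP _ _).1 h; near=> t.
    have t0 : 0 < t by near: t; exact: nbhs_right_gt.
    have tr : t < r by near: t; exact: nbhs_right_lt.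
    apply: hr; last exact: St.
    by rewrite subr0 rnorm_scalar modcR gtr0_norm.
- exact: F_generator.
- exists m, F; split=> //; split=> //.
  + by move=> z w x Sz Sw; exact: FD.
  + by move=> z x Sz; exact: F_derivable.
  + exact: F_cvg0.
- move=> t x; rewrite le_eqVlt => /predU1P[<-|t0]; last exact: F_decay.
  by rewrite mulr0 oppr0 expR0 mul1r E0.
Unshelve. all: end_near. Qed.

End Euler.

(** A semigroup generation theorem: resolvents that contract in a sector give a
    semigroup of contractions there, the smoothing bound makes it analytic, and
    the bound on real steps gives its decay. *)
Theorem euler_semigroup (R : realType) (X : normedModType R[i])
    (Xc : seq_complete X) (q : X -> R) (c1 c2 : R) (qP : seminorm q)
    (c1_gt0 : 0 < c1) (c2_gt0 : 0 < c2)
    (le_q : forall x, rnorm x <= c1 * q x)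
    (q_le : forall x, q x <= c2 * rnorm x)
    (T : partial_op X X) (m : R) (J : R[i] -> {linear X -> X})
    (T_lin : linear_op T) (T_dense : dense (opdom T)) (m_gt0 : 0 < m)
    (JT : forall z, sector m z ->
      [/\ forall x, opdom T (J z x) /\ J z x - z *: T (J z x) = x,
          forall x, opdom T x -> J z (x - z *: T x) = x &
          contr q (J z)])
    (K : R) (K_ge0 : 0 <= K)
    (smoothing : forall n t x, (0 < n)%N -> 0 < t -> opdom T x ->
       q (euler J n t%:C (T x)) <= K / t * q x)
    (om : R) (om_gt0 : 0 < om)
    (J_decay : forall t x, 0 < t ->
       (1 + 2 * om * t) * q (J t%:C x) ^+ 2 <= q x ^+ 2) :
  exists E : R -> {linear X -> X},
    [/\ C0_semigroup E, is_generator T E, analytic_semigroup E &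
      forall t x, 0 <= t -> q (E t x) <= expR (- (om * t)) * q x].
Proof.
have /choice[F FP] := ex_limit Xc qP c1_gt0 c2_gt0 le_q q_le T_lin T_dense m_gt0 JT.
have F_lim z (Sz : sector m z) := (FP z).1 Sz.
have F0 : forall x, F 0 x = x by apply: (FP 0).2 => -[]; rewrite /= ltxx.
exists (fun t => F t%:C).
exact: (F_semigroup Xc qP c1_gt0 c2_gt0 le_q q_le T_lin T_dense m_gt0 JT F_lim
  F0 K_ge0 smoothing om_gt0 J_decay).
Qed.

(** * Sectorial operators in a Hilbert space *)

Lemma amgm (R : realType) (G P Q : R) : 0 <= P -> 0 <= Q -> G ^+ 2 <= P * Q ->
  2 * G <= P + Q.
Proof.
move=> P0 Q0 h; have [g0|g0] := leP G 0.
  by apply: le_trans (addr_ge0 P0 Q0); lra.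
rewrite -ler_sqr ?nnegrE ?addr_ge0 //; last by rewrite mulr_ge0 // ltW.
have := sqr_ge0 (P - Q); rewrite !expr2 in h *; nra.
Qed.

Section Sectorial.
Context {R : realType} {X : normedModType R[i]}.
Hypothesis Xc : seq_complete X.
Variables (g : X -> X -> R[i]) (c1 c2 : R).
Hypotheses (gP : inner g) (c1_gt0 : 0 < c1) (c2_gt0 : 0 < c2)
  (le_q : forall x, rnorm x <= c1 * ipnorm g x)
  (q_le : forall x, ipnorm g x <= c2 * rnorm x).
Variables (T : partial_op X X) (om C : R).
Hypotheses (T_lin : linear_op T) (T_dense : dense (opdom T))
  (T_res : forall l, 0 < Rea l -> resolvent_set T l)
  (om_gt0 : 0 < om) (C_gt0 : 0 < C).
Local Notation q := (ipnorm g).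
Local Notation a u := (- Rea (g (T u) u)).
Hypotheses (T_coercive : forall u, opdom T u -> om * q u ^+ 2 <= a u)
  (T_form : forall u v, opdom T u -> opdom T v ->
     modc (g (T u) v) ^+ 2 <= C ^+ 2 * (a u * a v)).

Lemma form_ge0 u : opdom T u -> 0 <= a u.
Proof.
move=> Tu; apply: le_trans (T_coercive Tu).
by rewrite mulr_ge0 ?sqr_ge0 // ltW.
Qed.

Lemma form_sector u : opdom T u -> `|Ima (g (T u) u)| <= C * a u.
Proof.
move=> Tu; apply: le_trans (Im_le_modc _) _.
rewrite -ler_sqr ?nnegrE ?modc_ge0 ?mulr_ge0 ?form_ge0 ?(ltW C_gt0) //.
by rewrite exprMn [a u ^+ 2]expr2; exact: T_form.
Qed.

Lemma ipnorm_seminorm : seminorm q.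
Proof. by split=> [x y|b x]; [exact: ipnormD|exact: ipnormZ]. Qed.

Lemma opZ b x : opdom T x -> opdom T (b *: x) /\ T (b *: x) = b *: T x.
Proof.
move=> Tx; have [T0 TL] := T_lin.
have T00 : T 0 = 0.
  have := (TL (-1) 0 0 T0 T0).2.
  by rewrite scaler0 addr0 scaleN1r addNr.
by have := TL b x 0 Tx T0; rewrite T00 !addr0.
Qed.

(** (1 - zT)^-1 = - z^-1 (T - z^-1)^-1. *)
Lemma resolvent_step z : 0 < Rea z -> exists J : {linear X -> X},
  (forall x, opdom T (J x) /\ J x - z *: T (J x) = x) /\
  (forall x, opdom T x -> J (x - z *: T x) = x).
Proof.
move=> z0.
have zn : z != 0 by apply: contraTN z0 => /eqP ->; rewrite /= ltxx.
have [|G [_ G1 G2]] := T_res (l := z^-1).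
  case: z z0 {zn} => x y /= x0; rewrite divr_gt0 //.
  by rewrite ltr_pwDl ?sqr_ge0 // exprn_gt0.
have [|J JE] := @ex_linear _ _ _ (fun x => - z^-1 *: G x).
  move=> b x y; rewrite linearP scalerDr; congr (_ + _).
  by rewrite !scalerA mulrC.
exists J; split=> [x|x Tx]; rewrite JE.
  have [h1 h2] := G1 x; have [h3 h4] := opZ (- z^-1) h1.
  split=> //; rewrite h4 scalerA mulrN divff // scaleN1r opprK addrC.
  by rewrite scaleNr.
rewrite -linearZ_LR /= -[RHS](G2 x Tx); congr (G _).
by rewrite scalerBr scalerA mulNr mulVf // scaleN1r opprK addrC scaleNr.
Qed.

Lemma ipnorm_step z w : q (w - z *: T w) ^+ 2 = q w ^+ 2 + modc z ^+ 2 * q (T w) ^+ 2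
  - 2 * (Rea z * Rea (g (T w) w) - Ima z * Ima (g (T w) w)).
Proof.
rewrite (ipnormB_sqr gP) (ipnormZ gP) exprMn (innerZr gP) (innerC gP (T w) w).
by rewrite -rmorphM ReJ ReM.
Qed.

Section Smoothing.
Variables (J : {linear X -> X}) (h : R).
Hypotheses (h_gt0 : 0 < h)
  (J_dom : forall x, opdom T (J x)) (J_eq : forall x, J x - h%:C *: T (J x) = x)
  (TJ : forall x, opdom T x -> T (J x) = J (T x)).

(** x = J x - h T J x, and the square of h T J x is discarded. *)
Lemma energy_step x : q (J x) ^+ 2 + 2 * h * a (J x) <= q x ^+ 2.
Proof.
rewrite -{4}[x]J_eq ipnorm_step /= mul0r subr0.
have : 0 <= modc h%:C ^+ 2 * q (T (J x)) ^+ 2 by rewrite mulr_ge0 ?sqr_ge0.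
lra.
Qed.

Lemma energy_contr x : q (J x) <= q x.
Proof.
rewrite -ler_sqr ?nnegrE ?ipnorm_ge0 //; apply: le_trans (energy_step x).
by rewrite lerDl !mulr_ge0 ?form_ge0 // ltW.
Qed.

(** A discrete energy estimate, for u_k the k-th step of the scheme. The weight of
    |T u|^2 grows from (k+1)^2 to (k+2)^2 in one step; this growth is absorbed
    by the energies dissipated by u and by Tu, because |Tu|^2 = <Tu, Tu> is
    bounded by C times the geometric mean of a(u) and a(Tu). *)
Lemma energy_weighted k x : opdom T x ->
  k.+1%:R ^+ 2 * h ^+ 2 * q (T (iter k.+2 J x)) ^+ 2
    + C ^+ 2 * q (iter k.+2 J x) ^+ 2 <= (4 + C ^+ 2) * q x ^+ 2.
Proof.
move=> Tx; elim: k => [|k IH].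
  have h1 : q (iter 2 J x) ^+ 2 <= q x ^+ 2.
    rewrite ler_sqr ?nnegrE ?ipnorm_ge0 //.
    exact: le_trans (energy_contr _) (energy_contr _).
  have h2 : h * q (T (iter 2 J x)) <= 2 * q x.
    apply: le_trans (_ : h * q (T (J x)) <= _).
      by rewrite ler_pM2l // /= TJ // energy_contr.
    rewrite -(semiZr ipnorm_seminorm _ (ltW h_gt0)).
    have -> : h%:C *: T (J x) = J x - x by rewrite -{3}[x]J_eq subKr.
    apply: le_trans (semiB ipnorm_seminorm _ _) _.
    by have := energy_contr x; lra.
  have h3 : (h * q (T (iter 2 J x))) ^+ 2 <= (2 * q x) ^+ 2.
    by rewrite ler_sqr ?nnegrE ?mulr_ge0 ?ipnorm_ge0 // ltW.
  rewrite expr1n mul1r -exprMn mulrDl; apply: lerD.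
    by apply: le_trans h3 _; rewrite exprMn -natrX.
  by rewrite ler_wpM2l ?sqr_ge0.
apply: le_trans IH.
set u := iter k.+2 J x; rewrite iterS -/u.
have Tu : opdom T u by rewrite /u iterS.
have TTJ : opdom T (T (J u)) by rewrite TJ.
have e1 := energy_step u; have e2 := energy_step (T u).
rewrite -TJ // in e2.
set v := J u in e1 e2 TTJ *.
have Tv : opdom T v by apply: J_dom.
pose G := q (T v) ^+ 2.
have G0 : 0 <= G by exact: sqr_ge0.
have GE : G ^+ 2 <= C ^+ 2 * (a v * a (T v)).
  by apply: le_trans (T_form Tv TTJ); rewrite (innerE gP) modcR ger0_norm.
have a1 := form_ge0 Tv; have a2 := form_ge0 TTJ.
have k1 : 1 <= k.+1%:R :> R by rewrite ler1n.
have kE : k.+2%:R = k.+1%:R + 1 :> R by rewrite -natr1.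
move: kE k1; move: (k.+1%:R : R) => r -> r1.
have key : 2 * (2 * r * h ^+ 2 * G) <= 2 * h * (r ^+ 2 * h ^+ 2) * a (T v) + 2 * h * C ^+ 2 * a v.
  apply: amgm.
  - apply: mulr_ge0 a2; apply: mulr_ge0 (mulr_ge0 _ (ltW h_gt0)) _ => //.
    exact: mulr_ge0 (sqr_ge0 _) (sqr_ge0 _).
  - apply: mulr_ge0 a1; apply: mulr_ge0 (sqr_ge0 _).
    exact: mulr_ge0 (ltW h_gt0).
  - rewrite exprMn.
    have -> : 2 * h * (r ^+ 2 * h ^+ 2) * a (T v) * (2 * h * C ^+ 2 * a v) =
       (2 * r * h ^+ 2) ^+ 2 * (C ^+ 2 * (a v * a (T v))) by ring.
    by rewrite ler_wpM2l ?sqr_ge0.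
rewrite -/G in e2 *.
have e3 : (r + 1) ^+ 2 * h ^+ 2 * G <= r ^+ 2 * h ^+ 2 * G + 4 * r * h ^+ 2 * G.
  rewrite -!mulrDl ler_wpM2r // ler_wpM2r ?sqr_ge0 // expr2; nra.
have e4 : C ^+ 2 * (q v ^+ 2 + 2 * h * a v) <= C ^+ 2 * q u ^+ 2.
  by rewrite ler_wpM2l ?sqr_ge0.
have e5 : r ^+ 2 * h ^+ 2 * (G + 2 * h * a (T v)) <= r ^+ 2 * h ^+ 2 * q (T u) ^+ 2.
  by rewrite ler_wpM2l // mulr_ge0 ?sqr_ge0.
lra.
Qed.

(** The estimate |T exp(tT)| <= K/t that characterizes analytic semigroups, for the
    Euler scheme. *)
Lemma energy_smoothing N x : (1 < N)%N -> opdom T x ->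
  q (iter N J (T x)) <= 2 * Num.sqrt (4 + C ^+ 2) / (N%:R * h) * q x.
Proof.
case: N => [|[|k]] // _ Tx.
have -> : iter k.+2 J (T x) = T (iter k.+2 J x).
  suff : opdom T (iter k.+2 J x) /\ T (iter k.+2 J x) = iter k.+2 J (T x) by case.
  by elim: k.+2 => //= n [h1 h2]; split=> //; rewrite TJ // h2.
have Nh : 0 < k.+2%:R * h by rewrite mulr_gt0.
rewrite mulrAC ler_pdivlMr //.
have c0 : 0 <= 4 + C ^+ 2 by rewrite addr_ge0 ?sqr_ge0.
rewrite -ler_sqr ?nnegrE ?mulr_ge0 ?ipnorm_ge0 ?sqrtr_ge0 ?(ltW h_gt0) //.
rewrite !exprMn (sqr_sqrtr c0).
have := energy_weighted k Tx.
have : 0 <= C ^+ 2 * q (iter k.+2 J x) ^+ 2 by rewrite mulr_ge0 ?sqr_ge0.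
move=> p1 p2.
have p3 : k.+1%:R ^+ 2 * h ^+ 2 * q (T (iter k.+2 J x)) ^+ 2 <= (4 + C ^+ 2) * q x ^+ 2.
  by apply: le_trans p2; rewrite lerDl.
have p4 : k.+2%:R ^+ 2 <= 2 ^+ 2 * k.+1%:R ^+ 2 :> R.
  rewrite -exprMn ler_sqr ?nnegrE ?mulr_ge0 // -natrM ler_nat.
  by rewrite mulnC muln2 -addnn !addSn !addnS !ltnS leq_addr.
have p5 : 0 <= h ^+ 2 * q (T (iter k.+2 J x)) ^+ 2.
  exact: mulr_ge0 (sqr_ge0 _) (sqr_ge0 _).
by have := ler_wpM2r p5 p4; move: p3; lra.
Qed.

End Smoothing.

(** The operator is sectorial for the product g, which makes (1 - zT)^-1 a contraction
    for z in a sector: Re z Re <Tw,w> - Im z Im <Tw,w> <= 0 there. *)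
Theorem sectorial_semigroup : exists E : R -> {linear X -> X},
  [/\ C0_semigroup E, is_generator T E, analytic_semigroup E &
    forall t x, 0 <= t -> q (E t x) <= expR (- (om * t)) * q x].
Proof.
have /choice[J JP] (z : R[i]) : exists J : {linear X -> X}, 0 < Rea z ->
    (forall x, opdom T (J x) /\ J x - z *: T (J x) = x) /\
    (forall x, opdom T x -> J (x - z *: T x) = x).
  have [z0|_] := ltP 0 (Rea z); last by exists idfun.
  by have [J hJ] := resolvent_step z0; exists J.
have m0 : 0 < C^-1 by rewrite invr_gt0.
have JT z : sector C^-1 z ->
    [/\ forall x, opdom T (J z x) /\ J z x - z *: T (J z x) = x,
        forall x, opdom T x -> J z (x - z *: T x) = x &
        contr q (J z)].
  move=> [z0 hz]; have [h1 h2] := JP z z0; split=> // x.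
  rewrite -ler_sqr ?nnegrE ?ipnorm_ge0 //.
  have [Tw wE] := h1 x; rewrite -{2}wE ipnorm_step.
  set w := J z x in Tw *.
  have : 0 <= modc z ^+ 2 * q (T w) ^+ 2 by rewrite mulr_ge0 ?sqr_ge0.
  have p1 : - (Ima z * Ima (g (T w) w)) <= `|Ima z| * (C * a w).
    apply: le_trans (ler_norm _) _; rewrite normrN normrM.
    by rewrite ler_wpM2l // form_sector.
  have p2 : `|Ima z| * C <= Rea z by rewrite -ler_pdivlMr // mulrC ltW.
  have := ler_wpM2r (form_ge0 Tw) p2; rewrite -mulrA; lra.
have J_decay t x : 0 < t -> (1 + 2 * om * t) * q (J t%:C x) ^+ 2 <= q x ^+ 2.
  move=> t0; have [h1 _] := JP t%:C t0; have [Tw wE] := h1 x.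
  have Jeq y : J t%:C y - t%:C *: T (J t%:C y) = y by case: (h1 y).
  have := energy_step Jeq x.
  have := ler_wpM2l (ltW t0) (T_coercive Tw); lra.
have K0 : 0 <= 2 * Num.sqrt (4 + C ^+ 2) by rewrite mulr_ge0 // sqrtr_ge0.
apply: (euler_semigroup Xc ipnorm_seminorm c1_gt0 c2_gt0 le_q q_le T_lin T_dense
  m0 JT K0) => // n t x n0 t0 Tx.
have t1 : 0 < (2^-1) ^+ n * t by rewrite mulr_gt0 ?half_gt0.
have St : sector C^-1 ((2^-1) ^+ n * t)%:C by exact: sectorR.
rewrite /euler; have -> : step n t%:C = ((2^-1) ^+ n * t)%:C by rewrite /step rmorphM.
have N1 : (1 < 2 ^ n)%N by rewrite -{1}(expn0 2) ltn_exp2l.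
have [h1 h2 _] := JT _ St.
have := energy_smoothing (J := J ((2^-1) ^+ n * t)%:C) t1 _ _ _ N1 Tx.
rewrite mulrA count_half mul1r; apply.
- by move=> y; case: (h1 y).
- by move=> y; case: (h1 y).
- by move=> y Ty; exact: (TJ JT).
Qed.

End Sectorial.

(** * The scale H_1, H, H_{-1} *)

Section Preliminaries.
Context {R : realType}.

(** The infimum of a set that is empty or not bounded below is 0 by convention. *)
Lemma inf_gt0_le (E : set R) y : 0 < inf E -> E y -> inf E <= y.
Proof.
move=> E0 Ey; have iE : has_inf E.
  by apply: contrapT => /inf_out h; rewrite h ltxx in E0.
exact: (ge_inf iE.2).
Qed.

Lemma cont_extE (U : Type) (V W : normedModType R[i]) (P : set U) (e : U -> V)
    (f : U -> W) (v : V) (L : W) :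
  (forall d : R, 0 < d -> exists2 u, P u & rnorm (e u - v) < d) ->
  (forall r : R, 0 < r -> exists2 d : R, 0 < d &
     forall u, P u -> rnorm (e u - v) < d -> rnorm (f u - L) < r) ->
  cont_ext P e f v = L.
Proof.
move=> dP cf; rewrite /cont_ext.
set F := filter_from _ _.
have FF : ProperFilter F.
  apply: filter_from_proper.
    apply: filter_from_filter; first by exists setT; exact: filterT.
    move=> B C vB vC; exists (B `&` C); first exact: filterI.
    by move=> u [Pu [Bu Cu]].
  move=> B /nbhs_rnormP[d d0 hd]; have [u Pu ud] := dP d d0.
  by exists u; split=> //; exact: hd.
apply: cvg_lim; first exact: norm_hausdorff.
apply/cvg_rnormP => r r0; have [d d0 hd] := cf r r0.
exists [set w | rnorm (w - v) < d]; first by apply/nbhs_rnormP; exists d.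
by move=> u [Pu /= ud]; exact: hd.
Qed.

Lemma dot_inner (H : normedModType R[i]) (ip : {dot H for @Num.conj R[i]}) :
  hilbert_norm ip -> inner (fun x y => ip x y).
Proof.
move=> hip; split=> [a u v w|u v|u].
- by rewrite linearDl linearZl_LR.
- by rewrite [LHS]hermC expr0 mul1r.
- by rewrite hip rnormE -rmorphXn /= sqr_ge0.
Qed.

Lemma dot_rnorm (H : normedModType R[i]) (ip : {dot H for @Num.conj R[i]}) :
  hilbert_norm ip -> forall x, ipnorm (fun x y => ip x y) x = rnorm x.
Proof.
by move=> hip x; rewrite /ipnorm hip rnormE -rmorphXn /= sqrtr_sqr ger0_norm ?rnorm_ge0.
Qed.

End Preliminaries.

Section Scale.
Context {R : realType} {H : completeNormedModType R[i]}.
Variable ip : {dot H for @Num.conj R[i]}.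
Hypothesis ip_norm : hilbert_norm ip.
Variables A S : partial_op H H.
Hypotheses (A_sa : selfadjoint ip A) (a0_gt0 : 0 < lower_bound ip A)
  (S_sqrt : op_sqrt ip A S).
Let ipP : inner (fun x y => ip x y) := dot_inner ip_norm.
Let ip_rnorm := dot_rnorm ip_norm.
Local Notation a0 := (lower_bound ip A).

Lemma ip_CS x y : modc (ip x y) <= rnorm x * rnorm y.
Proof. by have := inner_CS ipP x y; rewrite !ip_rnorm. Qed.

Lemma ip_self x : ip x x = (rnorm x ^+ 2)%:C.
Proof. by rewrite ip_norm rnormE rmorphXn. Qed.

Lemma A_coercive x : opdom A x -> a0 * rnorm x ^+ 2 <= Rea (ip (A x) x).
Proof.
move=> Ax; have [->|/rnorm_gt0 x0] := eqVneq x 0.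
  by rewrite rnorm0 expr0n mulr0 (inner0r ipP).
have [[_ AL] _ _] := A_sa; have A0 : opdom A 0 by case: A_sa => -[].
pose c : R[i] := ((rnorm x)^-1)%:C.
have A00 : A 0 = 0.
  by have := (AL (-1) 0 0 A0 A0).2; rewrite scaler0 addr0 scaleN1r addNr.
have [h1 h2] := AL c x 0 Ax A0; rewrite !addr0 A00 addr0 in h1 h2.
have c0 : 0 < (rnorm x)^-1 by rewrite invr_gt0.
have : a0 <= Rea (ip (A (c *: x)) (c *: x)).
  apply: inf_gt0_le => //; exists (c *: x) => //; split=> //.
  by rewrite rnormE rnormZ modcR gtr0_norm // mulVf // gt_eqF.
rewrite h2 (innerZl ipP) (innerZr ipP) !ReImE /= oppr0 !mul0r !subr0.
rewrite -ler_pdivlMr ?exprn_gt0 // => h; apply: le_trans h _.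
by rewrite le_eqVlt; apply/orP; left; apply/eqP; field; rewrite gt_eqF.
Qed.

Lemma A_bounded_below x : opdom A x -> a0 * rnorm x <= rnorm (A x).
Proof.
move=> Ax; have := A_coercive Ax; have := ip_CS (A x) x.
have := le_trans (ler_norm _) (Re_le_modc (ip (A x) x)).
have [->|/rnorm_gt0 x0] := eqVneq x 0; first by move=> _ _ _; rewrite rnorm0 mulr0 rnorm_ge0.
move=> h1 h2 h3; rewrite -(ler_pM2r x0) -mulrA -expr2.
by apply: le_trans h3 _; apply: le_trans h1 h2.
Qed.

Lemma A_closed : closed_op A.
Proof.
move=> u x y Au ux uy; have [_ _ Aad] := A_sa; apply/Aad => w Aw.
apply/eqP; rewrite -subr_eq0; apply/eqP/modc_eq0/eqP.
rewrite eq_le modc_ge0 andbT; apply/ler_addgt0Pr => e e0; rewrite add0r.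
pose B := rnorm (A w) + rnorm w + 1.
have B0 : 0 < B by rewrite ltr_wpDl // addr_ge0 ?rnorm_ge0.
have eB : 0 < e / B by rewrite divr_gt0.
move/cvg_rnormP : ux => /(_ _ eB)[N1 _ h1].
move/cvg_rnormP : uy => /(_ _ eB)[N2 _ h2].
have := h1 (maxn N1 N2) (leq_maxl _ _); have := h2 (maxn N1 N2) (leq_maxr _ _).
rewrite /=; set n := maxn _ _ => {}h2 {}h1.
have -> : ip (A w) x - ip w y = ip w (A (u n) - y) - ip (A w) (u n - x).
  rewrite !(innerBr ipP) (_ : ip w (A (u n)) = ip (A w) (u n)).
    by ring.
  by apply/esym; apply: (Aad (u n) (A (u n))).1.
apply: le_trans (modcD _ _) _; rewrite modcN.
have := ip_CS w (A (u n) - y); have := ip_CS (A w) (u n - x).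
have := ler_wpM2l (rnorm_ge0 w) (ltW h2).
have := ler_wpM2l (rnorm_ge0 (A w)) (ltW h1).
have : e / B * B = e by rewrite divfK // gt_eqF.
rewrite {2}/B; move: eB; set d := e / B; lra.
Qed.

(** A selfadjoint operator that is bounded below is onto: a vector orthogonal to its
    range belongs to its kernel. *)
Lemma A_surj y : exists2 x, opdom A x & A x = y.
Proof.
have [AL _ Aad] := A_sa.
apply: (closed_op_surj (complete_seq_complete (V := H)) ipP ip_rnorm AL A_closed a0_gt0).
  exact: A_bounded_below.
move=> g hg; have [Ag Ag0] : opdom A g /\ A g = 0.
  by apply/Aad => x Ax; rewrite hg // (inner0r ipP).
have := A_bounded_below Ag; rewrite Ag0 rnorm0 pmulr_rle0 //.
exact: rnorm_le0.
Qed.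

Lemma S_surj y : exists2 x, opdom S x & S x = y.
Proof.
have [x Ax <-] := A_surj y; have [_ _ hdom hS] := S_sqrt.
by have [Sx SSx] := (hdom x).1 Ax; exists (S x); rewrite ?hS.
Qed.

Lemma S_linear : linear_op S. Proof. by case: S_sqrt => -[]. Qed.

Lemma S_sym x y : opdom S x -> opdom S y -> ip (S x) y = ip x (S y).
Proof.
by move=> Sx Sy; have [[_ _ Sad] _ _ _] := S_sqrt; apply: (Sad y (S y)).1.
Qed.

Lemma S_inj x y : opdom S x -> opdom S y -> S x = S y -> x = y.
Proof.
move=> Sx Sy E; have [S0 SL] := S_linear; have [_ _ hdom hS] := S_sqrt.
have [Sd Sd0] : opdom S (x - y) /\ S (x - y) = 0.
  by have := SL (-1) y x Sy Sx; rewrite !scaleN1r E addNr addrC.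
have Axy : opdom A (x - y) by apply/hdom; rewrite Sd0.
have := A_coercive Axy; rewrite hS // Sd0.
have -> : S 0 = 0.
  by have := (SL (-1) 0 0 S0 S0).2; rewrite scaler0 addr0 scaleN1r addNr.
rewrite (inner0l ipP) pmulr_rle0 // => h.
have : rnorm (x - y) ^+ 2 == 0 by rewrite eq_le h sqr_ge0.
by rewrite sqrf_eq0 => /eqP/rnorm_eq0/eqP; rewrite subr_eq0 => /eqP.
Qed.

(** With x = S w one has |x|^2 = (w, Sx) <= |w| |Sx|, and w is in the domain of A,
    where |x|^2 = (Aw, w) controls |w|^2. *)
Lemma S_bounded_below x : opdom S x -> Num.sqrt a0 * rnorm x <= rnorm (S x).
Proof.
move=> Sx; have [w Sw E] := S_surj x; have [_ _ hdom hS] := S_sqrt.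
have Aw : opdom A w by apply/hdom; rewrite E.
have s0 : 0 < Num.sqrt a0 by rewrite sqrtr_gt0.
have h1 : Num.sqrt a0 * rnorm w <= rnorm x.
  rewrite -ler_sqr ?nnegrE ?mulr_ge0 ?rnorm_ge0 ?(ltW s0) //.
  rewrite exprMn (sqr_sqrtr (ltW a0_gt0)); apply: le_trans (A_coercive Aw) _.
  by rewrite hS // E S_sym // E ip_self.
have h2 : rnorm x ^+ 2 <= rnorm w * rnorm (S x).
  have := ip_CS w (S x); rewrite -S_sym // E ip_self modcR ger0_norm ?sqr_ge0 //.
have [->|/rnorm_gt0 x0] := eqVneq x 0; first by rewrite rnorm0 mulr0 rnorm_ge0.
rewrite -(ler_pM2r x0) -mulrA -expr2.
apply: le_trans (ler_wpM2l (ltW s0) h2) _.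
by rewrite mulrA mulrC ler_wpM2l ?rnorm_ge0.
Qed.

Lemma op_invK x : opdom S x -> op_inv S (S x) = x.
Proof.
move=> Sx; rewrite /op_inv.
have [h1 h2] := @getPex _ [set y | opdom S y /\ S y = S x] (ex_intro _ x (conj Sx erefl)).
exact: S_inj.
Qed.

Variables (H1 : normedModType R[i]) (i1 : {linear H1 -> H}).
Hypothesis H1P : is_H1 S i1.

Lemma i1_dom x : opdom S (i1 x).
Proof. by case: H1P => _ <- _; exists x. Qed.

Lemma i1_surj y : opdom S y -> exists x, i1 x = y.
Proof. by case: H1P => _ <- _ [x _ <-]; exists x. Qed.

Lemma sqrt_norm x : rnorm (S (i1 x)) = rnorm x.
Proof. by case: H1P => _ _ h; rewrite /rnorm h. Qed.

Lemma sqrt_surj y : exists x, S (i1 x) = y.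
Proof.
have [z Sz <-] := S_surj y; have [x <-] := i1_surj Sz.
by exists x.
Qed.

Lemma sqrt_linear : linear (fun x => S (i1 x)).
Proof.
move=> a x y /=; rewrite linearP.
exact: (S_linear.2 _ _ _ (i1_dom x) (i1_dom y)).2.
Qed.

Lemma sqrtB x y : S (i1 (x - y)) = S (i1 x) - S (i1 y).
Proof.
have := sqrt_linear (-1) y x; rewrite !scaleN1r ![- _ + _]addrC; exact.
Qed.

Lemma H1_complete : seq_complete H1.
Proof.
move=> u uc.
have [l ul] : exists l : H, S (i1 (u n)) @[n --> \oo] --> l.
  apply: (complete_seq_complete (V := H)) => e e0.
  have [N hN] := uc e e0; exists N => m n Nm Nn.
  by rewrite -sqrtB sqrt_norm; exact: hN.
have [x xl] := sqrt_surj l; exists x; apply/cvg_rnormP => e e0.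
move/cvg_rnormP : ul => /(_ e e0); apply: filterS => n.
by rewrite -xl -sqrtB sqrt_norm.
Qed.

(** The map x |-> S x is a linear isometry of H_1 onto H; it carries the inner product
    and the completeness of H over to H_1. *)
Definition energy_ip (x y : H1) : R[i] := ip (S (i1 x)) (S (i1 y)).

Lemma energy_ip_inner : inner energy_ip.
Proof.
rewrite /energy_ip; split=> [a u v w|u v|u].
- by rewrite sqrt_linear (innerDl ipP) (innerZl ipP).
- exact: (innerC ipP).
- by rewrite ip_self /= sqr_ge0.
Qed.

Lemma energy_ip_rnorm x : ipnorm energy_ip x = rnorm x.
Proof.
by rewrite /ipnorm /energy_ip ip_self /= sqrtr_sqr ger0_norm ?rnorm_ge0 // sqrt_norm.
Qed.

Lemma i1_bounded x : rnorm (i1 x) <= (Num.sqrt a0)^-1 * rnorm x.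
Proof.
by rewrite ler_pdivlMl ?sqrtr_gt0 // -sqrt_norm; apply/S_bounded_below/i1_dom.
Qed.

Lemma i1_dense : dense (range i1).
Proof. by case: H1P => _ -> _; case: S_sqrt => -[]. Qed.

Variables (Hm : completeNormedModType R[i]) (j : {linear H -> Hm}).
Hypothesis HmP : is_Hm1 S j.

Let core : set H1 := [set u | opdom A (i1 u)].
Let jA (u : H1) : Hm := j (A (i1 u)).

(** The elements of H_1 that lie in the domain of A; there A acts as an isometry into
    H_{-1}, and its extension by continuity is A_ext. *)
Lemma coreP u : core u <-> opdom S (S (i1 u)).
Proof.
have [_ _ hdom _] := S_sqrt; split=> [/hdom[]//|h].
by apply/hdom; split=> //; exact: i1_dom.
Qed.

Lemma core_surj h : exists2 u, core u & A (i1 u) = h.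
Proof.
have [x Ax <-] := A_surj h; have [_ _ hdom _] := S_sqrt.
have [Sx _] := (hdom x).1 Ax; have [u ux] := i1_surj Sx.
by exists u; rewrite /core /= ux.
Qed.

Lemma core_dense x (e : R) : 0 < e -> exists2 u, core u & rnorm (u - x) < e.
Proof.
move=> e0; have Sd : dense (opdom S) by case: S_sqrt => -[].
have [y Sy xy] := (dense_rnormP _).1 Sd (S (i1 x)) e e0.
have [u uy] := sqrt_surj y; exists u; first by apply/coreP; rewrite uy.
by rewrite -sqrt_norm sqrtB uy rnormC.
Qed.

Lemma core_linear a u v : core u -> core v ->
  core (a *: u + v) /\ jA (a *: u + v) = a *: jA u + jA v.
Proof.
move=> cu cv; have [[_ AL] _ _] := A_sa; have [h1 h2] := AL a _ _ cu cv.
by rewrite /core /jA /= !linearP h2 !linearP.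
Qed.

Lemma jA_norm u : core u -> rnorm (jA u) = rnorm u.
Proof.
move=> cu; have [_ hj] := HmP; have [_ _ _ hS] := S_sqrt.
rewrite /jA [LHS]/rnorm hj hS // op_invK; last exact/coreP.
exact: sqrt_norm.
Qed.

Lemma jA_isom u v : core u -> core v -> rnorm (jA u - jA v) = rnorm (u - v).
Proof.
move=> cu cv; have [h1 h2] := core_linear (-1) cv cu.
by move: (jA_norm h1); rewrite h2 !scaleN1r ![- _ + _]addrC.
Qed.

(** The limit L of jA along one sequence of the core that converges to x satisfies the
    same estimate at every element of the core, so it is the limit defining
    A_ext. *)
Lemma A_ext_core x u : core u -> rnorm (jA u - A_ext A i1 j x) <= rnorm (u - x).
Proof.
have /choice[w hw] n : exists u, core u /\ rnorm (u - x) < (2^-1 : R) ^+ n.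
  by have [v] := core_dense x (half_gt0 n); exists v.
have wx : w n @[n --> \oo] --> x.
  apply/cvg_rnormP => e e0; have [N hN] := half_small e0.
  by exists N => // n Nn /=; apply: lt_trans (hw n).2 (hN n Nn).
have [L wL] : exists L : Hm, jA (w n) @[n --> \oo] --> L.
  apply: (complete_seq_complete (V := Hm)) => e e0.
  have e2 : 0 < e / 2 by rewrite divr_gt0.
  move/cvg_rnormP : wx => /(_ _ e2)[N _ hN]; exists N => m n Nm Nn.
  rewrite (jA_isom (hw m).1 (hw n).1).
  have := rnorm_tri (w m) x (w n); rewrite (rnormC x).
  have := hN m Nm; have := hN n Nn; rewrite /=; lra.
have key v : core v -> rnorm (jA v - L) <= rnorm (v - x).
  move=> cv; apply/ler_addgt0Pr => e e0.
  have e2 : 0 < e / 2 by rewrite divr_gt0.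
  move/cvg_rnormP : wx => /(_ _ e2)[N1 _ h1].
  move/cvg_rnormP : wL => /(_ _ e2)[N2 _ h2].
  have := h1 (maxn N1 N2) (leq_maxl _ _); have := h2 (maxn N1 N2) (leq_maxr _ _).
  rewrite /=; set n := maxn _ _ => {}h2 {}h1.
  have := rnorm_tri (jA v) (jA (w n)) L; rewrite (jA_isom cv (hw n).1).
  by have := rnorm_tri v x (w n); rewrite (rnormC x); lra.
suff -> : A_ext A i1 j x = L by exact: key.
apply: cont_extE => [d d0|r r0]; first exact: core_dense.
by exists r => // v cv; apply: le_lt_trans; exact: key.
Qed.

Lemma A_extE u : core u -> A_ext A i1 j u = jA u.
Proof.
move=> cu; apply/esym/eqP; rewrite -subr_eq0; apply/eqP/rnorm_le0.
by apply: le_trans (A_ext_core u cu) _; rewrite subrr rnorm0.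
Qed.

Lemma A_ext_linear : linear (A_ext A i1 j).
Proof.
move=> a x y; apply/eqP; rewrite -subr_eq0; apply/eqP/rnorm_le0.
apply/ler_addgt0Pr => e e0; rewrite add0r.
pose d := e / (2 * (modc a + 1)).
have a1 : 0 < modc a + 1 by rewrite ltr_wpDl // modc_ge0.
have d0 : 0 < d by rewrite divr_gt0 // mulr_gt0.
have [u cu ux] := core_dense x d0; have [v cv vy] := core_dense y d0.
have [cuv E] := core_linear a cu cv.
have h0 := A_ext_core (a *: x + y) cuv.
have h1 := A_ext_core x cu; have h2 := A_ext_core y cv.
set X := A_ext _ _ _ _ in h1 *; set Y := A_ext _ _ _ _ in h2 *.
set Z := A_ext _ _ _ _ in h0 *.
have -> : Z - (a *: X + Y) = (a *: (jA u - X) + (jA v - Y)) - (jA (a *: u + v) - Z).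
  by rewrite E scalerBr addrACA -opprD subrACA subrr sub0r opprB.
apply: le_trans (rnormD _ _) _; rewrite rnormN.
apply: le_trans (lerD (rnormD _ _) h0) _; rewrite rnormZ.
have -> : a *: u + v - (a *: x + y) = a *: (u - x) + (v - y).
  by rewrite scalerBr opprD addrACA.
have h3 := rnormD (a *: (u - x)) (v - y); rewrite rnormZ in h3.
have h4 : modc a * rnorm (u - x) <= modc a * d by rewrite ler_wpM2l ?modc_ge0 // ltW.
have h5 : modc a * rnorm (jA u - X) <= modc a * d.
  by rewrite ler_wpM2l ?modc_ge0 // (le_trans h1) // ltW.
have h6 : 2 * (modc a + 1) * d = e by rewrite /d mulrC divfK // gt_eqF // mulr_gt0.
lra.
Qed.

Lemma A_ext_isom x : rnorm (A_ext A i1 j x) = rnorm x.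
Proof.
have key (e : R) : 0 < e -> `|rnorm (A_ext A i1 j x) - rnorm x| <= e.
  move=> e0; have e2 : 0 < e / 2 by rewrite divr_gt0.
  have [u cu ux] := core_dense x e2; have := A_ext_core x cu.
  have := jA_norm cu; set Y := A_ext _ _ _ _; move: (jA u) => v vu vY.
  rewrite ler_norml.
  have := rnorm_tri Y v 0; have := rnorm_tri v Y 0.
  have := rnorm_tri u x 0; have := rnorm_tri x u 0.
  by rewrite !subr0 (rnormC Y) (rnormC x); lra.
apply/eqP; rewrite -subr_eq0 -normr_eq0 eq_le normr_ge0 andbT.
by apply/ler_addgt0Pr => e e0; rewrite add0r; exact: key.
Qed.

(** Every element of H is A u with u in the domain of A, and then (h, y) = <u, y>_1. *)
Lemma j_core h : exists2 u, A_ext A i1 j u = j h & forall y, energy_ip u y = ip h (i1 y).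
Proof.
have [u cu uh] := core_surj h; exists u; first by rewrite A_extE // /jA uh.
have [_ _ _ hS] := S_sqrt; move=> y; rewrite /energy_ip -uh hS //.
by rewrite [RHS]S_sym //; [exact/coreP|exact: i1_dom].
Qed.

Lemma A_extB x y : A_ext A i1 j (x - y) = A_ext A i1 j x - A_ext A i1 j y.
Proof.
by have := A_ext_linear (-1) y x; rewrite !scaleN1r ![- _ + _]addrC.
Qed.

(** The range is closed, as that of an isometry on a complete space, and contains the
    dense range of j. *)
Lemma A_ext_surj f : exists x, A_ext A i1 j x = f.
Proof.
have [jd _] := HmP.
have /choice[w hw] n : exists u, rnorm (A_ext A i1 j u - f) < (2^-1 : R) ^+ n.
  have [_ [h _ <-]] := (dense_rnormP _).1 jd f _ (half_gt0 n).
  by have [u uh _] := j_core h; exists u; rewrite uh rnormC.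
have wf : A_ext A i1 j (w n) @[n --> \oo] --> f.
  apply/cvg_rnormP => e e0; have [N hN] := half_small e0.
  by exists N => // n Nn /=; apply: lt_trans (hw n) (hN n Nn).
have [x wx] : exists x : H1, w n @[n --> \oo] --> x.
  apply: H1_complete => e e0; have e2 : 0 < e / 2 by rewrite divr_gt0.
  move/cvg_rnormP : wf => /(_ _ e2)[N _ hN]; exists N => m n Nm Nn.
  rewrite -A_ext_isom A_extB.
  have := rnorm_tri (A_ext A i1 j (w m)) f (A_ext A i1 j (w n)).
  rewrite (rnormC f); have := hN m Nm; have := hN n Nn; rewrite /=; lra.
exists x; apply: (cvg_rnorm_unique _ wf); apply/cvg_rnormP => e e0.
move/cvg_rnormP : wx => /(_ e e0); apply: filterS => n.
by rewrite -A_extB A_ext_isom.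
Qed.

Lemma energy_ip_CS x y : modc (energy_ip x y) <= rnorm x * rnorm y.
Proof. by have := inner_CS energy_ip_inner x y; rewrite !energy_ip_rnorm. Qed.

(** Through A, the duality between H_{-1} and H_1 becomes the inner product of H_1. *)
Lemma pairing_A x y : pairing ip i1 j (A_ext A i1 j x) y = energy_ip x y.
Proof.
rewrite /pairing.
apply: (@cont_extE _ _ _ ((R[i] : numFieldType)^o : normedModType R[i])) => [d d0|r r0].
  have [_ [h _ <-]] := (dense_rnormP _).1 HmP.1 (A_ext A i1 j x) d d0.
  by exists h => //; rewrite rnormC.
have y1 : 0 < rnorm y + 1 by rewrite ltr_wpDl // rnorm_ge0.
exists (r / (rnorm y + 1)) => [|h _]; first by rewrite divr_gt0.
have [u <- hu] := j_core h.
rewrite -A_extB A_ext_isom rnorm_scalar -hu -(innerBl energy_ip_inner) ltr_pdivlMr //.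
by have := energy_ip_CS (u - x) y; have := rnorm_ge0 (u - x); nra.
Qed.

End Scale.

(** * The scalar inequalities behind the constants *)

Section Scalars.
Context {R : realType}.
Implicit Types d e p b a w : R.

Lemma rate_poly d e : 0 < d -> d <= e ->
  5 * (d * (2 * e ^+ 2 + 2 * d * e - d ^+ 2) ^+ 2) <=
  2 * ((d + 2 * e) * e ^+ 2 * (e + 2 * d) ^+ 2).
Proof.
move=> d0 de; rewrite -subr_ge0; have [f f0 ->] : exists2 f, 0 <= f & e = d + f.
  by exists (e - d); [rewrite subr_ge0|ring].
set E := (X in 0 <= X).
have -> : E = d * ((3 * d ^+ 2 - 2 * f ^+ 2) ^+ 2 + 14 * f ^+ 4)
   + 16 * d ^+ 2 * f ^+ 3 + 4 * f ^+ 5.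
  by rewrite /E; ring.
have p1 : 0 <= (3 * d ^+ 2 - 2 * f ^+ 2) ^+ 2 by exact: sqr_ge0.
have p2 : 0 <= f ^+ 4 by exact: exprn_ge0.
have p3 : 0 <= d ^+ 2 * f ^+ 3 by apply: mulr_ge0 (sqr_ge0 _) _; exact: exprn_ge0.
have p4 : 0 <= f ^+ 5 by exact: exprn_ge0.
have p5 : 0 <= d * ((3 * d ^+ 2 - 2 * f ^+ 2) ^+ 2 + 14 * f ^+ 4).
  by apply: mulr_ge0 (ltW d0) _; lra.
lra.
Qed.

(** Here b, p, d, e, a and w stand for 1/beta, 1/sqrt(alpha delta), |D|/sqrt delta,
    sqrt(d^2 + 4p), 1/sqrt alpha and omega; the definition of omega reads
    1/w = b + e^2/2 + de. The bound says that the quadratic form of the next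
    lemma has a negative discriminant, with a margin of 4/5. It follows from
    b <= p, a <= pd and 2p = (e^2 - d^2)/2, which reduce it to the homogeneous
    polynomial inequality above. *)
Lemma rate_discr d e p b a w : 0 < d -> d <= e -> e ^+ 2 = d ^+ 2 + 4 * p ->
  0 < b -> b <= p -> 0 <= a -> a <= p * d -> 0 < w ->
  w * (b + e ^+ 2 / 2 + d * e) = 1 ->
  w * (d + 2 * w * a) ^+ 2 <= 4 / 5 * (1 - 3 * w * b).
Proof.
move=> d0 de ep b0 bp a0 apd w0 wQ.
have e0 : 0 < e by apply: lt_le_trans de.
pose Q := e ^+ 2 / 2 + d * e.
have Q0 : 0 < Q by rewrite addr_gt0 ?divr_gt0 ?mulr_gt0 ?exprn_gt0.
have wQ1 : w * Q <= 1.
  by rewrite -wQ /Q -addrA ler_pM2l // lerDr ltW.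
pose t := d + 2 * p * d / Q.
have p0 : 0 < p by apply: lt_le_trans bp.
have wt : d + 2 * w * a <= t.
  rewrite /t lerD2l ler_pdivlMr //.
  have h1 : w * Q * a <= a by rewrite ler_piMl.
  by rewrite -!mulrA [a * Q]mulrC [w * _]mulrA; lra.
have t0 : 0 <= d + 2 * w * a by rewrite addr_ge0 ?mulr_ge0 // ltW.
have h1 : w * (d + 2 * w * a) ^+ 2 <= w * t ^+ 2.
  rewrite ler_pM2l // ler_sqr ?nnegrE //; exact: le_trans wt.
apply: le_trans h1 _.
have -> : 1 - 3 * w * b = w * (Q - 2 * b) by rewrite -{1}wQ /Q; ring.
rewrite [4 / 5 * _]mulrCA ler_pM2l //.
apply: (@le_trans _ _ (4 / 5 * (d ^+ 2 / 2 + d * e))); last first.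
  by rewrite ler_pM2l // /Q ep; lra.
have pE : p = (e ^+ 2 - d ^+ 2) / 4 by rewrite ep; field.
have tE : t = d * (2 * e ^+ 2 + 2 * d * e - d ^+ 2) / (e * (e + 2 * d)).
  have e2 : 0 < e + 2 * d by rewrite addr_gt0 // mulr_gt0.
  have e3 : 0 < e ^+ 2 + d * e * 2.
    by apply: addr_gt0; [exact: exprn_gt0|rewrite !mulr_gt0].
  by rewrite /t /Q pE; field; rewrite !gt_eqF.
rewrite tE expr_div_n ler_pdivrMr ?exprn_gt0 ?mulr_gt0 ?addr_gt0 ?mulr_gt0 //.
have h2 := ler_wpM2l (ltW d0) (rate_poly d0 de).
rewrite -subr_ge0; rewrite -subr_ge0 in h2.
set E := (X in 0 <= X).
have -> : E = 1 / 5 * (d * (2 * ((d + 2 * e) * e ^+ 2 * (e + 2 * d) ^+ 2)) -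
  d * (5 * (d * (2 * e ^+ 2 + 2 * d * e - d ^+ 2) ^+ 2))) by rewrite /E; field.
by rewrite mulr_ge0.
Qed.

Lemma rate_form d e p b a w rho v : 0 < d -> d <= e -> e ^+ 2 = d ^+ 2 + 4 * p ->
  0 < b -> b <= p -> 0 <= a -> a <= p * d -> 0 < w ->
  w * (b + e ^+ 2 / 2 + d * e) = 1 ->
  2 * (w * (d + 2 * w * a) * (rho * v)) <=
    9 / 10 * ((1 - 3 * w * b) * rho ^+ 2 + w * v ^+ 2).
Proof.
move=> d0 de ep b0 bp a0 apd w0 wQ; have h := rate_discr d0 de ep b0 bp a0 apd w0 wQ.
have P0 : 0 <= 1 - 3 * w * b.
  by have := mulr_ge0 (ltW w0) (sqr_ge0 (d + 2 * w * a)); lra.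
rewrite [9 / 10 * _]mulrDr; apply: amgm.
- by rewrite mulr_ge0 // mulr_ge0 ?sqr_ge0.
- by rewrite mulr_ge0 // mulr_ge0 ?sqr_ge0 // ltW.
have -> : (w * (d + 2 * w * a) * (rho * v)) ^+ 2 =
  w * (w * (d + 2 * w * a) ^+ 2) * (rho ^+ 2 * v ^+ 2) by ring.
have -> : 9 / 10 * ((1 - 3 * w * b) * rho ^+ 2) * (9 / 10 * (w * v ^+ 2)) =
  w * (81 / 100 * (1 - 3 * w * b)) * (rho ^+ 2 * v ^+ 2) by field.
apply: ler_wpM2r; first exact: mulr_ge0 (sqr_ge0 _) (sqr_ge0 _).
by rewrite ler_pM2l //; lra.
Qed.

(** By the inequality of arithmetic and geometric means, 1/w >= b + (3/2) nD implies
    1/w^2 >= 6 b nD. *)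
Lemma rate_positive d e b w (nD : R) : 0 < d -> d <= e -> 0 < b -> 0 <= nD ->
  nD <= d ^+ 2 -> 0 < w -> w * (b + e ^+ 2 / 2 + d * e) = 1 ->
  w ^+ 2 * (nD * b) <= 1 / 6.
Proof.
move=> d0 de b0 n0 nd w0 wQ.
have h1 : w * (b + 3 / 2 * nD) <= 1.
  rewrite -[leRHS]wQ ler_pM2l // -addrA lerD2l.
  have e0 : 0 <= e by apply: le_trans de; exact: ltW.
  have : d ^+ 2 <= e ^+ 2 by rewrite ler_sqr // nnegrE ltW.
  have : d * d <= d * e by rewrite ler_pM2l.
  by lra.
have h2 : (w * (b + 3 / 2 * nD)) ^+ 2 <= 1.
  have h3 : 0 <= w * (b + 3 / 2 * nD).
    by apply: mulr_ge0 (ltW w0) _; have := ltW b0; lra.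
  by have := ler_pM h3 h3 h1 h1; rewrite mulr1 expr2.
have := mulr_ge0 (sqr_ge0 w) (sqr_ge0 (b - 3 / 2 * nD)).
rewrite -subr_ge0; move: h2; rewrite -subr_ge0; rewrite !expr2; lra.
Qed.

Lemma sector_const_cvg (nu b de be t : R) : 0 <= b -> 0 < de -> 0 < t ->
  (fun th => nu + 2 / (de * (b + Num.sqrt (b ^+ 2 + 4 * th))) +
     (Num.sqrt th - b) / be) @ t -->
  nu + 2 / (de * (b + Num.sqrt (b ^+ 2 + 4 * t))) + (Num.sqrt t - b) / be.
Proof.
move=> b0 de0 t0.
have s0 : 0 < b + Num.sqrt (b ^+ 2 + 4 * t).
  by rewrite ltr_wpDl // sqrtr_gt0 ltr_wpDl ?sqr_ge0 // mulr_gt0.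
have cs : Num.sqrt th @[th --> t] --> Num.sqrt t by exact: sqrt_continuous.
have cs2 : Num.sqrt (b ^+ 2 + 4 * th) @[th --> t] --> Num.sqrt (b ^+ 2 + 4 * t).
  apply: (cvg_comp (fun th => b ^+ 2 + 4 * th) Num.sqrt); last exact: sqrt_continuous.
  by apply: cvgD; [exact: cvg_cst|apply: cvgMr; exact: cvg_id].
apply: cvgD.
  apply: cvgD; first exact: cvg_cst.
  apply: cvgMr; apply: cvgV; first by rewrite mulf_neq0 // gt_eqF.
  by apply: cvgMr; apply: cvgD => //; exact: cvg_cst.
by apply: cvgMl; apply: cvgB => //; exact: cvg_cst.
Qed.

(** The function is continuous and is at least its value at b^2 + 1 for large th and,
    when b = 0, for small th; its minimum over the remaining compact interval is
    global. *)
Lemma sector_const_min (nu b de be : R) : 0 <= b -> 0 < de -> 0 < be ->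
  let f th := nu + 2 / (de * (b + Num.sqrt (b ^+ 2 + 4 * th))) +
     (Num.sqrt th - b) / be in
  exists2 t, b ^+ 2 <= t /\ 0 < t &
    forall th, b ^+ 2 <= th -> 0 < th -> f t <= f th.
Proof.
move=> b0 de0 be0 f.
pose t0 := b ^+ 2 + 1.
have t00 : 0 < t0 by rewrite ltr_wpDl ?sqr_ge0.
have sb th : b ^+ 2 <= th -> b <= Num.sqrt th.
  by move=> h; rewrite -[b]ger0_norm // -sqrtr_sqr ler_wsqrtr.
have first_gt0 th : 0 < th -> 0 < 2 / (de * (b + Num.sqrt (b ^+ 2 + 4 * th))).
  move=> th0; rewrite divr_gt0 // mulr_gt0 // ltr_wpDl // sqrtr_gt0.
  by rewrite ltr_wpDl ?sqr_ge0 // mulr_gt0.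
pose F := f t0 - nu.
have last_ge0 th : b ^+ 2 <= th -> 0 <= (Num.sqrt th - b) / be.
  by move=> h; rewrite divr_ge0 ?(ltW be0) // subr_ge0 sb.
have bt0 : b ^+ 2 <= t0 by rewrite lerDl.
have F0 : 0 < F.
  by have := first_gt0 _ t00; have := last_ge0 _ bt0; rewrite /F /f; lra.
pose hi := (b + be * F) ^+ 2 + t0.
have hiP th : hi < th -> f t0 <= f th.
  move=> h.
  have h1 : b + be * F <= Num.sqrt th.
    have h2 : 0 <= b + be * F by rewrite addr_ge0 // mulr_ge0 // ltW.
    rewrite -[b + _]ger0_norm // -sqrtr_sqr ler_wsqrtr //.
    by apply: le_trans (ltW h); rewrite lerDl ltW.
  have h3 : F <= (Num.sqrt th - b) / be by rewrite ler_pdivlMr //; lra.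
  have th0 : 0 < th.
    by apply: lt_trans h; rewrite ltr_wpDl ?sqr_ge0.
  by have := first_gt0 _ th0; move: h3; rewrite /F /f; lra.
have [lo [lo0 blo lot] loP] : exists2 lo, [/\ 0 < lo, b ^+ 2 <= lo & lo <= t0] &
    forall th, b ^+ 2 <= th -> 0 < th -> th < lo -> f t0 <= f th.
  have [bz|bnz] := eqVneq b 0; last first.
    exists (b ^+ 2) => //; first by split=> //; rewrite exprn_gt0 // lt_def bnz.
    by move=> th h _ /lt_geF; rewrite h.
  pose s := (de * F)^-1.
  have s0 : 0 < s by rewrite invr_gt0 mulr_gt0.
  exists (Num.min t0 (s ^+ 2)).
    split; rewrite ?lt_min ?t00 ?exprn_gt0 ?ge_min ?lexx //.
    by rewrite bz expr0n /= le_min !ltW // exprn_gt0.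
  move=> th _ th0; rewrite lt_min => /andP[_ ths].
  have h1 : Num.sqrt (b ^+ 2 + 4 * th) <= 2 * s.
    rewrite bz expr0n add0r -[2 * s]ger0_norm ?mulr_ge0 ?(ltW s0) //.
    rewrite -sqrtr_sqr ler_wsqrtr // exprMn -natrX ler_pM2l // ltW //.
  have h2 : 0 < Num.sqrt (b ^+ 2 + 4 * th).
    by rewrite sqrtr_gt0 ltr_wpDl ?sqr_ge0 // mulr_gt0.
  have h3 : F <= 2 / (de * (b + Num.sqrt (b ^+ 2 + 4 * th))).
    rewrite bz add0r -bz ler_pdivlMr ?mulr_gt0 //.
    have h4 : F * de * Num.sqrt (b ^+ 2 + 4 * th) <= F * de * (2 * s).
      by rewrite ler_pM2l // mulr_gt0.
    have h5 : F * de * (2 * s) = 2 by rewrite /s; field; rewrite !gt_eqF.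
    by rewrite mulrA -h5.
  have : 0 <= (Num.sqrt th - b) / be.
    by rewrite divr_ge0 ?(ltW be0) // bz subr0 sqrtr_ge0.
  by move: h3; rewrite /F /f; lra.
have lohi : lo <= hi by apply: le_trans lot _; rewrite lerDr sqr_ge0.
have fc : {within `[lo, hi], continuous f}.
  apply: continuous_in_subspaceT => x; rewrite inE /= in_itv /= => /andP[lx _].
  by apply: sector_const_cvg => //; exact: lt_le_trans lx.
have [c] := EVT_min lohi fc; rewrite in_itv /= => /andP[lc ch] cmin.
exists c; first by split; [exact: le_trans lc|exact: lt_le_trans lc].
move=> th bth th0.
have ct0 : f c <= f t0.
  by apply: cmin; rewrite in_itv /= lot /= lerDr sqr_ge0.
have [h|h] := ltP th lo; first exact: le_trans ct0 (loP _ bth th0 h).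
have [h'|h'] := ltP hi th; first exact: le_trans ct0 (hiP _ h').
by apply: cmin; rewrite in_itv /= h.
Qed.

End Scalars.

(** * The operator matrix and the pencil *)

Section ProductNorm.
Context {R : realType} {H H1 : normedModType R[i]}.
Implicit Types w : (H * H1)%type.

Lemma prod_rnorm w : rnorm w = Num.max (rnorm w.1) (rnorm w.2).
Proof.
rewrite {1}/rnorm prod_normE !rnormE !maxEle lecR.
by case: ifP.
Qed.

Lemma rnorm_prod1 w : rnorm w.1 <= rnorm w.
Proof. by rewrite prod_rnorm le_max lexx. Qed.

Lemma rnorm_prod2 w : rnorm w.2 <= rnorm w.
Proof. by rewrite prod_rnorm le_max lexx orbT. Qed.

Lemma prod_rnorm_le w : rnorm w <= rnorm w.1 + rnorm w.2.
Proof. by rewrite prod_rnorm ge_max lerDl lerDr !rnorm_ge0. Qed.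

End ProductNorm.

Section Damped.
Context {R : realType} {H H1 : normedModType R[i]}.
Hypotheses (Hc : seq_complete H) (H1c : seq_complete H1).
Variables (ip : H -> H -> R[i]) (ip1 : H1 -> H1 -> R[i]).
Hypotheses (ipP : inner ip) (ip_rnorm : forall x, ipnorm ip x = rnorm x)
  (ip1P : inner ip1) (ip1_rnorm : forall x, ipnorm ip1 x = rnorm x).
Variables (i : {linear H1 -> H}) (N : {linear H -> H1}) (B : {linear H1 -> H1}).
Variables (kap nD : R).
Hypotheses (i_dense : dense (range i))
  (kap_gt0 : 0 < kap) (i_bound : forall x, rnorm (i x) <= kap * rnorm x)
  (N_adj : forall h y, ip1 (N h) y = ip h (i y)) (N_dense : dense (range N))
  (nD_gt0 : 0 < nD) (B_bound : forall x, rnorm (B x) <= nD * rnorm x).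

Let CS := inner_CS ipP.
Let CS1 := inner_CS ip1P.

Lemma H_CS x y : modc (ip x y) <= rnorm x * rnorm y.
Proof. by have := CS x y; rewrite !ip_rnorm. Qed.
Lemma H1_CS x y : modc (ip1 x y) <= rnorm x * rnorm y.
Proof. by have := CS1 x y; rewrite !ip1_rnorm. Qed.
Lemma ip_selfE x : ip x x = (rnorm x ^+ 2)%:C.
Proof. by rewrite innerE // ip_rnorm. Qed.
Lemma ip1_selfE x : ip1 x x = (rnorm x ^+ 2)%:C.
Proof. by rewrite innerE // ip1_rnorm. Qed.

Lemma N_bound h : rnorm (N h) <= kap * rnorm h.
Proof.
have := H_CS h (i (N h)); rewrite -N_adj ip1_selfE modcR ger0_norm ?sqr_ge0 //.
have [->|/rnorm_gt0 x0] := eqVneq (N h) 0.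
  by move=> _; rewrite rnorm0 mulr_ge0 ?rnorm_ge0 // ltW.
move=> h1; rewrite -(ler_pM2r x0) -expr2; apply: le_trans h1 _.
apply: le_trans (ler_wpM2l (rnorm_ge0 h) (i_bound (N h))) _.
by rewrite mulrCA mulrA.
Qed.

(** Everything below is pulled back to H_1 by the isometry A of H_1 onto H_{-1}: B is
    A^-1 D, N is A^-1 on H, which is the adjoint of the embedding i of H_1 into
    H, and pencil1 l is A^-1 L(l). *)
Definition pencil1 (l : R[i]) (x : H1) : H1 := l ^+ 2 *: N (i x) + l *: B x + x.

Lemma pencil1_linear l : linear (pencil1 l).
Proof.
move=> a x y.
have E1 : l ^+ 2 *: N (i (a *: x + y)) =
    a *: (l ^+ 2 *: N (i x)) + l ^+ 2 *: N (i y).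
  by rewrite !linearP.
have E2 : l *: B (a *: x + y) = a *: (l *: B x) + l *: B y.
  by rewrite !linearP.
rewrite /pencil1 E1 E2 !scalerDr.
by rewrite [X in X + (a *: x + y)]addrACA [LHS]addrACA.
Qed.

Lemma pencil1_bound l x :
  rnorm (pencil1 l x) <= (modc l ^+ 2 * kap ^+ 2 + modc l * nD + 1) * rnorm x.
Proof.
rewrite /pencil1; apply: le_trans (rnormD _ _) _.
apply: le_trans (lerD (rnormD _ _) (lexx _)) _; rewrite !rnormZ expr2 modcM.
rewrite !mulrDl mul1r lerD2r; apply: lerD.
  rewrite -expr2 -mulrA ler_wpM2l ?sqr_ge0 // expr2 -mulrA.
  apply: le_trans (N_bound _) _; rewrite ler_pM2l //.
by rewrite -mulrA ler_wpM2l ?modc_ge0.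
Qed.

Definition pencil1_regular (l : R[i]) : Prop := exists G : {linear H1 -> H1},
  [/\ continuous G, cancel G (pencil1 l) & cancel (pencil1 l) G].

Lemma pencil1_ip l y : ip1 (pencil1 l y) y =
  l ^+ 2 * (rnorm (i y) ^+ 2)%:C + l * ip1 (B y) y + (rnorm y ^+ 2)%:C.
Proof.
by rewrite /pencil1 !(innerDl ip1P) !(innerZl ip1P) N_adj ip_selfE ip1_selfE.
Qed.

Lemma coercive_regular l (c : R) : 0 < c ->
  (forall y, c * rnorm y ^+ 2 <= modc (ip1 (pencil1 l y) y)) -> pencil1_regular l.
Proof.
move=> c0 hc; have [P PE] := ex_linear (pencil1_linear l).
pose M := modc l ^+ 2 * kap ^+ 2 + modc l * nD + 1.
have M0 : 0 < M.
  have := modc_ge0 l; have := mulr_ge0 (sqr_ge0 (modc l)) (sqr_ge0 kap).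
  by have := mulr_ge0 (modc_ge0 l) (ltW nD_gt0); rewrite /M; lra.
have Pc : continuous P.
  apply/linear_continuousP; exists M => // x.
  by rewrite PE; exact: pencil1_bound.
have hcP x : c * rnorm x ^+ 2 <= modc (ip1 (P x) x) by rewrite PE.
have /choice[g gP] := coercive_surj H1c ip1P ip1_rnorm Pc c0 hcP.
have Pb x : c * rnorm x <= rnorm (P x).
  have [->|/rnorm_gt0 x0] := eqVneq x 0; first by rewrite rnorm0 mulr0 rnorm_ge0.
  rewrite -(ler_pM2r x0) -mulrA -expr2; apply: le_trans (hcP x) _; exact: H1_CS.
have Pinj x y : P x = P y -> x = y.
  move=> E; apply/eqP; rewrite -subr_eq0; apply/eqP/rnorm_le0.
  by rewrite -(pmulr_rle0 _ c0); apply: le_trans (Pb _) _; rewrite linearB E subrr rnorm0.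
have [|G GE] := @ex_linear _ _ _ g.
  by move=> a x y; apply: Pinj; rewrite linearP !gP.
exists G; split.
- apply/linear_continuousP; exists c^-1 => [|x]; first by rewrite invr_gt0.
  by rewrite ler_pdivlMl // GE -{2}(gP x); exact: Pb.
- by move=> x; rewrite GE -PE gP.
- by move=> x; apply: Pinj; rewrite GE -PE gP.
Qed.

Variable T : partial_op (H * H1)%type (H * H1)%type.
Hypotheses (T_dom : forall w, opdom T w <->
    exists x z, w.1 = i x /\ B x + w.2 = N z)
  (T_val : forall w x z, w.1 = i x -> B x + w.2 = N z -> T w = (- z, x)).

Lemma T_linear : linear_op T.
Proof.
split.
  by apply/T_dom; exists 0, 0; rewrite /= !linear0 addr0.
move=> a u v /T_dom[x [z [ux uz]]] /T_dom[x' [z' [vx vz]]].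
have h1 : (a *: u + v).1 = i (a *: x + x') by rewrite !linearP -ux -vx.
have h2 : B (a *: x + x') + (a *: u + v).2 = N (a *: z + z').
  by rewrite !linearP /= addrACA -scalerDr uz vz.
split; first by apply/T_dom; exists (a *: x + x'), (a *: z + z').
rewrite (T_val h1 h2) (T_val ux uz) (T_val vx vz).
by rewrite -[RHS]/(a *: - z + - z', a *: x + x') opprD scalerN.
Qed.

(** Given (f, g), choose i x near f, and then z with N z near B x + g. *)
Lemma T_densely_defined : dense (opdom T).
Proof.
apply/dense_rnormP => w e e0.
have e4 : 0 < e / 4 by rewrite divr_gt0.
have [_ [x _ <-] hx] := (dense_rnormP _).1 i_dense w.1 _ e4.
have [_ [z _ <-] hz] := (dense_rnormP _).1 N_dense (B x + w.2) _ e4.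
exists (i x, N z - B x).
  by apply/T_dom; exists x, z; split=> //=; rewrite addrC subrK.
apply: le_lt_trans (prod_rnorm_le _) _ => /=.
have -> : w.2 - (N z - B x) = B x + w.2 - N z by rewrite opprB addrA [w.2 + _]addrC.
lra.
Qed.

Lemma product_complete : seq_complete (H * H1)%type.
Proof.
move=> u uc.
have [a ua] : exists a : H, (u n).1 @[n --> \oo] --> a.
  apply: Hc => e e0; have [M hM] := uc e e0; exists M => m n Mm Mn.
  by apply: le_lt_trans (hM m n Mm Mn); exact: (rnorm_prod1 (u m - u n)).
have [b ub] : exists b : H1, (u n).2 @[n --> \oo] --> b.
  apply: H1c => e e0; have [M hM] := uc e e0; exists M => m n Mm Mn.
  by apply: le_lt_trans (hM m n Mm Mn); exact: (rnorm_prod2 (u m - u n)).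
exists (a, b); apply/cvg_rnormP => e e0.
have e2 : 0 < e / 2 by rewrite divr_gt0.
move/cvg_rnormP : ua => /(_ _ e2); move/cvg_rnormP : ub => /(_ _ e2).
apply: filterS2 => n h1 h2; apply: le_lt_trans (prod_rnorm_le _) _ => /=.
by rewrite [e]splitr addrC ltrD.
Qed.

(** Eliminating w_2 from (T - l) w = f leaves pencil1 l x = f_2 - l N f_1 for the
    element x of H_1 that represents w_1. *)
Lemma regular_resolvent l : pencil1_regular l -> resolvent_set T l.
Proof.
move=> [G [/linear_continuousP[CG CG0 hG] GK KG]].
pose X (w : (H * H1)%type) := G (w.2 - l *: N w.1).
pose Y (w : (H * H1)%type) := N w.1 + l *: N (i (X w)) + B (X w).
have XL a u v : X (a *: u + v) = a *: X u + X v.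
  rewrite /X -linearP; congr (G _).
  have -> : l *: N (a *: u + v).1 = a *: (l *: N u.1) + l *: N v.1 by rewrite !linearP.
  by rewrite scalerBr /= opprD addrACA.
have YL a u v : Y (a *: u + v) = a *: Y u + Y v.
  rewrite /Y XL.
  have -> : N (a *: u + v).1 = a *: N u.1 + N v.1 by rewrite !linearP.
  have -> : l *: N (i (a *: X u + X v)) = a *: (l *: N (i (X u))) + l *: N (i (X v)).
    by rewrite !linearP.
  by rewrite linearP !scalerDr [X in X + (a *: _ + _)]addrACA [LHS]addrACA.
have [|g gE] := @ex_linear _ _ _ (fun w => (i (X w), - Y w)).
  move=> a u v; rewrite XL YL opprD -scalerN linearP.
  by [].
have PX w : pencil1 l (X w) = w.2 - l *: N w.1 by rewrite GK.
have gdom w : i (X w) = i (X w) /\ B (X w) + - Y w = N (- (w.1 + l *: i (X w))).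
  split=> //.
  have -> : N (- (w.1 + l *: i (X w))) = - (N w.1 + l *: N (i (X w))).
    by rewrite linearN linearD linearZ_LR.
  by rewrite /Y opprD addrCA subrr addr0.
exists g; split.
- apply/linear_continuousP.
  have Xb w : rnorm (X w) <= CG * (1 + modc l * kap) * rnorm w.
    rewrite -mulrA; apply: le_trans (hG _) _; rewrite ler_pM2l //.
    apply: le_trans (rnormD _ _) _; rewrite rnormN rnormZ mulrDl mul1r.
    apply: lerD; first exact: rnorm_prod2.
    rewrite -mulrA ler_wpM2l ?modc_ge0 //; apply: le_trans (N_bound _) _.
    by rewrite ler_pM2l // rnorm_prod1.
  set cX := CG * _ in Xb.
  have l0 := modc_ge0 l.
  have cX0 : 0 < cX by rewrite mulr_gt0 // ltr_wpDr // mulr_ge0 // ltW.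
  exists (kap * cX + (kap + modc l * (kap * (kap * cX)) + nD * cX)) => [|w].
    have p1 : 0 < kap * cX by exact: mulr_gt0.
    have p2 : 0 < nD * cX by exact: mulr_gt0.
    have p3 := mulr_ge0 l0 (ltW (mulr_gt0 kap_gt0 p1)).
    by rewrite addr_gt0 // addr_gt0 // ltr_wpDr.
  rewrite gE; apply: le_trans (prod_rnorm_le _) _; rewrite /= rnormN mulrDl.
  have h1 : rnorm (i (X w)) <= kap * cX * rnorm w.
    by apply: le_trans (i_bound _) _; rewrite -mulrA ler_pM2l.
  apply: lerD => //; apply: le_trans (rnormD _ _) _; rewrite mulrDl; apply: lerD.
    apply: le_trans (rnormD _ _) _; rewrite mulrDl; apply: lerD.
      by apply: le_trans (N_bound _) _; rewrite ler_pM2l // rnorm_prod1.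
    rewrite rnormZ; apply: le_trans (ler_wpM2l l0 (N_bound _)) _.
    apply: le_trans (ler_wpM2l l0 (ler_wpM2l (ltW kap_gt0) h1)) _.
    by rewrite !mulrA.
  by apply: le_trans (B_bound _) _; rewrite -mulrA ler_pM2l.
- move=> w; have [h1 h2] := gdom w; rewrite gE; split.
    by apply/T_dom; exists (X w), (- (w.1 + l *: i (X w))).
  rewrite (T_val (w := (i (X w), - Y w)) h1 h2) opprK.
  apply: injective_projections => /=; first by rewrite addrK.
  have -> : w.2 = pencil1 l (X w) + l *: N w.1 by rewrite PX subrK.
  rewrite /pencil1 /Y scalerN opprK !scalerDr scalerA -expr2.
  by rewrite [RHS]addrC [LHS]addrC -!addrA.
- move=> w /T_dom[x [z [wx wz]]]; rewrite (T_val wx wz) gE.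
  set v := _ - l *: w.
  have vX : X v = x.
    rewrite /X /v /= -[RHS]KG; congr (G _); rewrite /pencil1.
    have -> : N (- z - l *: w.1) = - N z - l *: N w.1.
      by rewrite linearB linearN linearZ_LR.
    have -> : l *: (- N z - l *: N w.1) =
        - (l *: w.2 + (l ^+ 2 *: N (i x) + l *: B x)).
      rewrite -wz wx -opprD scalerN !scalerDr scalerA -expr2; congr (- _).
      by rewrite [l *: B x + l *: w.2]addrC -addrA [l *: B x + _]addrC.
    by rewrite opprK addrA subrK addrC.
  apply: injective_projections => /=; first by rewrite vX.
  have Nv : N v.1 = - N z - l *: N (i x) by rewrite /v /= linearB linearN linearZ_LR wx.
  by rewrite /Y vX Nv subrK -wz opprD opprK addrAC subrr add0r.
Qed.

(** The right-hand sides f = (0, h) recover the inverse of the pencil, as the second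
    component of T w. *)
Lemma resolvent_regular l : resolvent_set T l -> pencil1_regular l.
Proof.
move=> [G [Gc TG GT]].
have [CG CG0 hG] := (linear_continuousP _).1 Gc.
pose e (h : H1) : (H * H1)%type := (0, h).
have eL a u v : e (a *: u + v) = a *: e u + e v.
  by apply: injective_projections; rewrite /= ?scaler0 ?addr0.
have T2 h : (T (G (e h))).2 = h + l *: (G (e h)).2.
  by have [_ /(congr1 snd)/= E] := TG (e h); rewrite -[X in _ = X + _]E subrK.
have [|g gE] := @ex_linear _ _ _ (fun h => h + l *: (G (e h)).2).
  move=> a u v; rewrite eL linearP /=.
  by rewrite !scalerDr [LHS]addrACA !scalerA [l * a]mulrC.
have inj x : g (pencil1 l x) = x.
  pose y := - N (l *: i x) - B x.
  have h1 : B x + y = N (- (l *: i x)) by rewrite /y addrC subrK linearN.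
  have Tw : T (i x, y) = (- - (l *: i x), x) by exact: (T_val (w := (i x, y))).
  have Dw : opdom T (i x, y) by apply/T_dom; exists x, (- (l *: i x)).
  have E : T (i x, y) - l *: (i x, y) = e (pencil1 l x).
    rewrite Tw; apply: injective_projections => /=; first by rewrite opprK subrr.
    have -> : y = - (l *: N (i x) + B x) by rewrite /y linearZ_LR opprD.
    by rewrite /pencil1 scalerN opprK scalerDr scalerA -expr2 addrC.
  have := GT _ Dw; rewrite E => GE.
  by rewrite gE -T2 GE Tw.
exists g; split.
- apply/linear_continuousP; exists (1 + modc l * CG) => [|h].
    by rewrite ltr_wpDr // mulr_ge0 ?modc_ge0 // ltW.
  rewrite gE mulrDl mul1r; apply: le_trans (rnormD _ _) _; rewrite lerD2l rnormZ.
  rewrite -mulrA ler_wpM2l ?modc_ge0 //; apply: le_trans (rnorm_prod2 _) _.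
  apply: le_trans (hG _) _; rewrite ler_pM2l //.
  by apply: le_trans (prod_rnorm_le _) _; rewrite /= rnorm0 add0r.
- move=> h; have [Dw TE] := TG (e h); move/T_dom: (Dw) => [x [z [wx wz]]].
  have gx : g h = x by rewrite gE -T2 (T_val wx wz).
  rewrite gx; move: TE; rewrite (T_val wx wz).
  set w := G (e h) in wx wz *.
  move=> TE; have := congr1 fst TE; have := congr1 snd TE => /= E2 E1.
  have zE : z = - (l *: i x).
    by move/eqP: E1; rewrite subr_eq0 => /eqP h0; rewrite -wx -h0 opprK.
  have w2 : w.2 = - (l *: N (i x) + B x).
    by rewrite opprD -linearZ_LR -linearN -zE -wz addrC addKr.
  by rewrite -E2 w2 scalerN opprK /pencil1 scalerDr scalerA -expr2 addrC.
- exact: inj.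
Qed.

(** * The Lyapunov product and the decay rate *)

Variables al be de nu : R.
Local Notation r x := (Rea (ip1 (B x) x)).
Hypotheses (al_gt0 : 0 < al) (be_gt0 : 0 < be) (de_gt0 : 0 < de) (nu_ge0 : 0 <= nu)
  (r_al : forall x, al * rnorm (N (i x)) ^+ 2 <= r x)
  (r_be : forall x, be * rnorm (i x) ^+ 2 <= r x)
  (r_de : forall x, de * rnorm x ^+ 2 <= r x)
  (r_nu : forall x, `|Ima (ip1 (B x) x)| <= nu * r x)
  (be_ge : Num.sqrt (al * de) <= be) (de_le : de <= nD).
Let om : R := (be^-1 + 2 / Num.sqrt (al * de) + nD ^+ 2 / (2 * de)
   + Num.sqrt (4 * nD ^+ 2 / (de * Num.sqrt (al * de)) + nD ^+ 4 / de ^+ 2))^-1.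

(** The notation of [rate_discr], in which the definition of om becomes [om_inv]. *)
Let sa := Num.sqrt al.
Let sd := Num.sqrt de.
Let d := nD / sd.
Let p := (sa * sd)^-1.
Let e := Num.sqrt (d ^+ 2 + 4 * p).
Let b := be^-1.
Let a := sa^-1.

Lemma sa_gt0 : 0 < sa. Proof. by rewrite sqrtr_gt0. Qed.
Lemma sd_gt0 : 0 < sd. Proof. by rewrite sqrtr_gt0. Qed.
Lemma sd_sqr : sd ^+ 2 = de. Proof. by rewrite sqr_sqrtr ?ltW. Qed.
Lemma sa_sqr : sa ^+ 2 = al. Proof. by rewrite sqr_sqrtr ?ltW. Qed.
Lemma p_gt0 : 0 < p. Proof. by rewrite invr_gt0 mulr_gt0 ?sa_gt0 ?sd_gt0. Qed.
Lemma d_gt0 : 0 < d. Proof. by rewrite divr_gt0 ?sd_gt0. Qed.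
Lemma b_gt0 : 0 < b. Proof. by rewrite invr_gt0. Qed.
Lemma a_ge0 : 0 <= a. Proof. by rewrite invr_ge0 ltW ?sa_gt0. Qed.
Lemma e_sqr : e ^+ 2 = d ^+ 2 + 4 * p.
Proof.
rewrite sqr_sqrtr //; have := sqr_ge0 d; have := p_gt0; lra.
Qed.
Lemma d_le_e : d <= e.
Proof.
rewrite -[d]gtr0_norm ?d_gt0 // -sqrtr_sqr ler_wsqrtr //.
by rewrite lerDl mulr_ge0 // ltW ?p_gt0.
Qed.
Lemma b_le_p : b <= p.
Proof.
rewrite lef_pV2 ?posrE ?mulr_gt0 ?sa_gt0 ?sd_gt0 //.
by rewrite -sqrtrM // ltW.
Qed.
Lemma a_le_pd : a <= p * d.
Proof.
have s1 := sa_gt0; have s2 := sd_gt0.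
have -> : p * d = a * (nD / de).
  by rewrite /p /d /a -sd_sqr; field; rewrite !gt_eqF.
by rewrite ler_peMr ?a_ge0 // ler_pdivlMr ?mul1r.
Qed.
Lemma nD_le_d2 : nD <= d ^+ 2.
Proof. by rewrite expr_div_n sd_sqr ler_pdivlMr // expr2 ler_pM2l. Qed.

Lemma om_inv : om^-1 = b + e ^+ 2 / 2 + d * e.
Proof.
have s1 := sa_gt0; have s2 := sd_gt0.
rewrite /om invrK sqrtrM ?(ltW al_gt0) // -/sa -/sd.
have -> : 4 * nD ^+ 2 / (de * (sa * sd)) + nD ^+ 4 / de ^+ 2 = (d * e) ^+ 2.
  by rewrite exprMn e_sqr /p /d -sd_sqr; field; rewrite !gt_eqF.
rewrite sqrtr_sqr ger0_norm; last by rewrite mulr_ge0 ?sqrtr_ge0 ?ltW ?d_gt0.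
by congr (_ + _); rewrite e_sqr /p /d -sd_sqr /b; field; rewrite !gt_eqF.
Qed.

Lemma om_gt0 : 0 < om.
Proof.
rewrite -invr_gt0 om_inv; have := b_gt0; have := d_gt0; have := d_le_e.
move=> h1 h2 h3; have e0 : 0 < e by apply: lt_le_trans h1.
have := mulr_gt0 h2 e0; have := exprn_gt0 2 e0; lra.
Qed.

Lemma om_eq : om * (b + e ^+ 2 / 2 + d * e) = 1.
Proof. by rewrite -om_inv divff // gt_eqF // om_gt0. Qed.

Let P := 1 - 3 * om * b.

Lemma P_gt0 : 0 < P.
Proof.
have := rate_discr d_gt0 d_le_e e_sqr b_gt0 b_le_p a_ge0 a_le_pd om_gt0 om_eq.
rewrite -/P => h.
have : 0 < om * (d + 2 * om * a) ^+ 2.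
  rewrite mulr_gt0 ?om_gt0 // exprn_gt0 // ltr_wpDr ?d_gt0 //.
  by rewrite !mulr_ge0 ?a_ge0 // ltW ?om_gt0.
lra.
Qed.

Let c0 := Num.min (P * de / 10) (om / 10).

Lemma c0_gt0 : 0 < c0.
Proof. by rewrite lt_min !divr_gt0 ?mulr_gt0 ?P_gt0 ?om_gt0. Qed.

(** The right-hand side is - Re <Tw,w> - omega <w,w> for the Lyapunov product and
    w = (i x, y). With rho^2 = r x, each term is bounded by its worst value: the
    constants alpha, beta, delta and |D| control |N i x|, |i x|, |x| and |B x| by
    rho, and a quadratic form in rho and |y| remains. *)
Lemma lyapunov_form x y : c0 * (rnorm x ^+ 2 + rnorm y ^+ 2) <=
  r x - 3 * om * rnorm (i x) ^+ 2 + om * rnorm y ^+ 2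
    + 2 * om * Rea (ip1 (B x) y) - 4 * om ^+ 2 * Rea (ip (i x) (i y)).
Proof.
have s1 := sa_gt0; have s2 := sd_gt0; have o0 := om_gt0.
have r0 : 0 <= r x by apply: le_trans (r_de x); rewrite mulr_ge0 ?sqr_ge0 // ltW.
pose rho := Num.sqrt (r x); have rho2 : rho ^+ 2 = r x by rewrite sqr_sqrtr.
have v0 := rnorm_ge0 y; set v := rnorm y in v0 *.
have x1 : rnorm x <= rho / sd.
  rewrite ler_pdivlMr // -ler_sqr ?nnegrE ?mulr_ge0 ?rnorm_ge0 ?sqrtr_ge0 ?(ltW s2) //.
  by rewrite exprMn sd_sqr rho2 mulrC.
have x2 : rnorm (N (i x)) <= rho / sa.
  rewrite ler_pdivlMr // -ler_sqr ?nnegrE ?mulr_ge0 ?rnorm_ge0 ?sqrtr_ge0 ?(ltW s1) //.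
  by rewrite exprMn sa_sqr rho2 mulrC.
have h1 : - (d * (rho * v)) <= Rea (ip1 (B x) y).
  have h2 : `|Rea (ip1 (B x) y)| <= d * (rho * v).
    apply: le_trans (Re_le_modc _) _; apply: le_trans (H1_CS _ _) _.
    rewrite -/v mulrA ler_wpM2r //; apply: le_trans (B_bound _) _.
    by rewrite /d mulrAC -mulrA ler_pM2l.
  by move: h2; rewrite ler_norml => /andP[].
have h2 : Rea (ip (i x) (i y)) <= a * (rho * v).
  rewrite -N_adj; apply: le_trans (ler_norm _) _.
  apply: le_trans (Re_le_modc _) _; apply: le_trans (H1_CS _ _) _.
  by rewrite -/v mulrA ler_wpM2r // mulrC.
have h3 : rnorm (i x) ^+ 2 <= b * rho ^+ 2 by rewrite ler_pdivlMl // rho2.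
have := rate_form rho v d_gt0 d_le_e e_sqr b_gt0 b_le_p a_ge0 a_le_pd om_gt0 om_eq.
rewrite -/P -{1}rho2 => h4.
have h5 : c0 * rnorm x ^+ 2 <= 1 / 10 * (P * rho ^+ 2).
  apply: le_trans (_ : P * de / 10 * rnorm x ^+ 2 <= _).
    by rewrite ler_wpM2r ?sqr_ge0 // ge_min lexx.
  by have := ler_wpM2l (ltW P_gt0) (r_de x); rewrite -rho2; lra.
have h6 : c0 * v ^+ 2 <= 1 / 10 * (om * v ^+ 2).
  apply: le_trans (_ : om / 10 * v ^+ 2 <= _); last by lra.
  by rewrite ler_wpM2r ?sqr_ge0 // ge_min lexx orbT.
have h7 := ler_wpM2l (ltW o0) h1; have h8 := ler_wpM2l (ltW o0) h3.
have h9 := ler_wpM2l (sqr_ge0 om) h2.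
rewrite /P in h4 h5; rewrite mulrDr; lra.
Qed.

(** The cross term of the Lyapunov product is a fraction of the diagonal ones, since
    |i y|^2 <= (|D|/beta) |y|^2 and omega^2 |D|/beta <= 1/6. *)
Lemma lyapunov_cross w1 y :
  4 * om * `|Rea (ip w1 (i y))| <= 9 / 10 * (rnorm w1 ^+ 2 + rnorm y ^+ 2).
Proof.
have o0 := om_gt0.
have h1 : rnorm (i y) ^+ 2 <= nD * b * rnorm y ^+ 2.
  rewrite mulrAC /b ler_pdivlMr // mulrC.
  apply: le_trans (r_be y) _; apply: le_trans (ler_norm _) _.
  apply: le_trans (Re_le_modc _) _; apply: le_trans (H1_CS _ _) _.
  by rewrite expr2 mulrA ler_wpM2r ?rnorm_ge0.
have h2 := rate_positive d_gt0 d_le_e b_gt0 (ltW nD_gt0) nD_le_d2 om_gt0 om_eq.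
have h3 : `|Rea (ip w1 (i y))| <= rnorm w1 * rnorm (i y).
  exact: le_trans (Re_le_modc _) (H_CS _ _).
have h4 : 2 * (2 * om * (rnorm w1 * rnorm (i y))) <=
   9 / 10 * rnorm w1 ^+ 2 + 9 / 10 * rnorm y ^+ 2.
  apply: amgm; [by rewrite mulr_ge0 ?sqr_ge0|by rewrite mulr_ge0 ?sqr_ge0|].
  have -> : (2 * om * (rnorm w1 * rnorm (i y))) ^+ 2 =
    rnorm w1 ^+ 2 * (4 * om ^+ 2 * rnorm (i y) ^+ 2) by ring.
  have -> : 9 / 10 * rnorm w1 ^+ 2 * (9 / 10 * rnorm y ^+ 2) =
    rnorm w1 ^+ 2 * (81 / 100 * rnorm y ^+ 2) by field.
  apply: ler_wpM2l; first exact: sqr_ge0.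
  have h5 := ler_wpM2l (sqr_ge0 om) h1.
  have h6 := ler_wpM2r (sqr_ge0 (rnorm y)) h2.
  have := sqr_ge0 (rnorm y); lra.
by have := ler_wpM2l (ltW o0) h3; lra.
Qed.

(** The energy product of H x H_1 corrected by k (w_1, w_2) with k = 2 omega: the
    energy itself is not dissipated by the component w_2, and the correction
    contributes the term - k |w_2|^2 to the dissipation. *)
Definition lyap (w w' : (H * H1)%type) : R[i] :=
  ip w.1 w'.1 + ip1 w.2 w'.2
  + (2 * om)%:C * (ip w.1 (i w'.2) + ip (i w.2) w'.1).

Lemma lyap_self w : Rea (lyap w w) =
  rnorm w.1 ^+ 2 + rnorm w.2 ^+ 2 + 4 * om * Rea (ip w.1 (i w.2)).
Proof.
rewrite /lyap !ReD ip_selfE ip1_selfE ReM /= mul0r subr0 ReD (innerC ipP w.1 (i w.2)) ReJ.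
ring.
Qed.

Lemma lyap_ge w : (rnorm w.1 ^+ 2 + rnorm w.2 ^+ 2) / 10 <= Rea (lyap w w).
Proof.
rewrite lyap_self; have := lyapunov_cross w.1 w.2.
have := ler_norm (- Rea (ip w.1 (i w.2))); rewrite normrN => h.
by have := ler_wpM2l (ltW om_gt0) h; lra.
Qed.

Lemma lyap_le w : Rea (lyap w w) <= 2 * (rnorm w.1 ^+ 2 + rnorm w.2 ^+ 2).
Proof.
rewrite lyap_self; have := lyapunov_cross w.1 w.2.
have := ler_wpM2l (ltW om_gt0) (ler_norm (Rea (ip w.1 (i w.2)))).
have := sqr_ge0 (rnorm w.1); have := sqr_ge0 (rnorm w.2); lra.
Qed.

Lemma lyap_inner : inner lyap.
Proof.
split=> [c u v w|u v|u].
- rewrite /lyap /= !linearP /= !(innerDl ipP) !(innerZl ipP) !(innerDl ip1P) !(innerZl ip1P).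
  ring.
- rewrite /lyap; set k := (2 * om)%:C.
  have kc : Num.conj k = k by exact: conjc_real.
  rewrite (innerC ipP u.1 v.1) (innerC ip1P u.2 v.2) (innerC ipP (i u.2) v.1).
  rewrite (innerC ipP u.1 (i v.2)) -{1}kc -!rmorphD -rmorphM -!rmorphD.
  by rewrite [ip (i u.2) v.1 + _]addrC.
- apply: le_trans (lyap_ge u); rewrite divr_ge0 // addr_ge0 ?sqr_ge0 //.
Qed.

(** A w_2 enters only through N z = B x + w_2, so the form is bounded on H_1 x H_1. *)
Lemma lyap_form w w' x z x' z' : w.1 = i x -> B x + w.2 = N z ->
  w'.1 = i x' -> B x' + w'.2 = N z' ->
  lyap (T w) w' = - ip1 (B x + w.2) x' + ip1 x w'.2
    + (2 * om)%:C * (- ip1 (B x + w.2) w'.2 + ip (i x) (i x')).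
Proof.
move=> wx wz wx' wz'; rewrite (T_val wx wz) /lyap /= wx' wz.
by rewrite !(innerNl ipP) !N_adj.
Qed.

Lemma lyap_coercive w x z : w.1 = i x -> B x + w.2 = N z ->
  om * Rea (lyap w w) + c0 * (rnorm x ^+ 2 + rnorm w.2 ^+ 2) <=
  - Rea (lyap (T w) w).
Proof.
move=> wx wz; have := lyapunov_form x w.2; rewrite (lyap_form wx wz wx wz) lyap_self wx.
rewrite !(innerDl ip1P) ip1_selfE ip_selfE (innerC ip1P x w.2) !ReImE /=.
lra.
Qed.

Let K1 := nD + 2 + 2 * om * (nD + 1 + kap ^+ 2).

Lemma lyap_bounded w w' x z x' z' : w.1 = i x -> B x + w.2 = N z ->
  w'.1 = i x' -> B x' + w'.2 = N z' ->
  modc (lyap (T w) w') <=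
    K1 * ((rnorm x + rnorm w.2) * (rnorm x' + rnorm w'.2)).
Proof.
move=> wx wz wx' wz'; rewrite (lyap_form wx wz wx' wz').
set y := w.2; set y' := w'.2.
have x0 := rnorm_ge0 x; have y0 := rnorm_ge0 y.
have x'0 := rnorm_ge0 x'; have y'0 := rnorm_ge0 y'.
have hB u : modc (ip1 (B x + y) u) <= (nD * rnorm x + rnorm y) * rnorm u.
  apply: le_trans (H1_CS _ _) _; rewrite ler_wpM2r ?rnorm_ge0 //.
  by apply: le_trans (rnormD _ _) _; rewrite lerD2r.
have hi : modc (ip (i x) (i x')) <= kap ^+ 2 * (rnorm x * rnorm x').
  apply: le_trans (H_CS _ _) _.
  have -> : kap ^+ 2 * (rnorm x * rnorm x') = kap * rnorm x * (kap * rnorm x') by ring.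
  by apply: ler_pM; rewrite ?rnorm_ge0.
apply: le_trans (modcD _ _) _; rewrite modcM modcR gtr0_norm ?mulr_gt0 ?om_gt0 //.
have h1 := modcD (- ip1 (B x + y) x') (ip1 x y').
have h2 := modcD (- ip1 (B x + y) y') (ip (i x) (i x')).
rewrite !modcN in h1 h2.
have h3 := hB x'; have h4 := hB y'; have h5 := H1_CS x y'.
have o2 : 0 < 2 * om by rewrite mulr_gt0 ?om_gt0.
have h6 : modc (- ip1 (B x + y) y' + ip (i x) (i x')) <=
   (nD + 1 + kap ^+ 2) * ((rnorm x + rnorm y) * (rnorm x' + rnorm y')).
  apply: le_trans h2 _; apply: le_trans (lerD h4 hi) _.
  have k2 := sqr_ge0 kap; have n0 := ltW nD_gt0.
  have p1 := mulr_ge0 x0 x'0; have p2 := mulr_ge0 x0 y'0.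
  have p3 := mulr_ge0 y0 x'0; have p4 := mulr_ge0 y0 y'0.
  have := mulr_ge0 n0 p1; have := mulr_ge0 n0 p3; have := mulr_ge0 n0 p4.
  have := mulr_ge0 k2 p2; have := mulr_ge0 k2 p3; have := mulr_ge0 k2 p4.
  by lra.
have h7 := ler_wpM2l (ltW o2) h6.
have h8 : modc (- ip1 (B x + y) x' + ip1 x y') <=
   (nD + 2) * ((rnorm x + rnorm y) * (rnorm x' + rnorm y')).
  apply: le_trans h1 _; apply: le_trans (lerD h3 h5) _.
  have n0 := ltW nD_gt0.
  have p1 := mulr_ge0 x0 x'0; have p2 := mulr_ge0 x0 y'0.
  have p3 := mulr_ge0 y0 x'0; have p4 := mulr_ge0 y0 y'0.
  have := mulr_ge0 n0 p2; have := mulr_ge0 n0 p3; have := mulr_ge0 n0 p4.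
  by lra.
have -> : K1 * ((rnorm x + rnorm y) * (rnorm x' + rnorm y')) =
  (nD + 2) * ((rnorm x + rnorm y) * (rnorm x' + rnorm y')) +
  2 * om * ((nD + 1 + kap ^+ 2) * ((rnorm x + rnorm y) * (rnorm x' + rnorm y'))).
  by rewrite /K1; ring.
exact: lerD h8 h7.
Qed.

(** * Localization of the spectrum *)

Lemma form_parts l y : let dy := ip1 (B y) y in
  Rea (ip1 (pencil1 l y) y) = (Rea l ^+ 2 - Ima l ^+ 2) * rnorm (i y) ^+ 2
     + (Rea l * Rea dy - Ima l * Ima dy) + rnorm y ^+ 2 /\
  Ima (ip1 (pencil1 l y) y) = 2 * Rea l * Ima l * rnorm (i y) ^+ 2
     + (Rea l * Ima dy + Ima l * Rea dy).
Proof.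
by rewrite pencil1_ip expr2 !ReImE /=; split; ring.
Qed.

(** Applied to the pair (l y, y), the Lyapunov inequality bounds the numerical range of
    the pencil: if E = (L(l)y, y) then Re ((conj l + 2 om) E) is the sum of
    (Re l + om) <w,w> and of the form of lyapunov_form, with w = (l i y, y). *)
Lemma halfplane_regular l : - om <= Rea l -> pencil1_regular l.
Proof.
move=> hl.
pose M := modc (Num.conj l + (2 * om)%:C) + 1.
have M0 : 0 < M by rewrite ltr_wpDl // modc_ge0.
apply: (@coercive_regular l (c0 / M)); first by rewrite divr_gt0 ?c0_gt0.
move=> y; set E := ip1 (pencil1 l y) y.
have [reE imE] := form_parts l y; rewrite -/E in reE imE.
have V0 : 0 <= Rea (lyap (l *: i y, y) (l *: i y, y)).
  by case: lyap_inner => _ _; apply.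
rewrite lyap_self /= rnormZ exprMn modc_sqr (innerZl ipP) ip_selfE ReM /= mulr0 subr0 in V0.
have := lyapunov_form (l *: y) y.
have Bl : B (l *: y) = l *: B y by exact: linearZ_LR.
have il : i (l *: y) = l *: i y by exact: linearZ_LR.
have E1 : Rea (ip1 (B (l *: y)) (l *: y)) =
    (Rea l ^+ 2 + Ima l ^+ 2) * Rea (ip1 (B y) y).
  by rewrite Bl (innerZl ip1P) (innerZr ip1P) !ReImE; ring.
have E2 : rnorm (i (l *: y)) ^+ 2 = (Rea l ^+ 2 + Ima l ^+ 2) * rnorm (i y) ^+ 2.
  by rewrite il rnormZ exprMn modc_sqr.
have E3 : rnorm (l *: y) ^+ 2 = (Rea l ^+ 2 + Ima l ^+ 2) * rnorm y ^+ 2.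
  by rewrite rnormZ exprMn modc_sqr.
have E4 : Rea (ip1 (B (l *: y)) y) =
    Rea l * Rea (ip1 (B y) y) - Ima l * Ima (ip1 (B y) y).
  by rewrite Bl (innerZl ip1P) ReM.
have E5 : Rea (ip (i (l *: y)) (i y)) = Rea l * rnorm (i y) ^+ 2.
  by rewrite il (innerZl ipP) ip_selfE ReM /= mulr0 subr0.
rewrite E1 E2 E3 E4 E5 => QF.
have c1 : c0 * rnorm y ^+ 2 <= Rea ((Num.conj l + (2 * om)%:C) * E).
  rewrite !ReImE /= reE imE.
  have := mulr_ge0 (_ : 0 <= Rea l + om) V0 => /(_ _); rewrite -lerBlDr sub0r => /(_ hl).
  have : 0 <= c0 * ((Rea l ^+ 2 + Ima l ^+ 2) * rnorm y ^+ 2).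
    apply: mulr_ge0 (ltW c0_gt0) _; apply: mulr_ge0 (sqr_ge0 _).
    by rewrite addr_ge0 ?sqr_ge0.
  move: QF; move: (ip1 (B y) y) => dy; move: (rnorm (i y) ^+ 2) (rnorm y ^+ 2) => h n.
  by move: (Rea dy) (Ima dy) (Rea l) (Ima l) => r s u v; lra.
have c2 : c0 * rnorm y ^+ 2 <= M * modc E.
  apply: le_trans c1 _; apply: le_trans (ler_norm _) _.
  apply: le_trans (Re_le_modc _) _; rewrite modcM ler_wpM2r ?modc_ge0 //.
  by rewrite lerDl.
by rewrite mulrAC ler_pdivrMr // [leRHS]mulrC.
Qed.

(** Write rho = |l|, h = |iy|^2, n = |y|^2, and multiply E = l^2 h + l d + n by the
    conjugate of l. If E = 0, the real part gives rho^2 Re d = xi Q with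
    Q = rho^2 h + n, and the imaginary part bounds eta |rho^2 h - n| by
    nu xi Q. As Q = |rho^2 h - n| + 2 Nm with Nm the minimum of rho^2 h and n,
    it remains to bound 2 eta Nm <= Nm rho^2/X + Nm X for the positive root X
    of X^2 = tX + th, through Nm rho^2 <= xi Q/de, Nm <= xi Q/be, Nm <= Q/2 and
    X <= sqrt th + t. Keeping the error terms e1 and e2 of a nonzero E turns
    this computation into a lower bound for |E|. *)
Lemma sector_regular l (t th : R) : Rea l <= 0 -> 0 <= t -> t ^+ 2 <= th -> 0 < th ->
  (nu + 2 / (de * (t + Num.sqrt (t ^+ 2 + 4 * th))) + (Num.sqrt th - t) / be)
    * `|Rea l| + t < `|Ima l| -> pencil1_regular l.
Proof.
move=> l0 t0 tth th0.
pose X := (t + Num.sqrt (t ^+ 2 + 4 * th)) / 2.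
have s0 : 0 < Num.sqrt (t ^+ 2 + 4 * th).
  by rewrite sqrtr_gt0 ltr_wpDl ?sqr_ge0 // mulr_gt0.
have X0 : 0 < X by rewrite divr_gt0 // ltr_wpDl.
have XE : 2 / (de * (t + Num.sqrt (t ^+ 2 + 4 * th))) = (de * X)^-1.
  by rewrite /X; field; rewrite !gt_eqF // ltr_wpDl.
have Xle : X <= Num.sqrt th + t.
  have st : 0 <= Num.sqrt th by exact: sqrtr_ge0.
  have st2 : Num.sqrt th ^+ 2 = th by rewrite sqr_sqrtr // ltW.
  rewrite /X ler_pdivrMr //.
  suff : Num.sqrt (t ^+ 2 + 4 * th) <= t + 2 * Num.sqrt th by lra.
  rewrite -ler_sqr ?nnegrE ?sqrtr_ge0 ?addr_ge0 ?mulr_ge0 //.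
  rewrite sqr_sqrtr; last by rewrite addr_ge0 ?sqr_ge0 ?mulr_ge0 // ltW.
  by rewrite -{1}st2; have := mulr_ge0 t0 st; lra.
have tst : t <= Num.sqrt th.
  by rewrite -[t]ger0_norm // -sqrtr_sqr ler_wsqrtr.
rewrite XE; set M := nu + _ + _; set xi := `|Rea l|; set eta := `|Ima l| => hl.
have M0 : 0 <= M.
  have a1 : 0 <= (de * X)^-1 by rewrite invr_ge0 mulr_ge0 // ltW.
  have a2 : 0 <= (Num.sqrt th - t) / be by rewrite divr_ge0 ?subr_ge0 // ltW.
  by rewrite addr_ge0 // addr_ge0.
have xiE : xi = - Rea l by rewrite /xi ler0_norm.
have xi0 : 0 <= xi by exact: normr_ge0.
have eta0 : 0 < eta.
  by apply: le_lt_trans hl; rewrite addr_ge0 ?mulr_ge0.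
pose rho := modc l.
have rho0 : 0 < rho by apply: lt_le_trans eta0 (Im_le_modc l).
have rho2 : rho ^+ 2 = Rea l ^+ 2 + Ima l ^+ 2 by exact: modc_sqr.
have M1 : 0 < (M + 1) * rho by rewrite mulr_gt0 // ltr_wpDl.
have gap : 0 < eta - M * xi - t by lra.
apply: (@coercive_regular l ((eta - M * xi - t) / ((M + 1) * rho))).
  by rewrite divr_gt0.
move=> y; set E := ip1 (pencil1 l y) y.
have [reE imE] := form_parts l y; rewrite -/E in reE imE.
rewrite mulrAC ler_pdivrMr //.
pose e1 := Rea (Num.conj l * E); pose e2 := Ima (Num.conj l * E).
have me1 : `|e1| <= rho * modc E.
  by apply: le_trans (Re_le_modc _) _; rewrite modcM modcJ.
have me2 : `|e2| <= rho * modc E.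
  by apply: le_trans (Im_le_modc _) _; rewrite modcM modcJ.
have ry := r_be y; have rd := r_de y; have rs := r_nu y.
set h := rnorm (i y) ^+ 2 in reE imE ry; set n := rnorm y ^+ 2 in reE imE rd *.
have h0 : 0 <= h by exact: sqr_ge0.
have n0 : 0 <= n by exact: sqr_ge0.
set rr := Rea (ip1 (B y) y) in reE imE ry rd rs.
set ss := Ima (ip1 (B y) y) in reE imE rs.
pose Q := rho ^+ 2 * h + n.
have r2 : 0 < rho ^+ 2 by rewrite exprn_gt0.
have e1E : rho ^+ 2 * rr = xi * Q + e1.
  by rewrite /e1 /Q ReM ReJ ImJ reE imE rho2 xiE; ring.
have e2E : Ima l * (rho ^+ 2 * h - n) = e2 - rho ^+ 2 * ss.
  by rewrite /e2 ImM ReJ ImJ reE imE rho2; ring.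
pose W := xi * Q + `|e1|.
have rW : rho ^+ 2 * rr <= W by rewrite e1E lerD2l ler_norm.
have k1 : eta * `|rho ^+ 2 * h - n| <= `|e2| + nu * W.
  rewrite /eta -normrM e2E; apply: le_trans (ler_normB _ _) _; rewrite lerD2l.
  rewrite normrM (gtr0_norm r2).
  apply: le_trans (ler_wpM2l (ltW r2) rs) _.
  by rewrite mulrCA ler_wpM2l.
pose Nm := Num.min (rho ^+ 2 * h) n.
have N1 : Nm <= rho ^+ 2 * h by rewrite ge_min lexx.
have N2 : Nm <= n by rewrite ge_min lexx orbT.
have N0 : 0 <= Nm by rewrite le_min n0 mulr_ge0 // ltW.
have k2 : Q = `|rho ^+ 2 * h - n| + 2 * Nm.
  rewrite /Q /Nm minEle; case: ifPn => [le1|]; last rewrite -ltNge => lt1.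
    by rewrite ler0_norm ?subr_le0 //; ring.
  by rewrite ger0_norm ?subr_ge0 ?(ltW lt1) //; ring.
have k3 : Nm * rho ^+ 2 <= W / de.
  rewrite ler_pdivlMr //; apply: le_trans rW.
  have := ler_wpM2l (ltW r2) rd; have := ler_wpM2r (ltW (mulr_gt0 r2 de_gt0)) N2; lra.
have k4 : Nm <= W / be.
  rewrite ler_pdivlMr //; apply: le_trans rW.
  have := ler_wpM2l (ltW r2) ry; have := ler_wpM2r (ltW be_gt0) N1; lra.
have etarho : eta <= rho by exact: Im_le_modc.
have k5 : 2 * eta * Nm <= Nm * rho ^+ 2 / X + Nm * X.
  have : 2 * (eta * Nm) <= Nm * rho ^+ 2 / X + Nm * X.
    have rN := mulr_ge0 N0 (ltW r2).
    apply: amgm; [by rewrite divr_ge0 // ltW|by rewrite mulr_ge0 // ltW|].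
    have -> : Nm * rho ^+ 2 / X * (Nm * X) = (rho * Nm) ^+ 2.
      by field; rewrite gt_eqF.
    rewrite ler_sqr ?nnegrE ?(mulr_ge0 (ltW rho0)) ?(mulr_ge0 (ltW eta0)) //.
    by rewrite ler_wpM2r.
  by rewrite mulrA.
have k6 : Nm * rho ^+ 2 / X <= (de * X)^-1 * W.
  rewrite ler_pdivrMr //; apply: le_trans k3 _.
  by rewrite le_eqVlt; apply/orP; left; apply/eqP; field; rewrite !gt_eqF.
have k7 : Nm * X <= (Num.sqrt th - t) / be * W + t * Q.
  apply: le_trans (ler_wpM2l N0 Xle) _.
  have a1 : Nm * (Num.sqrt th - t) <= (Num.sqrt th - t) / be * W.
    rewrite mulrC -mulrA ler_wpM2l ?subr_ge0 //.
    by rewrite mulrC.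
  have a2 : Nm * (2 * t) <= t * Q.
    have := normr_ge0 (rho ^+ 2 * h - n) => a3.
    have : 2 * Nm <= Q by lra.
    by move/(ler_wpM2l t0); lra.
  lra.
have k8 : eta * Q <= `|e2| + M * W + t * Q.
  rewrite {1}k2 /M; lra.
have k9 : (eta - M * xi - t) * Q <= `|e2| + M * `|e1|.
  by move: k8; rewrite /W; lra.
have nQ : n <= Q by rewrite lerDr mulr_ge0 // ltW.
apply: le_trans (ler_wpM2l (ltW gap) nQ) _.
apply: le_trans k9 _; have := ler_wpM2l M0 me1; lra.
Qed.

(** * The semigroup and the main theorem *)

Lemma lyapunov_semigroup : exists E : R -> {linear (H * H1)%type -> (H * H1)%type},
  [/\ C0_semigroup E, is_generator T E, analytic_semigroup E &
    forall t w, 0 <= t -> ipnorm lyap (E t w) <= expR (- (om * t)) * ipnorm lyap w].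
Proof.
have c00 := c0_gt0; have o0 := om_gt0.
have K10 : 0 < K1.
  have k2 : 0 <= nD + 1 + kap ^+ 2 by rewrite !addr_ge0 ?sqr_ge0 // ltW.
  have o2 : 0 <= 2 * om by rewrite mulr_ge0 // ltW.
  by rewrite /K1 ltr_wpDr ?(mulr_ge0 o2 k2) // addr_gt0.
pose C := 2 * K1 / c0; have C0 : 0 < C by rewrite !divr_gt0 ?mulr_gt0.
have sq2 (x y : R) : (x + y) ^+ 2 <= 2 * (x ^+ 2 + y ^+ 2).
  by have := sqr_ge0 (x - y); lra.
apply: (@sectorial_semigroup _ _ product_complete lyap 5 2 lyap_inner _ _ _ _ T om C
  T_linear T_densely_defined) => //.
- move=> w; apply: le_trans (prod_rnorm_le _) _.
  rewrite -ler_sqr ?nnegrE ?addr_ge0 ?mulr_ge0 ?rnorm_ge0 ?ipnorm_ge0 //.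
  apply: le_trans (sq2 _ _) _; rewrite exprMn (ipnorm_sqr lyap_inner).
  have := lyap_ge w; have := sqr_ge0 (rnorm w.1); have := sqr_ge0 (rnorm w.2); lra.
- move=> w; rewrite -ler_sqr ?nnegrE ?mulr_ge0 ?rnorm_ge0 ?ipnorm_ge0 //.
  rewrite exprMn (ipnorm_sqr lyap_inner); apply: le_trans (lyap_le w) _.
  have h1 : rnorm w.1 ^+ 2 <= rnorm w ^+ 2.
    by rewrite ler_sqr ?nnegrE ?rnorm_ge0 // rnorm_prod1.
  have h2 : rnorm w.2 ^+ 2 <= rnorm w ^+ 2.
    by rewrite ler_sqr ?nnegrE ?rnorm_ge0 // rnorm_prod2.
  lra.
- move=> l l0; apply: regular_resolvent; apply: halfplane_regular.
  by apply: le_trans (ltW l0); rewrite oppr_le0 ltW.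
- move=> w /T_dom[x [z [wx wz]]]; rewrite (ipnorm_sqr lyap_inner).
  have := lyap_coercive wx wz.
  have : 0 <= c0 * (rnorm x ^+ 2 + rnorm w.2 ^+ 2).
    by rewrite mulr_ge0 ?addr_ge0 ?sqr_ge0 // ltW.
  lra.
- move=> w w' /T_dom[x [z [wx wz]]] /T_dom[x' [z' [wx' wz']]].
  have hb := lyap_bounded wx wz wx' wz'.
  have hV u : 0 <= om * Rea (lyap u u).
    by rewrite mulr_ge0 ?(ltW o0) //; case: lyap_inner => _ _; apply.
  have h1 := lyap_coercive wx wz; have h2 := lyap_coercive wx' wz'.
  have v1 := hV w; have v2 := hV w'.
  set a1 := - Rea _ in h1 *; set a2 := - Rea _ in h2 *.
  set s := rnorm x + rnorm w.2 in hb; set s' := rnorm x' + rnorm w'.2 in hb.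
  have h3 : c0 * s ^+ 2 <= 2 * a1.
    by have := ler_wpM2l (ltW c00) (sq2 (rnorm x) (rnorm w.2)); rewrite -/s; lra.
  have h4 : c0 * s' ^+ 2 <= 2 * a2.
    by have := ler_wpM2l (ltW c00) (sq2 (rnorm x') (rnorm w'.2)); rewrite -/s'; lra.
  have h5 : modc (lyap (T w) w') ^+ 2 <= (K1 * (s * s')) ^+ 2.
    by rewrite ler_sqr ?nnegrE ?modc_ge0 //; apply: le_trans hb; exact: modc_ge0.
  apply: le_trans h5 _.
  have -> : (K1 * (s * s')) ^+ 2 = (K1 / c0) ^+ 2 * ((c0 * s ^+ 2) * (c0 * s' ^+ 2)).
    by field; rewrite gt_eqF.
  have -> : C ^+ 2 * (a1 * a2) = (K1 / c0) ^+ 2 * ((2 * a1) * (2 * a2)).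
    by rewrite /C; field; rewrite gt_eqF.
  apply: ler_wpM2l; first exact: sqr_ge0.
  by apply: ler_pM => //; apply: mulr_ge0 (ltW c00) (sqr_ge0 _).
Qed.

Theorem damped_semigroup : exists E : R -> {linear (H * H1)%type -> (H * H1)%type},
  [/\ C0_semigroup E, is_generator T E, analytic_semigroup E &
    exists C : R, forall (t : R) w, 0 <= t ->
      pnorm (E t w) <= C * expR (- (om * t)) * pnorm w].
Proof.
have [E [E1 E2 E3 E4]] := lyapunov_semigroup.
(* 5 ^ 2 >= 10 * 2, the constants of lyap_ge and lyap_le *)
exists E; split=> //; exists 5 => t w t0; have ep := expR_ge0 (- (om * t)).
have pn0 u : 0 <= pnorm (u : (H * H1)%type) by exact: sqrtr_ge0.
have pnE u : pnorm (u : (H * H1)%type) ^+ 2 = rnorm u.1 ^+ 2 + rnorm u.2 ^+ 2.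
  by rewrite sqr_sqrtr // addr_ge0 ?sqr_ge0.
rewrite -ler_sqr ?nnegrE ?mulr_ge0 ?pn0 // !exprMn !pnE.
have h1 : ipnorm lyap (E t w) ^+ 2 <= (expR (- (om * t)) * ipnorm lyap w) ^+ 2.
  by rewrite ler_sqr ?nnegrE ?mulr_ge0 ?ipnorm_ge0 ?E4.
rewrite exprMn !(ipnorm_sqr lyap_inner) in h1.
have h2 := lyap_ge (E t w).
have h3 := ler_wpM2l (sqr_ge0 (expR (- (om * t)))) (lyap_le w).
have h4 : 0 <= expR (- (om * t)) ^+ 2 * (rnorm w.1 ^+ 2 + rnorm w.2 ^+ 2).
  by apply: mulr_ge0 (sqr_ge0 _) _; rewrite addr_ge0 ?sqr_ge0.
lra.
Qed.

End Damped.

Section Assembly.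
Context {R : realType} {H : completeNormedModType R[i]}.
Variable ip : {dot H for @Num.conj R[i]}.
Hypothesis ip_norm : hilbert_norm ip.
Variables A S : partial_op H H.
Hypotheses (A_sa : selfadjoint ip A) (a0_gt0 : 0 < lower_bound ip A)
  (S_sqrt : op_sqrt ip A S).
Variables (H1 : normedModType R[i]) (i1 : {linear H1 -> H}).
Hypothesis H1P : is_H1 S i1.
Variables (Hm : completeNormedModType R[i]) (j : {linear H -> Hm}).
Hypothesis HmP : is_Hm1 S j.
Variable D : {linear H1 -> Hm}.
Hypothesis D_cont : continuous D.

Local Notation Ae := (A_ext A i1 j).
Local Notation ip1 := (energy_ip ip S i1).
Let Ae_isom := A_ext_isom ip_norm A_sa a0_gt0 S_sqrt H1P HmP.
Let Ae_surj := A_ext_surj ip_norm A_sa a0_gt0 S_sqrt H1P HmP.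
Let Ae_linear := A_ext_linear ip_norm A_sa a0_gt0 S_sqrt H1P HmP.
Let AeB := A_extB ip_norm A_sa a0_gt0 S_sqrt H1P HmP.
Let ip1P := energy_ip_inner ip_norm S_sqrt H1P.
Let ip1n := energy_ip_rnorm ip_norm H1P.
Let ipP := dot_inner ip_norm.
Let ipn := dot_rnorm ip_norm.

Lemma Ae_inj : injective Ae.
Proof.
move=> x y E; apply/eqP; rewrite -subr_eq0; apply/eqP/rnorm_eq0.
by rewrite -Ae_isom AeB E subrr rnorm0.
Qed.

(** Composition with the inverse of the isometry A. *)
Lemma ex_lift (V : lmodType R[i]) (f : {linear V -> Hm}) :
  exists g : {linear V -> H1}, forall x, Ae (g x) = f x.
Proof.
have /choice[g gE] x := Ae_surj (f x).
have [|g' gg] := @ex_linear _ _ _ g.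
  by move=> a x y; apply: Ae_inj; rewrite Ae_linear !gE linearP.
by exists g' => x; rewrite gg.
Qed.

Variables (N : {linear H -> H1}) (B : {linear H1 -> H1}).
Hypotheses (NE : forall h, Ae (N h) = j h) (BE : forall x, Ae (B x) = D x).
Local Notation r x := (Rea (ip1 (B x) x)).

Lemma N_adj h y : ip1 (N h) y = ip h (i1 y).
Proof.
have [u uj hu] := j_core ip_norm A_sa a0_gt0 S_sqrt H1P HmP h.
by rewrite -hu; congr (energy_ip _ _ _ _ y); apply: Ae_inj; rewrite NE.
Qed.

Lemma N_norm h : rnorm (N h) = rnorm (j h).
Proof. by rewrite -Ae_isom NE. Qed.

Lemma B_norm x : rnorm (B x) = rnorm (D x).
Proof. by rewrite -Ae_isom BE. Qed.

Lemma N_dense : dense (range N).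
Proof.
apply/dense_rnormP => x e e0; have [jd _] := HmP.
have [_ [h _ <-] hx] := (dense_rnormP _).1 jd (Ae x) e e0.
by exists (N h); [exists h|rewrite -Ae_isom AeB NE].
Qed.

Lemma pairing_B x y : pairing ip i1 j (D x) y = ip1 (B x) y.
Proof. by rewrite -BE (pairing_A ip_norm A_sa a0_gt0 S_sqrt H1P HmP). Qed.

Lemma rform_B x : rform ip i1 j D x = r x.
Proof. by rewrite /rform pairing_B. Qed.

Lemma iform_B x : iform ip i1 j D x = Ima (ip1 (B x) x).
Proof. by rewrite /iform pairing_B. Qed.

Let T := opT A i1 j D.

Lemma get_i1 x : get [set y | i1 y = i1 x] = x.
Proof.
have [i_inj _ _] := H1P; apply: i_inj.
exact: (@getPex _ [set y | i1 y = i1 x] (ex_intro _ x erefl)).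
Qed.

Lemma opT_dom w : opdom T w <-> exists x z, w.1 = i1 x /\ B x + w.2 = N z.
Proof.
rewrite /T /=; split=> [[[x _ xw] [z _]]|[x [z [wx wz]]]].
  rewrite -xw get_i1 => zE; exists x, z; split=> //.
  have AeD u v : Ae (u + v) = Ae u + Ae v by have := Ae_linear 1 u v; rewrite !scale1r.
  by apply: Ae_inj; rewrite NE AeD BE.
split; first by exists x.
exists z => //; rewrite wx get_i1 -NE -wz -BE.
by have := Ae_linear 1 (B x) w.2; rewrite !scale1r.
Qed.

Lemma j_inj h h' : j h = j h' -> h = h'.
Proof.
move=> E; have [_ hj] := HmP.
have hS : rnorm (op_inv S (h - h')) = 0.
  have := hj (h - h'); rewrite linearB E subrr normr0 => /esym h0.
  by rewrite /rnorm h0.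
have [x Sx xh] := S_surj ip_norm A_sa a0_gt0 S_sqrt (h - h').
move: hS; rewrite -xh (op_invK ip_norm A_sa a0_gt0 S_sqrt Sx) => /rnorm_eq0 x0.
apply/eqP; rewrite -subr_eq0 -xh x0.
have [S0 SL] := S_linear S_sqrt.
by have := (SL (-1) 0 0 S0 S0).2; rewrite scaler0 addr0 scaleN1r addNr => ->.
Qed.

Lemma opT_val w x z : w.1 = i1 x -> B x + w.2 = N z -> T w = (- z, x).
Proof.
move=> wx wz; rewrite /T /= wx get_i1; congr (- _, _); apply: j_inj.
have E : D x + Ae w.2 = j z.
  rewrite -NE -wz -BE.
  by have := Ae_linear 1 (B x) w.2; rewrite !scale1r.
by rewrite E (@getPex _ [set y | j y = j z] (ex_intro _ z erefl)).
Qed.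

Lemma pencil_B l x : pencil A i1 j D l x = Ae (pencil1 i1 N B l x).
Proof.
rewrite /pencil /pencil1 -NE -BE -[in RHS]addrA.
by rewrite (Ae_linear (l ^+ 2) (N (i1 x))) (Ae_linear l (B x)) addrA.
Qed.

Lemma pencil_regular l : pencil_resolvent_set A i1 j D l <-> pencil1_regular i1 N B l.
Proof.
split=> -[G [Gc GK KG]].
  have [C C0 hC] := (linear_continuousP _).1 Gc.
  have [|g gE] := @ex_linear _ _ _ (fun x => G (Ae x)).
    by move=> a x y; rewrite Ae_linear linearP.
  exists g; split.
  - by apply/linear_continuousP; exists C => // x; rewrite gE -(Ae_isom x).
  - by move=> x; apply: Ae_inj; rewrite -pencil_B gE GK.
  - by move=> x; rewrite gE -pencil_B KG.
have [C C0 hC] := (linear_continuousP _).1 Gc.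
have [Ai AiE] := ex_lift idfun.
have [|g gE] := @ex_linear _ _ _ (fun x => G (Ai x)).
  by move=> a x y; rewrite !linearP.
exists g; split.
- apply/linear_continuousP; exists C => // x; rewrite gE.
  by have := hC (Ai x); rewrite -(Ae_isom (Ai x)) AiE.
- by move=> x; rewrite pencil_B gE GK AiE.
- by move=> x; rewrite gE -[RHS]KG; congr (G _); apply: Ae_inj; rewrite AiE pencil_B.
Qed.

Hypothesis delta_gt0 : 0 < delta ip i1 j D.
Local Notation al := (alpha ip i1 j D).
Local Notation be := (beta ip i1 j D).
Local Notation de := (delta ip i1 j D).
Local Notation nD := (normD D).
Let kap := (Num.sqrt (lower_bound ip A))^-1.

Lemma kap_gt0 : 0 < kap. Proof. by rewrite invr_gt0 sqrtr_gt0. Qed.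

Lemma embedding_bound x : rnorm (i1 x) <= kap * rnorm x.
Proof. exact: (i1_bounded ip_norm A_sa a0_gt0 S_sqrt H1P). Qed.

Lemma delta_le_form x : de * rnorm x ^+ 2 <= r x.
Proof.
have [->|x0] := eqVneq x 0.
  by rewrite rnorm0 expr0n mulr0 (inner0r ip1P).
have x2 : 0 < rnorm x ^+ 2 by rewrite exprn_gt0 // rnorm_gt0.
rewrite -ler_pdivlMr //; apply: inf_gt0_le => //; exists x => //.
by rewrite rform_B.
Qed.

Lemma embedding_gt0 x : x != 0 -> 0 < rnorm (i1 x).
Proof.
move=> x0; apply: rnorm_gt0; apply: contraNN x0 => /eqP E.
by have [i_inj _ _] := H1P; apply/eqP/i_inj; rewrite E linear0.
Qed.

Lemma embedding2_gt0 x : x != 0 -> 0 < rnorm (j (i1 x)).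
Proof.
move=> x0; apply: rnorm_gt0; apply: contraTN (embedding_gt0 x0) => /eqP E.
have -> : i1 x = 0 by apply: j_inj; rewrite E linear0.
by rewrite rnorm0 ltxx.
Qed.

Lemma embedding_interpolation x : rnorm (i1 x) ^+ 2 <= rnorm (j (i1 x)) * rnorm x.
Proof.
have := inner_CS ip1P (N (i1 x)) x; rewrite !ip1n N_adj N_norm.
by rewrite (innerE ipP) ipn modcR ger0_norm // sqr_ge0.
Qed.

Lemma nonzero_vector : exists x : H1, x != 0.
Proof.
apply: contrapT => nx; move: delta_gt0; rewrite /delta.
have -> : [set x : H1 | x != 0] = set0.
  by apply/seteqP; split=> x //= x0; case: nx; exists x.
by rewrite image_set0 inf0 ltxx.
Qed.

(** As |x|_{-1} <= kap^2 |x|_1, alpha is at least delta/kap^4. *)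
Lemma alpha_gt0 : 0 < al.
Proof.
have k0 := kap_gt0; have [x0 hx0] := nonzero_vector.
apply: (@lt_le_trans _ _ (de / kap ^+ 4)); first by rewrite divr_gt0 // exprn_gt0.
apply: lb_le_inf; first by exists (rform ip i1 j D x0 / rnorm (j (i1 x0)) ^+ 2), x0.
move=> _ [x xn0 <-]; have jx := embedding2_gt0 xn0.
rewrite rform_B ler_pdivlMr ?exprn_gt0 // mulrAC ler_pdivrMr ?exprn_gt0 //.
have h1 : rnorm (j (i1 x)) ^+ 2 <= kap ^+ 4 * rnorm x ^+ 2.
  have -> : kap ^+ 4 * rnorm x ^+ 2 = (kap * (kap * rnorm x)) ^+ 2 by ring.
  rewrite ler_sqr ?nnegrE ?mulr_ge0 ?rnorm_ge0 ?(ltW k0) //.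
  rewrite -N_norm.
  apply: le_trans (N_bound ipP ipn ip1P ip1n k0 embedding_bound N_adj _) _.
  by rewrite ler_pM2l //; exact: embedding_bound.
apply: le_trans (ler_wpM2l (ltW delta_gt0) h1) _.
by rewrite mulrCA [leRHS]mulrC ler_wpM2l ?exprn_ge0 ?(ltW k0) // delta_le_form.
Qed.

Lemma alpha_le_form x : al * rnorm (N (i1 x)) ^+ 2 <= r x.
Proof.
have [->|x0] := eqVneq x 0.
  by rewrite !linear0 rnorm0 expr0n mulr0 (inner0r ip1P).
rewrite N_norm -ler_pdivlMr ?exprn_gt0 ?embedding2_gt0 //.
by apply: inf_gt0_le; [exact: alpha_gt0|exists x => //; rewrite rform_B].
Qed.

(** By interpolation, |x|^2 <= |x|_{-1} |x|_1. *)
Lemma beta_ge_sqrt : Num.sqrt (al * de) <= be.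
Proof.
have [x0 hx0] := nonzero_vector.
apply: lb_le_inf; first by exists (rform ip i1 j D x0 / rnorm (i1 x0) ^+ 2), x0.
move=> _ [x xn0 <-]; have ix := embedding_gt0 xn0.
have r0 : 0 <= r x.
  by apply: le_trans (delta_le_form x); rewrite mulr_ge0 ?sqr_ge0 // ltW.
rewrite rform_B ler_pdivlMr ?exprn_gt0 //.
apply: le_trans (ler_wpM2l (sqrtr_ge0 _) (embedding_interpolation x)) _.
have a0 := alpha_gt0.
rewrite -ler_sqr ?nnegrE ?mulr_ge0 ?sqrtr_ge0 ?rnorm_ge0 //.
rewrite exprMn sqr_sqrtr ?mulr_ge0 ?(ltW a0) ?(ltW delta_gt0) //.
have -> : al * de * (rnorm (j (i1 x)) * rnorm x) ^+ 2 =
   (al * rnorm (N (i1 x)) ^+ 2) * (de * rnorm x ^+ 2) by rewrite N_norm; ring.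
rewrite expr2; apply: ler_pM; rewrite ?alpha_le_form ?delta_le_form //.
  by apply: mulr_ge0 (ltW a0) (sqr_ge0 _).
by apply: mulr_ge0 (ltW delta_gt0) (sqr_ge0 _).
Qed.

Lemma beta_gt0 : 0 < be.
Proof.
by apply: lt_le_trans beta_ge_sqrt; rewrite sqrtr_gt0 mulr_gt0 // alpha_gt0.
Qed.

Lemma beta_le_form x : be * rnorm (i1 x) ^+ 2 <= r x.
Proof.
have [->|x0] := eqVneq x 0.
  by rewrite !linear0 rnorm0 expr0n mulr0 (inner0r ip1P).
rewrite -ler_pdivlMr ?exprn_gt0 ?embedding_gt0 //.
by apply: inf_gt0_le; [exact: beta_gt0|exists x => //; rewrite rform_B].
Qed.

Lemma lift_bound x : rnorm (B x) <= nD * rnorm x.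
Proof.
have [->|x0] := eqVneq x 0; first by rewrite !linear0 !rnorm0 mulr0.
have x1 := rnorm_gt0 x0; have [C C0 hC] := (linear_continuousP _).1 D_cont.
rewrite B_norm -ler_pdivrMr //.
pose y := ((rnorm x)^-1)%:C *: x.
have ny : rnorm y = 1.
  by rewrite rnormZ modcR gtr0_norm ?invr_gt0 // mulVf // gt_eqF.
have y1 : `|y| = 1 by rewrite rnormE ny.
have -> : rnorm (D x) / rnorm x = rnorm (D y).
  by rewrite /y linearZ_LR rnormZ modcR gtr0_norm ?invr_gt0 // mulrC.
apply: ub_le_sup; last by exists y.
exists C => _ [z z1 <-]; apply: le_trans (hC z) _.
by rewrite /rnorm z1 mulr1.
Qed.

Lemma delta_le_normD : de <= nD.
Proof.
have [x /rnorm_gt0 x0] := nonzero_vector.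
have x2 : 0 < rnorm x ^+ 2 by rewrite exprn_gt0.
rewrite -(ler_pM2r x2); apply: le_trans (delta_le_form x) _.
apply: le_trans (ler_norm _) _; apply: le_trans (inner_Re_CS ip1P _ _) _.
by rewrite !ip1n expr2 mulrA ler_pM2r // lift_bound.
Qed.

End Assembly.

Local Close Scope complex_scope.

Theorem theorem1 (R : realType)
  (H : completeNormedModType R[i]) (ip : {dot H for @Num.conj R[i]})
  (ip_norm : hilbert_norm ip)
  (A S : partial_op H H)
  (A_sa : selfadjoint ip A) (a0_gt0 : 0 < lower_bound ip A)
  (S_sqrt : op_sqrt ip A S)
  (H1 : normedModType R[i]) (i1 : {linear H1 -> H}) (H1P : is_H1 S i1)
  (Hm : completeNormedModType R[i]) (j : {linear H -> Hm}) (HmP : is_Hm1 S j)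
  (D : {linear H1 -> Hm}) (D_cont : continuous D)
  (nu : R) (nu_gt0 : 0 < nu)
  (D_ge0 : forall x : H1, 0 <= rform ip i1 j D x)
  (D_sect : forall x : H1,
     `|iform ip i1 j D x| <= nu * rform ip i1 j D x)
  (delta_gt0 : 0 < delta ip i1 j D) :
  let om := omega ip i1 j D in
  let T := opT A i1 j D in
  [/\ 0 < om,
      exists E : R -> {linear (H * H1)%type -> (H * H1)%type},
        [/\ C0_semigroup E, is_generator T E, analytic_semigroup E &
            exists C : R, forall (t : R) (w : (H * H1)%type), 0 <= t ->
              pnorm (E t w) <= C * expR (- (om * t)) * pnorm w],
      pencil_spectrum A i1 j D = spectrum T &
      forall b : R, 0 <= b -> exists M : R,
        is_M_min ip i1 j D nu b M /\
        spectrum T `<=` [set l | complex.Re l <= - om /\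
          `|complex.Im l| <= M * `|complex.Re l| + b]].
Proof.
move=> om T.
have [N NE] := ex_lift ip_norm A_sa a0_gt0 S_sqrt H1P HmP j.
have [B BE] := ex_lift ip_norm A_sa a0_gt0 S_sqrt H1P HmP D.
have ipP := dot_inner ip_norm; have ipn := dot_rnorm ip_norm.
have ip1P := energy_ip_inner ip_norm S_sqrt H1P; have ip1n := energy_ip_rnorm ip_norm H1P.
have H1c := H1_complete ip_norm A_sa a0_gt0 S_sqrt H1P.
have k0 := kap_gt0 a0_gt0.
have ib := embedding_bound ip_norm A_sa a0_gt0 S_sqrt H1P.
have Nadj := N_adj ip_norm A_sa a0_gt0 S_sqrt H1P HmP NE.
have Bb := lift_bound ip_norm A_sa a0_gt0 S_sqrt H1P HmP D_cont BE.
have a1 := alpha_gt0 ip_norm A_sa a0_gt0 S_sqrt H1P HmP NE BE delta_gt0.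
have b1 := beta_gt0 ip_norm A_sa a0_gt0 S_sqrt H1P HmP NE BE delta_gt0.
have r1 := alpha_le_form ip_norm A_sa a0_gt0 S_sqrt H1P HmP NE BE delta_gt0.
have r2 := beta_le_form ip_norm A_sa a0_gt0 S_sqrt H1P HmP NE BE delta_gt0.
have r3 := delta_le_form ip_norm A_sa a0_gt0 S_sqrt H1P HmP BE delta_gt0.
have bg := beta_ge_sqrt ip_norm A_sa a0_gt0 S_sqrt H1P HmP NE BE delta_gt0.
have dn := delta_le_normD ip_norm A_sa a0_gt0 S_sqrt H1P HmP D_cont BE delta_gt0.
have n0 := lt_le_trans delta_gt0 dn.
have Td := opT_dom ip_norm A_sa a0_gt0 S_sqrt H1P HmP NE BE.
have Tv := opT_val ip_norm A_sa a0_gt0 S_sqrt H1P HmP NE BE.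
have pr := pencil_regular ip_norm A_sa a0_gt0 S_sqrt H1P HmP NE BE.
have hres l : pencil1_regular i1 N B l -> resolvent_set T l.
  exact: (regular_resolvent ipP ipn ip1P ip1n k0 ib Nadj n0 Bb Td Tv).
have hreg l : resolvent_set T l -> pencil1_regular i1 N B l.
  exact: (resolvent_regular Td Tv).
split.
- exact: om_gt0.
- apply: (damped_semigroup (complete_seq_complete (V := H)) H1c ipP ipn ip1P ip1n
    (i1_dense S_sqrt H1P) k0 ib Nadj
    (N_dense ip_norm A_sa a0_gt0 S_sqrt H1P HmP NE) n0 Bb Td Tv a1 b1 delta_gt0
    r1 r2 r3 bg dn).
- rewrite /pencil_spectrum /spectrum; congr (~` _); apply/seteqP; split=> l.
    by move=> /pr/hres.
  by move=> /hreg/pr.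
- move=> b b0; have [th [th1 th2] thmin] := sector_const_min nu b0 delta_gt0 b1.
  exists (M_theta ip i1 j D nu b th); split.
    by split; [exists th|move=> _ [t [t1 t2] <-]; exact: thmin].
  move=> l nl; split.
    rewrite leNgt; apply/negP => h; apply: nl; apply: hres.
    apply: (halfplane_regular H1c ipP ipn ip1P ip1n k0 ib Nadj n0 Bb a1 b1 delta_gt0
      r1 r2 r3 bg dn); exact: ltW.
  rewrite leNgt; apply/negP => h; apply: nl; apply: hres.
  have [l0|l0] := leP (complex.Re l) 0; last first.
    apply: (halfplane_regular H1c ipP ipn ip1P ip1n k0 ib Nadj n0 Bb a1 b1 delta_gt0
      r1 r2 r3 bg dn); apply: le_trans (ltW l0); rewrite oppr_le0 ltW //.
    exact: om_gt0.
  apply: (sector_regular H1c ipP ipn ip1P ip1n k0 ib Nadj n0 Bb b1 delta_gt0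
    (ltW nu_gt0) r2 r3 _ l0 b0 th1 th2 h).
  move=> x; rewrite -(iform_B ip_norm A_sa a0_gt0 S_sqrt H1P HmP BE).
  by rewrite -(rform_B ip_norm A_sa a0_gt0 S_sqrt H1P HmP BE).
Qed.
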